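(* Let $\Sigma=\mathbb{D}/\Gamma$ be a compact Riemann surface of genus $\ge 2$ and $\Omega=(\mathbb{D}\times\mathbb{D})/\Gamma$ (diagonal action). Then the Hardy space $A^2_{-1}(\Omega)$ consists of constant functions only. In particular, there is no bounded holomorphic function on $\Omega$ except constant functions.
   Context: $\mathbb{D}\subset\mathbb{C}$ is the unit disk, $\Gamma<\mathrm{Aut}(\mathbb{D})=PSU(1,1)$ is a Fuchsian group such that $\mathbb{D}\to\Sigma=\mathbb{D}/\Gamma$ is the universal covering of a compact Riemann surface of genus $\ge 2$. $\Gamma$ acts on $\mathbb{D}\times\mathbb{D}$ by $\gamma\cdot(z,w)=(\gamma z,\gamma w)$; holomorphic functions on $\Omega$ are identified with $\Gamma$-invariant holomorphic functions on $\mathbb{D}\times\mathbb{D}$, and their space is $\mathcal{O}(\Omega)$. Poincaré metric on $\Sigma$: fundamental form $\omega_g=\frac{2i\,dz\wedge d\bar z}{(1-|z|^2)^2}$, with induced metric on $K_\Sigma^{\otimes n}$ normalized by $|(dz)^{\otimes n}|_g^2=\left(\frac{(1-|z|^2)^2}{2}\right)^n$; for a section $u$ of $K_\Sigma^{\otimes n}$, $\|u\|^2=\int_\Sigma|u|_g^2\,\omega_g$. Associated differentials: for $f\in\mathcal{O}(\Omega)$, expand $f(z,w)=\sum_{n\ge0}f_n(z)t^n$ with $t=\frac{w-z}{1-\bar z w}$ (for each fixed $z\in\mathbb{D}$, the Taylor expansion in $t\in\mathbb{D}$). The $n$-th associated differential $\varphi_n:=f_n(z)\left(\frac{\sqrt2\,dz}{1-|z|^2}\right)^{\otimes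 n}$ is $\Gamma$-invariant and so is a smooth section of $K_\Sigma^{\otimes n}$ on $\Sigma$. Hardy space: $\|f\|_{-1}^2:=\pi\sum_{n=0}^\infty\|\varphi_n\|^2$ and $A^2_{-1}(\Omega):=\{f\in\mathcal{O}(\Omega):\|f\|_{-1}<\infty\}$. *)

(* Defs.v *)
From HB Require Import structures.
From mathcomp Require Import all_boot all_order all_algebra.
From mathcomp Require Import generic_quotient.
From mathcomp Require Import all_classical all_reals all_analysis.
From mathcomp Require Import complex.
Set Implicit Arguments.
Unset Strict Implicit.
Unset Printing Implicit Defensive.
Import Order.TTheory GRing.Theory Num.Theory.
Import numFieldNormedType.Exports.
Local Open Scope classical_set_scope.
Local Open Scope ring_scope.
Local Open Scope complex_scope.
Local Open Scope quotient_scope.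

(* The library puts a topology on an abstract [numClosedFieldType] only; this is
   the same one, on the concrete complex numbers. *)
HB.instance Definition _ (R : realType) := NormedModule.copy R[i] R[i]^o.

(* The modulus of a complex number, as a real number; MathComp's norm on [R[i]]
   is itself [R[i]]-valued. *)
Definition cmod (R : realType) (z : R[i]) : R := complex.Re `|z|.
Arguments cmod {R} z.

Definition disk (R : realType) : set R[i] := [set z | cmod z < 1].
Arguments disk : clear implicits.

(* [g] is the class in PSU(1,1) = SU(1,1)/{1,-1} of the matrix with rows (a, b)
   and (b^*, a^* ). As the action of PSU(1,1) on the disk is faithful, we
   identify Aut(D) with the transformations of this form. *)
Definition su11 (R : realType) (a b : R[i]) (g : disk R -> disk R) : Prop :=
  cmod a ^+ 2 - cmod b ^+ 2 = 1 /\
  forall z : disk R,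
    set_val (g z) = (a * set_val z + b) / (b^* * set_val z + a^*).

(* Discreteness says that the identity is isolated for the topology induced by
   SU(1,1). *)
Record fuchsian (R : realType) := Fuchsian {
  fuchsian_set :> (disk R -> disk R) -> Prop;
  fuchsian_aut : forall g, fuchsian_set g -> exists a b, su11 a b g;
  fuchsian_id : fuchsian_set id;
  fuchsian_comp : forall g h,
    fuchsian_set g -> fuchsian_set h -> fuchsian_set (g \o h);
  fuchsian_inv : forall g, fuchsian_set g ->
    exists2 h, fuchsian_set h & cancel g h /\ cancel h g;
  fuchsian_discrete : exists2 e : R, 0 < e &
    forall g a b, fuchsian_set g -> su11 a b g ->
      cmod (a - 1) < e -> cmod b < e -> g = id
}.

Section Surface.
Variables (R : realType) (G : fuchsian R).

Definition orbit_rel (z w : disk R) : bool := `[< exists2 g, G g & g z = w >].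

Lemma orbit_rel_refl : reflexive orbit_rel.
Proof. by move=> z; apply/asboolP; exists id => //; exact: fuchsian_id. Qed.

Lemma orbit_rel_sym : symmetric orbit_rel.
Proof.
have sub z w : orbit_rel z w -> orbit_rel w z.
  move=> /asboolP[g Gg <-]; apply/asboolP.
  by have [h Gh [gh _]] := fuchsian_inv Gg; exists h.
by move=> z w; apply/idP/idP; exact: sub.
Qed.

Lemma orbit_rel_trans : transitive orbit_rel.
Proof.
move=> y x z /asboolP[g Gg <-] /asboolP[h Gh <-]; apply/asboolP.
by exists (h \o g) => //; exact: fuchsian_comp.
Qed.

Canonical orbit_equiv :=
  EquivRel orbit_rel orbit_rel_refl orbit_rel_sym orbit_rel_trans.

(* The quotient of the disk by the group, with the quotient topology. *)
Definition surface : topologicalType :=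
  quotient_topology {eq_quot orbit_equiv}.

(* The quotient map is a covering map whose group of deck transformations is
   [G]; as the disk is simply connected, it is then the universal covering. *)
Definition covering_action : Prop :=
  forall z : disk R, exists2 U : set (disk R), open_nbhs z U &
    forall g, G g -> g <> id -> (g @` U) `&` U = set0.

(* O(Omega): a holomorphic function on the quotient of the bidisk by the
   diagonal action is an invariant holomorphic function on the bidisk. Functions
   are total on C^2 and only their values on the bidisk matter; [differentiable]
   is here differentiability over the field [R[i]]. *)
Definition holo_Omega (f : R[i] * R[i] -> R[i]) : Prop :=
  (forall z w, disk R z -> disk R w -> differentiable f (z, w)) /\
  (forall g, G g -> forall z w : disk R,
    f (set_val (g z), set_val (g w)) = f (set_val z, set_val w)).

(* [c n z] is the coefficient f_n(z) of the expansion of [f] in powers of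
   t = (w - z)/(1 - z^* w). For [z] in the disk it is uniquely determined by
   [f], since t ranges over the whole disk. *)
Definition taylor_expansion (f : R[i] * R[i] -> R[i])
    (c : nat -> R[i] -> R[i]) : Prop :=
  forall z w, disk R z -> disk R w ->
    series (fun n => c n z * ((w - z) / (1 - z^* * w)) ^+ n) @ \oo
      --> f (z, w).

(* The Dirichlet fundamental domain of [G] centred at 0, in real coordinates:
   the hyperbolic distance from 0 to z is an increasing function of |z|. *)
Definition dirichlet_domain : set (R * R) :=
  [set p | exists2 z : disk R, set_val z = p.1 +i* p.2 &
     forall g, G g -> cmod (set_val z) <= cmod (set_val (g z))].

(* The density with respect to dx dy of the Poincare area form
   2 i dz /\ dz^* / (1 - |z|^2)^2, where i dz /\ dz^* = 2 dx dy. *)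
Definition poincare_density (z : R[i]) : R := 4 / (1 - cmod z ^+ 2) ^+ 2.

(* The squared pointwise norm |u|_g^2 at [z] of the differential
   u = h(z) dz^n. *)
Definition diff_norm2 (n : nat) (h : R[i] -> R[i]) (z : R[i]) : R :=
  cmod (h z) ^+ 2 * ((1 - cmod z ^+ 2) ^+ 2 / 2) ^+ n.

(* ||u||^2 for an invariant differential u = h(z) dz^n. The integral over the
   surface is computed on the Dirichlet domain, whose translates cover the disk
   and overlap only in null sets. *)
Definition diff_L2norm2 (n : nat) (h : R[i] -> R[i]) : \bar R :=
  (\int[(lebesgue_measure \x lebesgue_measure)%E]_(p in dirichlet_domain)
     (diff_norm2 n h (p.1 +i* p.2) * poincare_density (p.1 +i* p.2))%:E)%E.

(* The coefficient of dz^n in the n-th associated differential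
   f_n(z) (sqrt 2 dz / (1 - |z|^2))^n. *)
Definition assoc_diff (c : nat -> R[i] -> R[i]) (n : nat) (z : R[i]) : R[i] :=
  c n z * ((Num.sqrt 2 / (1 - cmod z ^+ 2)) ^+ n)%:C.

Definition hardy_norm2 (c : nat -> R[i] -> R[i]) : \bar R :=
  (pi%:E * \sum_(0 <= n <oo) diff_L2norm2 n (assoc_diff c n))%E.

Definition hardy_space : set (R[i] * R[i] -> R[i]) :=
  [set f | holo_Omega f /\
     exists2 c, taylor_expansion f c & (hardy_norm2 c < +oo)%E].

End Surface.

Definition constant_on_bidisk (R : realType) (f : R[i] * R[i] -> R[i]) : Prop :=
  exists k, forall z w, disk R z -> disk R w -> f (z, w) = k.

Definition bounded_on_bidisk (R : realType) (f : R[i] * R[i] -> R[i]) : Prop :=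
  exists M : R, forall z w, disk R z -> disk R w -> cmod (f (z, w)) <= M.

(* Main.v *)
From HB Require Import structures.
Require Import Defs.
From mathcomp Require Import all_boot all_order all_algebra.
From mathcomp Require Import all_classical all_reals all_analysis.
From mathcomp Require Import measurable_realfun simple_functions.
From mathcomp Require Import complex.
From mathcomp Require Import ring lra.
Set Implicit Arguments.
Unset Strict Implicit.
Unset Printing Implicit Defensive.
Import Order.TTheory GRing.Theory Num.Theory.
Import numFieldNormedType.Exports.
Local Open Scope classical_set_scope.
Local Open Scope ring_scope.

(* Push an invariant radial probability kernel Psi through |f|^2 and integrate
   over a fundamental domain: the energy of Psi is the integral of
   int Psi(z, w) |f(z, w)|^2 dw. If f is bounded this is at most sup |f|^2 times
   the area of the surface; if f is in the Hardy space, the mean value property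
   gives int Psi(z, w) |f(z, w)|^2 dw <= sum_n |f_n(z)|^2 (recentre at z and peel
   off one power of t at a time), so that the energy is at most the Hardy norm.
   Now replace Psi by its composition with the normalised indicator Chi of a
   hyperbolic ball. Unfolding the double integral over the group exchanges the
   roles of z and of its neighbour z', and the mean value property in each
   variable shows that the energy grows by at least the integral of
   int Chi(z, z') |f(z', z) - f(z, z)|^2 dz', which does not depend on Psi. The
   energies being bounded, that integral vanishes and f(z', z) = f(z, z) for all
   z and z'. So f depends on its second variable only; its restriction to the
   diagonal is invariant, hence bounded by compactness, and the same argument
   with the two variables exchanged shows that f is constant. *)

(** No limit of iterated kernels is taken. With L the supremum of the energies over all radial
    kernels and g0 the gain of one step, composing with Chi maps kernels to kernels and gives L + g0
    <= L; finiteness of L forces g0 = 0. This replaces boundary values and ergodicity of the group.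
    Chi has to be symmetric, because unfolding turns Chi(z, z') into Chi(z', z); a ball of any
    radius below 1 is allowed, so every pair of points is reached. All integrands are non-negative,
    so Tonelli applies throughout and infinite values are harmless. The second application of the
    argument cannot rest on the Hardy norm: that norm expands f in its second variable about the
    first, and nothing of the kind is known once the variables are exchanged. Boundedness survives
    the exchange, and this is why the diagonal has to be bounded in between. Two domains coexist:
    the Dirichlet domain, on which the norm is computed and whose translates may overlap, and a
    strict measurable fundamental domain, on which unfolding is exact; an inequality links them. *)

Section density_measure.
Local Open Scope ereal_scope.
Context d d' (X : measurableType d) (Y : measurableType d') (R : realType).
Variables (m : {measure set X -> \bar R}) (T : X -> Y) (J : X -> R).
Hypothesis mT : measurable_fun setT T.
Hypothesis mJ : measurable_fun setT J.
Hypothesis J0 : forall x, (0 <= J x)%R.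

(** The image under [T] of the measure with density [J]. It is a measure for every measurable [T],
    injective or not, so uniqueness of Lebesgue measure can be applied to it. *)
Definition density_image (A : set Y) : \bar R := \int[m]_(x in T @^-1` A) (J x)%:E.

Let mpre A : measurable A -> measurable (T @^-1` A).
Proof. by move=> mA; rewrite -[X in measurable X]setTI; exact: mT. Qed.

Let density_image0 : density_image set0 = 0.
Proof. by rewrite /density_image preimage_set0 integral_set0. Qed.

Let density_image_ge0 A : 0 <= density_image A.
Proof. by apply: integral_ge0 => x _; rewrite lee_fin. Qed.

Let density_image_sigma_additive : semi_sigma_additive density_image.
Proof.
move=> F mF tF mUF; rewrite /density_image preimage_bigcup.
rewrite ge0_integral_bigcup//=.
- by apply: is_cvg_nneseries => n _ _; apply: integral_ge0 => x _; rewrite lee_fin.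
- by move=> k; exact: mpre.
- apply/measurable_EFinP; exact: measurable_funTS.
- by move=> x _; rewrite lee_fin.
- apply/trivIsetP => /= i j _ _ ij; rewrite -preimage_setI.
  by move/trivIsetP : tF => /(_ _ _ _ _ ij) ->//; rewrite preimage_set0.
Qed.

HB.instance Definition _ := isMeasure.Build _ _ _
  density_image density_image0 density_image_ge0 density_image_sigma_additive.

Definition density_measure : {measure set Y -> \bar R} := density_image.

Variable m' : {measure set Y -> \bar R}.

Import HBNNSimple.

(** Equality of the measures on sets is the formula for indicators; it extends to simple functions
    by linearity and to [F] by monotone convergence. [T] need not be smooth, so it may be glued from
    pieces. *)
Lemma ge0_change_of_variable (F : Y -> \bar R) :
  (forall A, measurable A -> density_image A = m' A) ->
  measurable_fun setT F -> (forall y, 0 <= F y) ->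
  \int[m]_x (F (T x) * (J x)%:E) = \int[m']_y F y.
Proof.
move=> TE mF F0.
pose f_ := nnsfun_approx measurableT mF.
have fF y : (f_ n y)%:E @[n --> \oo] --> F y by exact: cvg_nnsfun_approx.
have indicE A : measurable A -> \int[m]_x ((\1_A (T x))%:E * (J x)%:E) = m' A.
  move=> mA; rewrite -TE// /density_image [RHS]integral_mkcond; apply: eq_integral => x _.
  rewrite patchE indicE.
  have -> : (x \in T @^-1` A) = (T x \in A) by apply/idP/idP; rewrite !inE.
  by case: ifP => _; rewrite ?mul1e ?mul0e.
have mfT n : measurable_fun setT (fun x => f_ n (T x)) by exact: measurableT_comp.
transitivity (limn (fun n => \int[m]_x ((f_ n (T x))%:E * (J x)%:E))).
  rewrite -monotone_convergence//.
  - apply: eq_integral => x _; apply/esym/cvg_lim => //.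
    rewrite muleC; under eq_cvg do rewrite muleC.
    by apply: cvgeZl => //; exact: fF.
  - move=> n; apply: emeasurable_funM; exact/measurable_EFinP.
  - by move=> n x _; rewrite mule_ge0// lee_fin.
  - move=> x _ a b ab; rewrite lee_wpmul2r ?lee_fin//; exact/lefP/nd_nnsfun_approx.
transitivity (limn (fun n => \int[m']_x (f_ n x)%:E)); last first.
  rewrite -monotone_convergence//.
  - by apply: eq_integral => x _; apply/cvg_lim => //; exact: fF.
  - by move=> n; exact/measurable_EFinP.
  - by move=> n x _; rewrite lee_fin.
  - by move=> x _ a b ab; rewrite lee_fin; exact/lefP/nd_nnsfun_approx.
congr (limn _); apply/funext => n.
transitivity (\sum_(k \in range (f_ n)) (k%:E * m' (f_ n @^-1` [set k]))); last first.
  by rewrite integralT_nnsfun sintegralE.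
transitivity (\int[m]_x (\sum_(k \in range (f_ n))
   (k%:E * ((\1_(f_ n @^-1` [set k]) (T x))%:E * (J x)%:E)))).
  apply: eq_integral => x _.
  rewrite [in LHS]fimfunE -fsumEFin// ge0_mule_fsuml; last first.
    (* A negative value has an empty preimage under a non-negative function, so its term is zero. *)
    move=> r; case: (ltP r 0%R) => r0; last by rewrite lee_fin mulr_ge0.
    by rewrite preimage_nnfun0// indic0 mulr0.
  by apply: eq_fsbigr => r _; rewrite EFinM muleA.
rewrite ge0_integral_fsum//.
- apply: eq_fsbigr => r; rewrite inE => -[y _ <-].
  rewrite ge0_integralZl_EFin// ?indicE//.
  + by move=> x _; rewrite mule_ge0// lee_fin.
  + apply: emeasurable_funM; apply/measurable_EFinP => //.
    by apply: measurableT_comp => //; exact: measurable_indic.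
- move=> r; apply: emeasurable_funM => //; apply: emeasurable_funM; apply/measurable_EFinP => //.
    by apply: measurableT_comp => //; exact: measurable_indic.
- move=> r x _; case: (ltP r 0%R) => r0; last by rewrite !mule_ge0// lee_fin.
  by rewrite preimage_nnfun0// indic0 mul0e mule0.
Qed.

End density_measure.

(** * Affine substitutions on the real line *)

Section real_substitution.
Variable R : realType.
Local Notation mu := (@lebesgue_measure R).

Lemma measurable_inv : measurable_fun [set: R] (@GRing.inv R).
Proof.
rewrite (_ : [set: R] = [set~ 0] `|` [set 0]); last first.
  by apply/seteqP; split => // x _; case: (eqVneq x 0) => [->|/eqP]; [right|left].
apply/measurable_funU => //; first exact: measurableC.
split; last exact: measurable_fun_set1.
apply: open_continuous_measurable_fun; first by rewrite openC; exact:
  (accessible_closed_set1 (hausdorff_accessible (@Rhausdorff R))).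
by move=> x; rewrite inE => /eqP x0; exact: inv_continuous.
Qed.


(** By uniqueness of Lebesgue measure, lengths of half-open intervals suffice; for k < 0 the
    preimage is open at the other end, which does not change its length. *)
Lemma ge0_integral_affine (F : R -> \bar R) (k l : R) : (k != 0)%R ->
  measurable_fun setT F -> (forall x, 0 <= F x)%E ->
  (\int[mu]_x (F (k * x + l)%R * (`|k|%R)%:E) = \int[mu]_x F x)%E.
Proof.
move=> k0 mF F0.
have mT : measurable_fun [set: R] (fun x => k * x + l)%R.
  by apply: measurable_funD => //; exact: mulrl_measurable.
have -> // := @ge0_change_of_variable _ _ (measurableTypeR R) (measurableTypeR R) R mu (fun x =>
  k * x + l)%R (fun=> `|k|%R) mT _ _ mu F _ mF F0.
move=> A mA; have mk : measurable_fun [set: R] (fun=> `|k|%R) by [].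
have k_ge0 (x : R) : (0 <= `|k|)%R by [].
apply/esym; apply: (@lebesgue_measure_unique R
  (@density_measure _ _ (measurableTypeR R) (measurableTypeR R) R mu _ _ mT mk k_ge0)) => //=
    _ [[a b]] _ <- /=.
rewrite /density_image.
rewrite (integral_cst _ _ (`|k|%R)%:E)//; last first.
  by rewrite -[X in measurable X]setTI; exact: mT.
have -> : (fun x => k * x + l)%R @^-1` `]a, b]%classic =
    if (0 < k)%R then `](a - l) / k, (b - l) / k]%classic else `[(b - l) / k, (a - l) / k[%classic.
  apply/seteqP; case: (ltgtP k 0%R) k0 => // k0 _; split => x /=; rewrite !in_itv/=.
  - by rewrite ltr_ndivlMr// ler_ndivrMr// mulrC ltrBlDr lerBrDr => /andP[-> ->].
  - by rewrite ltr_ndivlMr// ler_ndivrMr// mulrC ltrBlDr lerBrDr => /andP[-> ->].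
  - by rewrite ltr_pdivrMr// ler_pdivlMr// mulrC ltrBlDr lerBrDr => /andP[-> ->].
  - by rewrite ltr_pdivrMr// ler_pdivlMr// mulrC ltrBlDr lerBrDr => /andP[-> ->].
rewrite lebesgue_measure_itv/= lte_fin -EFinB.
case: (ltgtP 0 k) k0 => // k0 _.
- have -> := lebesgue_measure_itv `](a - l) / k, (b - l) / k].
  rewrite /= lte_fin -EFinB ltr_pM2r ?invr_gt0// ltrD2r; case: ifP => _; last by rewrite mule0.
  rewrite -EFinM gtr0_norm//; congr EFin; by field; rewrite gt_eqF.
- have -> := lebesgue_measure_itv `[(b - l) / k, (a - l) / k[.
  rewrite /= lte_fin -EFinB ltr_nM2r ?invr_lt0// ltrD2r; case: ifP => _; last by rewrite mule0.
  rewrite -EFinM ltr0_norm//; congr EFin; by field; rewrite lt_eqF.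
Qed.

End real_substitution.

(** * The inversion x -> 1/(k x) of the real line *)

Section real_inversion.
Variable R : realType.
Local Notation mu := (@lebesgue_measure R).

Lemma ge0_integral_halves (F : R -> \bar R) :
  measurable_fun setT F -> (forall x, 0 <= F x)%E ->
  (\int[mu]_x F x = \int[mu]_(x in `]0%R, +oo[) F x
     + \int[mu]_(x in `]0%R, +oo[) F (- x)%R)%E.
Proof.
move=> mF F0.
have mFN : measurable_fun setT (fun x : R => F (- x)) by exact: measurableT_comp.
have mS (D : set R) (G : R -> \bar R) : measurable_fun setT G -> measurable_fun D G.
  exact: measurable_funS.
rewrite (integral_itv_obnd_cbnd (f := fun x => F (- x))); last exact: mS.
rewrite (@ge0_integration_by_substitution0 R (fun x => F (- x)))//.
under [X in (_ = _ + X)%E]eq_integral do rewrite opprK.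
have -> : [set: R] = `]0, +oo[%classic `|` `]-oo, 0]%classic.
  apply/seteqP; split => // x _ /=; rewrite !in_itv/= andbT.
  by case: (ltP 0 x); [left|right].
rewrite ge0_integral_setU//; first exact: mS.
apply/disj_set2P; apply/seteqP; split => // x [] /=; rewrite !in_itv/= andbT.
by rewrite ltNge => /negP.
Qed.

(* Inverting the positive half-line and fixing the other one gives a bijection
   of the line, so that uniqueness of Lebesgue measure applies. *)
Let T (k x : R) : R := if 0 < x then (k * x)^-1 else x.
Let J (k x : R) : R := if 0 < x then (k * x ^+ 2)^-1 else 1.

Let mT k : measurable_fun [set: R] (T k).
Proof.
apply: measurable_fun_ifT => //; first exact: measurable_fun_ltr.
by apply: measurableT_comp; [exact: measurable_inv|exact: mulrl_measurable].
Qed.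

Let mJ k : measurable_fun [set: R] (J k).
Proof.
apply: measurable_fun_ifT => //; first exact: measurable_fun_ltr.
apply: measurableT_comp; first exact: measurable_inv.
by apply: measurable_funM => //; exact: exprn_measurable.
Qed.

Let J0 k : 0 < k -> forall x, 0 <= J k x.
Proof.
move=> k0 x; rewrite /J; case: ifP => // x0.
by rewrite invr_ge0 mulr_ge0 ?sqr_ge0// ltW.
Qed.

Let inv_swap (k x c : R) : 0 < k -> 0 < x -> 0 < c ->
  ((k * x)^-1 <= c) = ((k * c)^-1 <= x).
Proof.
move=> k0 x0 c0; rewrite -(div1r (k * x)) -(div1r (k * c)) !ler_pdivrMr ?mulr_gt0//;
  congr (_ <= _); ring.
Qed.

(** The preimage of ]0, c] is [1/(k c), +oo[, and -1/(k x), a primitive of [J] there, vanishes at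
    infinity. *)
Let nu_0c k c : 0 < k -> 0 < c -> density_image mu (T k) (J k) `]0, c]%classic = c%:E.
Proof.
move=> k0 c0; rewrite /density_image.
have dT (x : R) : 0 < x -> is_derive x 1 (fun x : R => - (k * x)^-1) (k * x ^+ 2)^-1.
  move=> x0; have kx0 : k * x != 0 by rewrite mulf_neq0// gt_eqF.
  have h : is_derive x 1 (fun y : R => k * y) k.
    by apply: is_derive_eq; rewrite /GRing.scale/= mulr1.
  have h2 := is_deriveN (is_deriveV kx0 h).
  apply: is_derive_eq.
  by rewrite /GRing.scale/=; field; rewrite !gt_eqF.
have kc0 : 0 < (k * c)^-1 by rewrite invr_gt0 mulr_gt0.
have -> : T k @^-1` `]0, c] = `[(k * c)^-1, +oo[%classic.
  apply/seteqP; split => x /=; rewrite /T !in_itv/= andbT.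
    by case: ifPn => [x0 /andP[_]|/negbTE -> //]; rewrite inv_swap.
  move=> kx; have x0 : 0 < x by rewrite (lt_le_trans _ kx).
  by rewrite x0 invr_gt0 mulr_gt0//= inv_swap.
under eq_integral => x.
  rewrite inE /= in_itv/= andbT => kx.
  rewrite /J (lt_le_trans _ kx)//.
  over.
rewrite (@ge0_continuous_FTC2y R _ (fun x => - (k * x)^-1) _ 0)//.
- by rewrite sub0e -EFinN opprK; congr EFin; field; rewrite !gt_eqF.
- by move=> x kx; rewrite invr_ge0 mulr_ge0 ?sqr_ge0// ltW.
- apply: continuous_in_subspaceT => x; rewrite inE/= in_itv/= andbT => kx.
  apply: cvgV; first by rewrite mulf_neq0 ?expf_neq0// gt_eqF// (lt_le_trans kc0).
  by apply: cvgZr => //; exact: exprn_continuous.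
- rewrite -oppr0; apply: cvgN.
  apply/gtr0_cvgV0; first by near=> x; rewrite mulr_gt0//; near: x; exact: nbhs_pinfty_gt.
  exact: gt0_cvgMry.
- by move=> x kx; have [] := dT x (lt_trans kc0 kx).
- apply: cvg_at_right_filter; apply: (@differentiable_continuous _ _ _ _ (fun x :
  R => - (k * x)^-1)).
  by apply/derivable1_diffP; have [] := dT _ kc0.
- by move=> x; rewrite in_itv/= andbT => kx; rewrite derive1E;
  have [_ ->] := dT x (lt_trans kc0 kx).
Unshelve. all: by end_near. Qed.

(** Intervals are cut at 0. For 0 < a the mass is a difference of two masses given by [nu_0c], both
    finite. *)
Let nu_oc k a b : 0 < k -> a < b ->
  density_image mu (T k) (J k) `]a, b]%classic = (b - a)%:E.
Proof.
move=> k0 ab.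
pose nu : {measure set (measurableTypeR R) -> \bar R} :=
  @density_measure _ _ (measurableTypeR R) (measurableTypeR R) R mu _ _ (mT k) (mJ k) (J0 k0).
have nu_le0 x y : x < y -> y <= 0 -> nu `]x, y]%classic = (y - x)%:E.
  move=> xy y0; rewrite /nu /= /density_image.
  have -> : T k @^-1` `]x, y] = `]x, y]%classic.
    apply/seteqP; split => z /=; rewrite /T !in_itv/=.
      case: ifP => // z0 /andP[_]; rewrite leNgt (le_lt_trans y0)//.
      by rewrite invr_gt0 mulr_gt0.
    by case: ifP => // z0 /andP[_]; rewrite leNgt (le_lt_trans y0).
  under eq_integral => z.
    rewrite inE /= in_itv/= => /andP[_ zy].
    rewrite /J ltNge (le_trans zy)//=.
    over.
  rewrite (integral_cst _ _ 1%E)// mul1e.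
  transitivity (mu `]x, y]%classic) => //.
  by rewrite lebesgue_measure_itv/= lte_fin xy EFinB.
have nuU x y z : x < y -> y < z ->
    nu `]x, z]%classic = (nu `]x, y]%classic + nu `]y, z]%classic)%E.
  move=> xy yz; rewrite -measureU//.
    congr (nu _); apply/seteqP; split => t /=; rewrite !in_itv/=.
      by move=> /andP[xt tz]; case: (leP t y) => ty; [left; rewrite xt|right].
    by case=> /andP[h1 h2]; [rewrite h1 (le_trans h2)// ltW|rewrite h2 (lt_trans xy)].
  apply/seteqP; split => // t []/=; rewrite !in_itv/= => /andP[_ ty] /andP[+ _].
  by rewrite ltNge ty.
change (nu `]a, b]%classic = (b - a)%:E).
have nu0 (z c : R) : z = 0 -> 0 < c -> nu `]z, c]%classic = c%:E.
  by move=> ->; exact: nu_0c.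
case: (leP b 0) => b0; first exact: nu_le0.
case: (ltgtP a 0) => a0.
- by rewrite (nuU _ 0)// (nu_le0 a 0)// (nu0 0 b erefl)// -EFinD sub0r addrC.
- have h := nu0 0 b erefl b0; rewrite (nuU 0 a b)// (nu0 0 a erefl)// in h.
  by rewrite EFinB -h [(a%:E + _)%E]addeC addeK.
- by rewrite nu0// a0 subr0.
Qed.

(** Extending [F] by zero to the other half-line, which [T] fixes, makes that half contribute
    nothing. *)
Lemma ge0_integral_inv_pos (F : R -> \bar R) (k : R) : 0 < k ->
  measurable_fun setT F -> (forall x, 0 <= F x)%E ->
  (\int[mu]_(x in `]0%R, +oo[) (F (k * x)^-1%R * ((k * x ^+ 2)^-1)%:E)
   = \int[mu]_(x in `]0%R, +oo[) F x)%E.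
Proof.
move=> k0 mF F0.
pose G := F \_ `]0%R, +oo[%classic.
have mG : measurable_fun setT G by apply/(measurable_restrictT _ _).1 => //; exact:
  measurable_funS mF.
have G0 x : (0 <= G x)%E by rewrite /G patchE; case: ifP.
rewrite [RHS]integral_mkcond -/G.
have <- := @ge0_change_of_variable _ _ (measurableTypeR R) (measurableTypeR R) R mu
  (T k) (J k) (mT k) (mJ k) (J0 k0) mu G _ mG G0.
- rewrite [LHS]integral_mkcond; apply: eq_integral => x _.
  rewrite /G !patchE /T /J !mem_setE !in_itv/= !andbT.
  by case: ifP => x0; rewrite ?invr_gt0 ?mulr_gt0 ?x0 ?mul0e.
- move=> A mA; apply/esym; apply: (@lebesgue_measure_unique R
   (@density_measure _ _ (measurableTypeR R) (measurableTypeR R) R mu _ _ (mT k) (mJ k)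
      (J0 k0))) => //= _ [[a b]] _ <- /=.
  have [ab|ba] := ltP a b; last first.
    rewrite set_itv_ge; last by rewrite bnd_simp -leNgt.
    by rewrite /density_image preimage_set0 integral_set0 measure0.
  rewrite lebesgue_measure_itv/= lte_fin ab -EFinB.
  by apply/esym; exact: nu_oc.
Qed.

(** The inversion commutes with x -> -x, so the negative half-line reduces to the positive one. *)
Lemma ge0_integral_inv (F : R -> \bar R) (k : R) : 0 < k ->
  measurable_fun setT F -> (forall x, 0 <= F x)%E ->
  (\int[mu]_x (F (k * x)^-1%R * ((k * x ^+ 2)^-1)%:E) = \int[mu]_x F x)%E.
Proof.
move=> k0 mF F0.
have mkV : measurable_fun [set: R] (fun x => (k * x)^-1).
  by apply: measurableT_comp; [exact: measurable_inv|exact: mulrl_measurable].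
have mkV2 : measurable_fun [set: R] (fun x => (k * x ^+ 2)^-1).
  apply: measurableT_comp; first exact: measurable_inv.
  by apply: measurable_funM => //; exact: exprn_measurable.
rewrite [RHS]ge0_integral_halves// [LHS]ge0_integral_halves.
- congr (_ + _)%E; first exact: ge0_integral_inv_pos.
  rewrite -[RHS](ge0_integral_inv_pos k0 (F := fun x : R => F (- x)))//.
    by apply: eq_integral => x _; rewrite mulrN sqrrN invrN.
  exact: measurableT_comp.
- by apply: emeasurable_funM; [exact: measurableT_comp|exact/measurable_EFinP].
- by move=> x; rewrite mule_ge0// lee_fin invr_ge0 mulr_ge0 ?sqr_ge0// ltW.
Qed.

End real_inversion.

(** * The real-valued modulus *)

Section cmod_theory.
Local Open Scope complex_scope.
Variable R : realType.
Implicit Types z w : R[i].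

Lemma cmodE z : `|z| = (cmod z)%:C.
Proof. by []. Qed.

Lemma cmod_sqr z : cmod z ^+ 2 = complex.Re z ^+ 2 + complex.Im z ^+ 2.
Proof. by case: z => x y; rewrite /cmod/= sqr_sqrtr// addr_ge0 ?sqr_ge0. Qed.

Lemma cmod_ge0 z : 0 <= cmod z.
Proof. by case: z => x y; exact: sqrtr_ge0. Qed.

Lemma cmod0 : cmod (0 : R[i]) = 0.
Proof. exact: ComplexField.Normc.normc0. Qed.

Lemma cmod1 : cmod (1 : R[i]) = 1.
Proof. exact: ComplexField.Normc.normc1. Qed.

Lemma cmodM z w : cmod (z * w) = cmod z * cmod w.
Proof. exact: ComplexField.Normc.normcM. Qed.

Lemma cmodV z : cmod z^-1 = (cmod z)^-1.
Proof. exact: ComplexField.Normc.normcV. Qed.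

Lemma cmodN z : cmod (- z) = cmod z.
Proof. exact: normcN. Qed.

Lemma cmodD z w : cmod (z + w) <= cmod z + cmod w.
Proof. exact: le_normcD. Qed.

Lemma cmodB z w : cmod (z - w) = cmod (w - z).
Proof. by rewrite -cmodN opprB. Qed.

Lemma cmod_eq0 z : (cmod z == 0) = (z == 0).
Proof.
apply/eqP/eqP => [/ComplexField.Normc.eq0_normc //|->]; exact: cmod0.
Qed.

Lemma cmodJ z : cmod z^* = cmod z.
Proof. by case: z => x y; rewrite /cmod/= sqrrN. Qed.

Lemma cmodX z n : cmod (z ^+ n) = cmod z ^+ n.
Proof. by elim: n => [|n ih]; rewrite ?expr0 ?cmod1// !exprS cmodM ih. Qed.

Lemma cmod_real (x : R) : cmod x%:C = `|x|.
Proof. by rewrite /cmod/= expr0n addr0 sqrtr_sqr. Qed.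

Lemma mulcJ z : z * z^* = (cmod z ^+ 2)%:C.
Proof. by rewrite -sqr_normc cmodE rmorphXn. Qed.

Lemma normr_Re_cmod z : `|complex.Re z| <= cmod z.
Proof.
case: z => x y; rewrite /cmod/= -sqrtr_sqr ler_wsqrtr// lerDl; exact: sqr_ge0.
Qed.

Lemma normr_Im_cmod z : `|complex.Im z| <= cmod z.
Proof.
case: z => x y; rewrite /cmod/= -sqrtr_sqr ler_wsqrtr// lerDr; exact: sqr_ge0.
Qed.

Lemma cmod_le_ReIm z : cmod z <= `|complex.Re z| + `|complex.Im z|.
Proof.
case: z => x y; rewrite /cmod/= -[leRHS]ger0_norm ?addr_ge0//.
by rewrite -sqrtr_sqr ler_wsqrtr// sqrrD !real_normK ?num_real// lerD2r lerDl mulrn_wge0// mulr_ge0.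
Qed.

End cmod_theory.

(** * Measurability and area substitutions in the plane *)

Section plane_substitution.
Local Open Scope complex_scope.
Variable R : realType.
Local Notation mu := (@lebesgue_measure R).
Local Notation mu2 := (mu \x mu)%E.

Definition cx (p : R * R) : R[i] := p.1 +i* p.2.

(** Measurability is read in the two real coordinates, over which all integrals are taken. *)
Definition cmeasurable d (T : measurableType d) (F : R[i] -> T) :=
  measurable_fun [set: R * R] (fun p => F (cx p)).

Definition plane_map (T : R[i] -> R[i]) :=
  measurable_fun [set: R * R] (fun p => (complex.Re (T (cx p)), complex.Im (T (cx p)))).

(* [J] is the Jacobian of [T], [T] being one-to-one up to null sets. *)
Definition area_subst (T : R[i] -> R[i]) (J : R[i] -> R) :=
  forall F : R[i] -> \bar R, cmeasurable F -> (forall z, 0 <= F z)%E ->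
  (\int[mu2]_p (F (T (cx p)) * (J (cx p))%:E) = \int[mu2]_p F (cx p))%E.

Lemma cmeasurable_comp d (T : measurableType d) (F : R[i] -> T) (g : R[i] -> R[i]) :
  cmeasurable F -> plane_map g -> cmeasurable (fun z => F (g z)).
Proof.
move=> mF mg; rewrite /cmeasurable.
have -> : (fun p => F (g (cx p))) = (fun p => F (cx p)) \o
    (fun p => (complex.Re (g (cx p)), complex.Im (g (cx p)))).
  by apply/funext => p /=; rewrite /cx/=; congr F; case: (g _).
exact: (measurableT_comp mF mg).
Qed.

Lemma area_subst_comp (T1 T2 : R[i] -> R[i]) (J1 J2 : R[i] -> R) :
  plane_map T1 -> cmeasurable J1 -> (forall z, 0 <= J1 z) ->
  area_subst T1 J1 -> area_subst T2 J2 ->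
  area_subst (T1 \o T2) (fun z => J1 (T2 z) * J2 z).
Proof.
move=> mT1 mJ1 J10 h1 h2 F mF F0.
rewrite -(h1 F)// -(h2 (fun z => F (T1 z) * (J1 z)%:E)%E).
- by apply: eq_integral => p _; rewrite EFinM muleA.
- by apply: emeasurable_funM; [exact: (cmeasurable_comp mF mT1)|exact/measurable_EFinP].
- by move=> z; rewrite mule_ge0// lee_fin.
Qed.

(** By Tonelli, a shear is a family of one-dimensional affine maps, all with the same factor. *)
Lemma ge0_integral_fst_affine (F : R * R -> \bar R) (k : R) (g : R -> R) : k != 0 ->
  measurable_fun setT g -> measurable_fun setT F -> (forall p, 0 <= F p)%E ->
  (\int[mu2]_p (F ((k * p.1 + g p.2)%R, p.2) * (`|k|%R)%:E) = \int[mu2]_p F p)%E.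
Proof.
move=> k0 mg mF F0.
have mT : measurable_fun [set: R * R] (fun p => (k * p.1 + g p.2, p.2)).
  apply: measurable_fun_pair => //.
  apply: measurable_funD; last exact: (measurableT_comp mg measurable_snd).
  by apply: measurable_funM => //; exact: measurable_fst.
rewrite [RHS]fubini_tonelli2// fubini_tonelli2.
- apply: eq_integral => y _.
  rewrite /fubini_G/=.
  apply: (@ge0_integral_affine R (fun x => F (x, y)) k (g y)) => //.
  exact: (measurableT_comp mF (pair2_measurable y)).
- by apply: emeasurable_funM => //; exact: (measurableT_comp mF mT).
- by move=> p; rewrite mule_ge0// lee_fin.
Qed.

Lemma ge0_integral_snd_affine (F : R * R -> \bar R) (k : R) (g : R -> R) : k != 0 ->
  measurable_fun setT g -> measurable_fun setT F -> (forall p, 0 <= F p)%E ->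
  (\int[mu2]_p (F (p.1, (k * p.2 + g p.1)%R) * (`|k|%R)%:E) = \int[mu2]_p F p)%E.
Proof.
move=> k0 mg mF F0.
have mT : measurable_fun [set: R * R] (fun p => (p.1, k * p.2 + g p.1)).
  apply: measurable_fun_pair => //.
  apply: measurable_funD; last exact: (measurableT_comp mg measurable_fst).
  by apply: measurable_funM => //; exact: measurable_snd.
rewrite [RHS]fubini_tonelli1// fubini_tonelli1.
- apply: eq_integral => x _.
  rewrite /fubini_F/=.
  apply: (@ge0_integral_affine R (fun y => F (x, y)) k (g x)) => //.
  exact: (measurableT_comp mF (pair1_measurable x)).
- by apply: emeasurable_funM => //; exact: (measurableT_comp mF mT).
- by move=> p; rewrite mule_ge0// lee_fin.
Qed.

Lemma ge0_integral_swap (F : R * R -> \bar R) :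
  measurable_fun setT F -> (forall p, 0 <= F p)%E ->
  (\int[mu2]_p F (p.2, p.1) = \int[mu2]_p F p)%E.
Proof.
move=> mF F0; rewrite fubini_tonelli2//.
  by rewrite [RHS]fubini_tonelli1.
by apply: measurableT_comp => //; exact: measurable_swap.
Qed.

End plane_substitution.

(** * Area substitution for affine maps and for the complex inversion *)

Section moebius_substitution.
Local Open Scope complex_scope.
Variable R : realType.
Local Notation mu := (@lebesgue_measure R).
Local Notation mu2 := (mu \x mu)%E.

Let mx : measurable_fun [set: R * R] (fun p => p.1) := measurable_fst.
Let my : measurable_fun [set: R * R] (fun p => p.2) := measurable_snd.

Lemma measurable_mulr d (T : measurableType d) (k : R) (f : T -> R) :
  measurable_fun setT f -> measurable_fun setT (fun x => k * f x).
Proof. by move=> mf; exact: measurable_funM. Qed.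

Lemma plane_map_affine (c e : R[i]) : plane_map (fun z => c * z + e).
Proof.
case: c => a b; case: e => e1 e2; rewrite /plane_map/cx/=.
apply: measurable_fun_pair; apply: measurable_funD => //.
- by apply: measurable_funB; exact: measurable_mulr.
- by apply: measurable_funD; exact: measurable_mulr.
Qed.

Lemma plane_map_inv : plane_map (@GRing.inv R[i]).
Proof.
rewrite /plane_map/cx.
have mN : measurable_fun setT (fun p : R * R => (p.1 ^+ 2 + p.2 ^+ 2)^-1).
  apply: (measurableT_comp (@measurable_inv R)).
  by apply: measurable_funD; exact: measurable_funX.
apply: measurable_fun_pair => /=; first exact: measurable_funM.
by apply: measurable_funN; exact: measurable_funM.
Qed.

(** Multiplication by a + i b has the matrix with rows (a, -b) and (b, a), which is factored into
    two shears, as in Gaussian elimination. *)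
Lemma area_subst_affine (c e : R[i]) : c != 0 ->
  area_subst (fun z => c * z + e) (fun=> cmod c ^+ 2).
Proof.
move=> c0 F mF F0; rewrite cmod_sqr.
case: c e c0 => [a b] [e1 e2]; rewrite eq_complex/= negb_and => c0; rewrite /cx/=.
have D0 : 0 < a ^+ 2 + b ^+ 2.
  by case/orP: c0 => h; [rewrite ltr_pwDl// ?sqr_ge0// exprn_even_gt0|
    rewrite ltr_wpDl// ?sqr_ge0// exprn_even_gt0].
pose H (p : R * R) := F (cx p).
have H0 p : (0 <= H p)%E by exact: F0.
have [a0|a0] := eqVneq a 0; last first.
  (* The second pivot: a * k2 is the determinant. [g] and its constant restore b x + e2 from the new
     first coordinate. *)
  pose k2 := (a ^+ 2 + b ^+ 2) / a.
  pose g (x : R) := b / a * x + (e2 - b / a * e1).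
  have k20 : k2 != 0 by rewrite mulf_neq0// ?invr_neq0// gt_eqF.
  have mg : measurable_fun setT g by apply: measurable_funD => //; exact: measurable_mulr.
  pose f (y : R) := - b * y + e1.
  have mf : measurable_fun setT f by apply: measurable_funD => //; exact: measurable_mulr.
  rewrite -[RHS](ge0_integral_snd_affine k20 mg mF H0).
  rewrite -[RHS](ge0_integral_fst_affine a0 mf).
  - apply: eq_integral => -[x y] _; rewrite /H /cx/= /f /g.
    rewrite -muleA -EFinM -normrM mulrC; congr (_ * _)%E.
      congr F; congr (_ +i* _); first by ring.
      by rewrite /k2; field.
    congr EFin; rewrite /k2 divfK// ger0_norm// ltW//.
  - apply: emeasurable_funM => //; apply: (measurableT_comp mF).
    apply: measurable_fun_pair => //; apply: measurable_funD; first exact: measurable_mulr.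
    exact: (measurableT_comp mg mx).
  - by move=> p; rewrite mule_ge0// lee_fin.
(* The first pivot vanishes: the map is a swap of the coordinates composed with two scalings. *)
have {c0} b0 : b != 0 by move: c0; rewrite a0 eqxx.
subst a.
have Nb0 : - b != 0 by rewrite oppr_eq0.
rewrite -[RHS](ge0_integral_snd_affine b0 (g := cst e2) _ mF H0)//.
rewrite -[RHS](ge0_integral_fst_affine Nb0 (g := cst e1))//.
- rewrite -[RHS]ge0_integral_swap.
  + apply: eq_integral => -[x y] _; rewrite /H /cx/=.
    rewrite -muleA -EFinM normrN -normrM expr0n add0r -expr2 ger0_norm ?sqr_ge0//.
    congr (F _ * _)%E; congr (_ +i* _); ring.
  + apply: emeasurable_funM => //; apply: emeasurable_funM => //; apply: (measurableT_comp mF).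
    apply: measurable_fun_pair => /=; apply: measurable_funD => //; exact: measurable_mulr.
  + by move=> p; rewrite !mule_ge0// lee_fin.
- apply: emeasurable_funM => //; apply: (measurableT_comp mF).
  apply: measurable_fun_pair => //=; apply: measurable_funD => //; exact: measurable_mulr.
- by move=> p; rewrite mule_ge0// lee_fin.
Qed.

(* Away from the axis [x = 0], integrate over lines through the origin. *)
Lemma ge0_integral_slope (F : R * R -> \bar R) :
  measurable_fun setT F -> (forall p, 0 <= F p)%E ->
  (\int[mu2]_p F p = \int[mu]_t \int[mu]_x (F (x, (x * t)%R) * (`|x|%R)%:E))%E.
Proof.
move=> mF F0.
have mT : measurable_fun [set: R * R] (fun p => (p.1, p.1 * p.2)).
  by apply: measurable_fun_pair => //; exact: measurable_funM.
have mG : measurable_fun [set: R * R] (fun p => F (p.1, (p.1 * p.2)%R) * (`|p.1|%R)%:E)%E.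
  apply: emeasurable_funM; first exact: (measurableT_comp mF mT).
  by apply/measurable_EFinP; exact: measurableT_comp.
have G0 p : (0 <= F (p.1, (p.1 * p.2)%R) * (`|p.1|%R)%:E)%E by rewrite mule_ge0// lee_fin.
rewrite -(@fubini_tonelli _ _ (measurableTypeR R) (measurableTypeR R) R mu mu (fun p :
  R * R => F (p.1, (p.1 * p.2)%R) * (`|p.1|%R)%:E)%E)//=.
(* The substitution y = x t on the fibre over x requires x != 0; a single point is deleted. *)
have del0 (h : R -> \bar R) : measurable_fun setT h ->
    (\int[mu]_x h x = \int[mu]_(x in [set~ 0%R]) h x)%E.
  move=> mh; rewrite -[in RHS]setTD (@integral_setD1 R h 0 setT)//; last exact: measurable_funTS.
  exact: measurableD.
have mF1 := measurable_fun_fubini_tonelli_F (m2 := mu) F mF F0.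
have mG1 := measurable_fun_fubini_tonelli_F (m2 := mu) _ mG G0.
transitivity (\int[mu]_x fubini_F mu F x)%E; first exact: fubini_tonelli1.
apply: eq_trans; first exact: (del0 _ mF1).
apply: eq_trans; last exact/esym/(del0 _ mG1).
apply: eq_integral => x; rewrite inE/= => /eqP x0.
rewrite /fubini_F/= -[LHS](@ge0_integral_affine R (fun y => F (x, y)) x 0)//.
  by apply: eq_integral => y _; rewrite addr0.
exact: (measurableT_comp mF (pair1_measurable x)).
Qed.

(** Inversion sends the line of slope t to the line of slope -t, and along it acts as x -> 1/(k x)
    with k = 1 + t^2. In slope coordinates it is thus a family of real inversions followed by t ->
    -t. *)
Lemma area_subst_inv : area_subst (@GRing.inv R[i]) (fun z => cmod z ^- 4).
Proof.
move=> F mF F0.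
pose H (p : R * R) := F (cx p).
have H0 p : (0 <= H p)%E by exact: F0.
have mJ : measurable_fun [set: R * R] (fun p => cmod (cx p) ^- 4).
  apply: (measurableT_comp (@measurable_inv R)).
  rewrite (_ : (fun p => _) = fun p => (p.1 ^+ 2 + p.2 ^+ 2) ^+ 2); last first.
    by apply/funext => p; rewrite -[4%N]/(2 * 2)%N exprM cmod_sqr.
  by apply: measurable_funX; apply: measurable_funD; exact: measurable_funX.
rewrite ge0_integral_slope; last 2 first.
- apply: emeasurable_funM; last exact/measurable_EFinP.
  exact: (cmeasurable_comp mF plane_map_inv).
- by move=> p; rewrite mule_ge0// lee_fin invr_ge0 exprn_ge0// cmod_ge0.
have mHs (t : R) : measurable_fun setT (fun x : R => H (x, x * - t)).
  apply: (measurableT_comp mF); apply: measurable_fun_pair => //=.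
  exact: measurable_funM.
transitivity (\int[mu]_t \int[mu]_x (H (x, (x * - t)%R) * (`|x|%R)%:E))%E.
  apply: eq_integral => t _.
  have t0 : 0 < 1 + t ^+ 2 by rewrite ltr_pwDl// sqr_ge0.
  rewrite -[RHS](ge0_integral_inv t0).
  - apply: eq_integral => x _.
    have [->|x0] := eqVneq x 0.
      by rewrite normr0 !mule0 expr0n !mulr0 invr0 mule0.
    rewrite -!muleA; congr (_ * _)%E.
      have D0 : x ^+ 2 + (x * t) ^+ 2 != 0.
        have -> : x ^+ 2 + (x * t) ^+ 2 = x ^+ 2 * (1 + t ^+ 2) by ring.
        by rewrite mulf_neq0// ?expf_neq0// gt_eqF.
      by rewrite /H /cx/=; congr F; congr (_ +i* _); field; rewrite D0 x0 gt_eqF.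
    rewrite -!EFinM; congr EFin.
    rewrite -[4%N]/(2 * 2)%N exprM cmod_sqr/= normfV normrM (gtr0_norm t0).
    have -> : x ^+ 2 + (x * t) ^+ 2 = `|x| ^+ 2 * (1 + t ^+ 2).
      by rewrite real_normK ?num_real//; ring.
    rewrite -[x ^+ 2]real_normK ?num_real//.
    by field; rewrite normr_eq0 x0 gt_eqF.
  - by apply: emeasurable_funM; [exact: mHs|apply/measurable_EFinP; exact: normr_measurable].
  - by move=> x; rewrite mule_ge0// lee_fin.
apply: eq_trans; last exact/esym/(ge0_integral_slope mF H0).
have mG : measurable_fun [set: R * R] (fun p => H (p.2, (p.2 * p.1)%R) * (`|p.2|%R)%:E)%E.
  apply: emeasurable_funM; last by apply/measurable_EFinP; exact: measurableT_comp.
  by apply: (measurableT_comp mF); apply: measurable_fun_pair => //; exact: measurable_funM.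
have G0 p : (0 <= H (p.2, (p.2 * p.1)%R) * (`|p.2|%R)%:E)%E by rewrite mule_ge0// lee_fin.
pose K (t : R) := (\int[mu]_x (H (x, (x * t)%R) * (`|x|%R)%:E))%E.
have mK : measurable_fun setT K := measurable_fun_fubini_tonelli_F (m2 := mu) _ mG G0.
have K0 t : (0 <= K t)%E by apply: integral_ge0 => x _; rewrite mule_ge0// lee_fin.
have N10 : -1 != 0 :> R by rewrite oppr_eq0 oner_eq0.
(* The slopes have changed sign; reflecting t restores them. *)
have := ge0_integral_affine 0 N10 mK K0.
rewrite normrN1 => <-.
by apply: eq_integral => t _; rewrite mule1 /K addr0 mulN1r.
Qed.

End moebius_substitution.

(** * Automorphisms of the disk and invariance of the Poincare area *)

Section moebius.
Local Open Scope complex_scope.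
Variable R : realType.
Local Notation mu := (@lebesgue_measure R).
Local Notation mu2 := (mu \x mu)%E.
Implicit Types a b z w : R[i].

Definition su a b := cmod a ^+ 2 - cmod b ^+ 2 = 1.

Definition mob a b z := (a * z + b) / (b^* * z + a^*).

Lemma su_neq0 a b : su a b -> a != 0.
Proof.
move=> h; rewrite -cmod_eq0; apply/eqP => a0.
by move: h; rewrite /su a0; have := sqr_ge0 (cmod b); lra.
Qed.

(** A matrix of SU(1,1) multiplies (z, 1) into the numerator and the denominator, and preserves the
    Hermitian form |z1|^2 - |z2|^2. *)
Lemma mob_den_identity a b z : su a b ->
  cmod (b^* * z + a^*) ^+ 2 - cmod (a * z + b) ^+ 2 = 1 - cmod z ^+ 2.
Proof.
move=> h; transitivity ((cmod a ^+ 2 - cmod b ^+ 2) * (1 - cmod z ^+ 2)); last by rewrite h mul1r.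
by rewrite !cmod_sqr; case: a b z {h} => [a1 a2] [b1 b2] [z1 z2] /=; ring.
Qed.

Lemma cmod_lt1 z : (cmod z < 1) = (cmod z ^+ 2 < 1).
Proof. by rewrite expr_lt1// cmod_ge0. Qed.

Lemma mob_den_neq0 a b z : su a b -> cmod z < 1 -> b^* * z + a^* != 0.
Proof.
move=> h z1; rewrite -cmod_eq0; apply/eqP => d0.
have := mob_den_identity z h; rewrite d0; move: z1; rewrite cmod_lt1.
by have := sqr_ge0 (cmod (a * z + b)); lra.
Qed.

Lemma mob_norm a b z : su a b -> b^* * z + a^* != 0 ->
  1 - cmod (mob a b z) ^+ 2 = (1 - cmod z ^+ 2) / cmod (b^* * z + a^*) ^+ 2.
Proof.
move=> h d0; rewrite -(mob_den_identity z h) /mob cmodM cmodV exprMn exprVn.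
by field; rewrite cmod_eq0.
Qed.

Lemma mob_disk a b z : su a b -> cmod z < 1 -> cmod (mob a b z) < 1.
Proof.
move=> h z1; have d0 := mob_den_neq0 h z1.
rewrite cmod_lt1 -subr_gt0 mob_norm// divr_gt0 ?subr_gt0 -?cmod_lt1//.
by rewrite exprn_even_gt0//= cmod_eq0.
Qed.

(** The maps may differ where the Jacobian is 0. This disposes of the pole, as the inverse of 0 is
    0. *)
Lemma area_subst_ext (T1 T2 : R[i] -> R[i]) (J1 J2 : R[i] -> R) :
  (forall z, J1 z != 0 -> T1 z = T2 z) -> J1 =1 J2 ->
  area_subst T1 J1 -> area_subst T2 J2.
Proof.
move=> T12 /funext J12 h F mF F0; rewrite -(h F)// -J12; apply: eq_integral => p _.
by have [->|/T12 ->//] := eqVneq (J1 (cx p)) 0; rewrite !mule0.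
Qed.

Lemma cmeasurable_cmod : cmeasurable (fun z : R[i] => cmod z).
Proof.
rewrite /cmeasurable (_ : (fun p => _) = Num.sqrt \o (fun p : R * R => p.1 ^+ 2 + p.2 ^+ 2))//.
apply: measurableT_comp; first by apply: continuous_measurable_fun; exact: sqrt_continuous.
by apply: measurable_funD; apply: measurable_funX; [exact: measurable_fst|exact: measurable_snd].
Qed.

Lemma plane_map_comp (T1 T2 : R[i] -> R[i]) :
  plane_map T1 -> plane_map T2 -> plane_map (T1 \o T2).
Proof.
move=> m1 m2.
exact: (cmeasurable_comp (F := fun z => (complex.Re (T1 z), complex.Im (T1 z))) m1 m2).
Qed.

(** Partial fractions: an affine map, the inversion, an affine map. The pole, where a division by 0
    gives 0, is set apart. *)
Lemma mob_decomp a b z : su a b -> b != 0 ->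
  mob a b z = (- b^*^-1) * (b^* * z + a^*)^-1 + a / b^* \/ b^* * z + a^* = 0.
Proof.
move=> h b0; have [->|d0] := eqVneq (b^* * z + a^*) 0; [by right|left].
have bc0 : b^* != 0 by rewrite conjc_eq0.
rewrite /mob.
have e : a * a^* = 1 + b * b^*.
  by rewrite !mulcJ -[1]/(1%:C) -rmorphD; congr (_%:C); move: h; rewrite /su; lra.
apply: (mulIf d0); rewrite divfK// mulrDl mulNr -invfM mulNr.
rewrite invfM -mulrA mulVf// mulr1 mulrDr mulrA divfK//.
rewrite [a / _ * _]mulrAC e mulrDl mul1r mulfK//; ring.
Qed.

Lemma plane_map_mul (S T : R[i] -> R[i]) :
  plane_map S -> plane_map T -> plane_map (fun z => S z * T z).
Proof.
rewrite /plane_map => /measurable_fun_pairP[/= mS1 mS2] /measurable_fun_pairP[/= mT1 mT2].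
rewrite (_ : (fun p => _) = (fun p : R * R =>
   (complex.Re (S (cx p)) * complex.Re (T (cx p)) - complex.Im (S (cx p)) * complex.Im (T (cx p)),
    complex.Re (S (cx p)) * complex.Im (T (cx p)) + complex.Im (S (cx p)) * complex.Re (T (cx p))))).
  apply: measurable_fun_pair.
    by apply: measurable_funB; exact: measurable_funM.
  by apply: measurable_funD; exact: measurable_funM.
by apply/funext => p; case: (S _) (T _) => [? ?] [? ?].
Qed.

Lemma plane_map_mob a b : plane_map (mob a b).
Proof.
apply: plane_map_mul; first exact: plane_map_affine.
apply: plane_map_comp; [exact: plane_map_inv|exact: plane_map_affine].
Qed.

(** For b = 0 the map is a rotation; otherwise the Jacobians of the three factors of [mob_decomp]
    multiply to the modulus of the denominator to the power -4. *)
Lemma area_subst_mob a b : su a b ->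
  area_subst (mob a b) (fun z => cmod (b^* * z + a^*) ^- 4).
Proof.
move=> h; have [b0|b0] := eqVneq b 0.
  have a1 : cmod a ^+ 2 = 1 by move: h; rewrite /su b0 cmod0 expr0n subr0.
  have aJ0 : a^* != 0 by rewrite conjc_eq0 (su_neq0 h).
  apply: (area_subst_ext (T1 := fun z => (a / a^*) * z + 0) (J1 := fun=> cmod (a / a^*) ^+ 2)).
  - by move=> z _; rewrite /mob b0 rmorph0 mul0r add0r !addr0 mulrAC.
  - move=> z; rewrite b0 rmorph0 mul0r add0r cmodM cmodV cmodJ.
    rewrite divff ?cmod_eq0 ?(su_neq0 h)// -[4%N]/(2 * 2)%N exprM a1 !expr1n invr1//.
  - by apply: area_subst_affine; rewrite mulf_neq0 ?invr_eq0 ?(su_neq0 h).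
have bc0 : b^* != 0 by rewrite conjc_eq0.
apply: (area_subst_ext
  (T1 := (fun z => (- b^*^-1) * z + a / b^*) \o (GRing.inv \o (fun z => b^* * z + a^*)))
  (J1 := fun z => cmod (- b^*^-1) ^+ 2 * (cmod (b^* * z + a^*) ^- 4 * cmod b^* ^+ 2))).
- move=> z Jz; have [->//|d0] := mob_decomp z h b0.
  by move: Jz; rewrite d0 cmod0 expr0n invr0 mul0r mulr0 eqxx.
- move=> z; rewrite cmodN cmodV mulrCA -exprMn mulVf ?cmod_eq0// expr1n mulr1//.
have mJ : cmeasurable (fun z : R[i] => cmod z ^- 4).
  apply: (measurableT_comp (@measurable_inv R)).
  by apply: measurable_funX; exact: cmeasurable_cmod.
apply: (area_subst_comp (J1 := fun=> cmod (- b^*^-1) ^+ 2)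
  (J2 := fun z => cmod (b^* * z + a^*) ^- 4 * cmod b^* ^+ 2)).
- exact: plane_map_affine.
- exact: measurable_cst.
- by move=> z; exact: sqr_ge0.
- by apply: area_subst_affine; rewrite oppr_eq0 invr_eq0.
apply: (area_subst_comp (J1 := fun z => cmod z ^- 4) (J2 := fun=> cmod b^* ^+ 2)) => //.
- exact: plane_map_inv.
- by move=> z; rewrite invr_ge0 exprn_ge0// cmod_ge0.
- exact: area_subst_inv.
- exact: area_subst_affine.
Qed.

(** Set to zero off the disk, so that integrals run over the whole plane and the disk never appears
    as a domain of integration. *)
Definition rho z : R := if cmod z < 1 then poincare_density z else 0.

Lemma rho_ge0 z : 0 <= rho z.
Proof. by rewrite /rho; case: ifP => // _; rewrite divr_ge0// sqr_ge0. Qed.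

Lemma rho_mob a b z : su a b -> rho (mob a b z) * cmod (b^* * z + a^*) ^- 4 = rho z.
Proof.
move=> h; have [d0|d0] := eqVneq (b^* * z + a^*) 0.
  rewrite d0 cmod0 expr0n invr0 mulr0 /rho; case: ifP => // z1.
  by move: (mob_den_neq0 h z1); rewrite d0 eqxx.
have N := mob_norm h d0.
have D0 : 0 < cmod (b^* * z + a^*) ^+ 2 by rewrite exprn_even_gt0//= cmod_eq0.
rewrite /rho; have -> : (cmod (mob a b z) < 1) = (cmod z < 1).
  by rewrite !cmod_lt1 -![_ < 1]subr_gt0 N pmulr_lgt0 ?invr_gt0.
case: ifP => z1; last by rewrite mul0r.
have z2 : 1 - cmod z ^+ 2 != 0 by rewrite gt_eqF// subr_gt0 -cmod_lt1.
rewrite /poincare_density N -[4%N]/(2 * 2)%N exprM.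
have d1 : cmod (b^* * z + a^*) != 0 by rewrite cmod_eq0.
by field; rewrite z2 d1.
Qed.

Lemma cmeasurable_rho : cmeasurable rho.
Proof.
apply: measurable_fun_ifT => //.
  by apply: measurable_fun_ltr => //; exact: cmeasurable_cmod.
apply: measurable_funM => //; apply: (measurableT_comp (@measurable_inv R)).
apply: measurable_funX; apply: measurable_funB => //; apply: measurable_funX.
exact: cmeasurable_cmod.
Qed.

(* Integration against the Poincare area. *)
Definition hint (h : R[i] -> \bar R) : \bar R := (\int[mu2]_p ((rho (cx p))%:E * h (cx p)))%E.

Lemma hint_mob a b (h : R[i] -> \bar R) : su a b -> cmeasurable h -> (forall z, 0 <= h z)%E ->
  hint (fun z => h (mob a b z)) = hint h.
Proof.
move=> ab mh h0.
rewrite /hint -(area_subst_mob ab (F := fun z => (rho z)%:E * h z)%E).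
- by apply: eq_integral => p _; rewrite muleAC -EFinM rho_mob.
- by apply: emeasurable_funM => //; apply/measurable_EFinP; exact: cmeasurable_rho.
- by move=> z; rewrite mule_ge0// lee_fin rho_ge0.
Qed.

End moebius.

(** * Goursat's theorem for closed forms on rectangles *)

Section goursat.
Variable R : realType.
Local Notation mu := (@lebesgue_measure R).
Implicit Types (f : R -> R) (F P Q : R -> R -> R).

Definition iint f a b : R := \int[mu]_(x in `[a, b]) f x.

Definition icontinuous f (a b : R) := {in `[a, b], continuous f}.

Lemma icontinuous_integrable f a b : icontinuous f a b ->
  mu.-integrable `[a, b] (EFin \o f).
Proof.
move=> cf; apply: continuous_compact_integrable; first exact: segment_compact.
by apply: continuous_in_subspaceT => x; rewrite inE => xab; exact: cf.
Qed.

Lemma iint_split f a b c : a <= c -> c <= b -> icontinuous f a b ->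
  iint f a b = iint f a c + iint f c b.
Proof.
move=> ac cb cf; have icf := icontinuous_integrable cf.
apply/eqP; rewrite addrC -subr_eq; apply/eqP.
rewrite /iint Rintegral_itvB ?bnd_simp//.
rewrite Rintegral_itv_obnd_cbnd//; apply: integrableS icf => //.
by apply: subset_itvr; rewrite bnd_simp.
Qed.

Lemma iint_approx f a b k e : a <= b -> icontinuous f a b ->
  (forall x, x \in `[a, b] -> `|f x - k| <= e) ->
  `|iint f a b - k * (b - a)| <= e * (b - a).
Proof.
move=> ab cf fke; have icf := icontinuous_integrable cf.
have ick r : mu.-integrable `[a, b] (EFin \o (fun=> r)).
  by apply: icontinuous_integrable => x _; exact: cst_continuous.
have lab r : \int[mu]_(x in `[a, b]) r = r * (b - a).
  rewrite Rintegral_cst//; congr (_ * _).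
  transitivity (fine (mu `[a, b]%classic)) => //.
  by rewrite lebesgue_measure_itv/= lte_fin; case: ltgtP ab => // -> _; rewrite subrr.
rewrite -(lab k) -RintegralB//.
have ic : icontinuous (fun x => f x - k) a b.
  by move=> x xab; apply: continuousB; [exact: cf|exact: cst_continuous].
apply: le_trans (le_normr_Rintegral _ (icontinuous_integrable ic)) _ => //.
rewrite -lab; apply: le_Rintegral => //.
by apply: icontinuous_integrable => x xab; apply: cvg_norm; exact: ic.
Qed.

Definition has_gradient F (s t al be : R) := forall e, 0 < e -> exists2 d, 0 < d &
  forall s' t', `|s' - s| < d -> `|t' - t| < d ->
    `|F s' t' - F s t - (al * (s' - s) + be * (t' - t))| <= e * (`|s' - s| + `|t' - t|).

Lemma has_gradient_cvg F s t al be : has_gradient F s t al be ->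
  {for s, continuous (F ^~ t)} /\ {for t, continuous (F s)}.
Proof.
move=> h.
suff key (g : R -> R) x k : (forall e, 0 < e -> exists2 d, 0 < d &
    forall x', `|x' - x| < d -> `|g x' - g x - k * (x' - x)| <= e * `|x' - x|) ->
    {for x, continuous g}.
  split; [apply: (key _ _ al)|apply: (key _ _ be)] => e /h[d d0 hd]; exists d => // x' xx'.
    by have := hd x' t xx'; rewrite subrr normr0 mulr0 !addr0; exact.
  by have := hd s x'; rewrite subrr normr0 mulr0 !add0r; apply.
move=> hg; apply/cvgrPdist_le => e e0.
have [d d0 hd] := hg 1 ltr01.
have k1 : 0 < 1 + `|k| by rewrite ltr_pwDl.
near=> x'.
have xx' : `|x' - x| < d by rewrite distrC; near: x'; exact: cvgr_dist_lt.
rewrite distrC -[X in `|X|](subrK (k * (x' - x))) (le_trans (ler_normD _ _))//.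
rewrite (le_trans (lerD (hd _ xx') (lexx _)))// normrM mul1r -[X in X + _]mul1r -mulrDl.
rewrite -ler_pdivlMl// mulrC ltW//.
rewrite distrC; near: x'; apply: cvgr_dist_lt => //; exact: divr_gt0.
Unshelve. all: by end_near. Qed.

Lemma itv_left (x y : R) : x <= y -> x \in `[x, y].
Proof. by move=> xy; rewrite in_itv/= lexx. Qed.

Lemma itv_right (x y : R) : x <= y -> y \in `[x, y].
Proof. by move=> xy; rewrite in_itv/= lexx andbT. Qed.

Section rectangle.
Variables (P Q : R -> R -> R).

(* The integral of the form P ds + Q dt along the boundary of a rectangle. *)
Definition bint a b c d :=
  iint (P ^~ c) a b - iint (P ^~ d) a b + (iint (Q b) c d - iint (Q a) c d).

(** The shared [be] is the equality of the cross derivatives of P and Q. Differentiability at points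
    is all that is asked, not continuity of the derivatives, so complex differentiability will
    provide it. *)
Definition closed_at s t := exists al be ga, has_gradient P s t al be /\ has_gradient Q s t be ga.

Definition closed_on a b c d := forall s t, s \in `[a, b] -> t \in `[c, d] -> closed_at s t.

Lemma closed_on_continuous a b c d : closed_on a b c d ->
  (forall t, t \in `[c, d] -> icontinuous (P ^~ t) a b) /\
  (forall s, s \in `[a, b] -> icontinuous (Q s) c d).
Proof.
move=> h; split => [t tcd s sab|s sab t tcd]; have [al [be [ga [hP hQ]]]] := h s t sab tcd.
  exact: (has_gradient_cvg hP).1.
exact: (has_gradient_cvg hQ).2.
Qed.

(** Each inner edge occurs with both signs and cancels; only the outer edges have to be cut. *)
Lemma bint_split a b c d m n : a <= m -> m <= b -> c <= n -> n <= d ->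
  closed_on a b c d ->
  bint a b c d = bint a m c n + bint m b c n + bint a m n d + bint m b n d.
Proof.
move=> am mb cn nd /closed_on_continuous[hP hQ].
have cd := le_trans cn nd; have ab := le_trans am mb.
rewrite /bint (iint_split am mb (hP c (itv_left cd))) (iint_split am mb (hP d (itv_right cd))).
rewrite (iint_split cn nd (hQ a (itv_left ab))) (iint_split cn nd (hQ b (itv_right ab))).
ring.
Qed.

(** Near a point of closedness P and Q are affine up to e times the size, and the affine part of a
    closed form has boundary integral zero. *)
Lemma bint_small s t (e : R) : closed_at s t -> 0 < e -> exists2 r, 0 < r &
  forall a b c d, closed_on a b c d -> s \in `[a, b] -> t \in `[c, d] -> b - a < r -> d - c < r ->
    `|bint a b c d| <= 2 * e * ((b - a) + (d - c)) ^+ 2.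
Proof.
move=> [al [be [ga [hP hQ]]]] e0.
have [r1 r10 h1] := hP e e0; have [r2 r20 h2] := hQ e e0.
exists (Num.min r1 r2); first by rewrite lt_min r10.
move=> a b c d cl; rewrite !in_itv/= => /andP[as_ sb] /andP[ct td].
rewrite !lt_min => /andP[w1 w2] /andP[v1 v2].
have ab := le_trans as_ sb; have cd := le_trans ct td.
have [cP cQ] := closed_on_continuous cl.
have cPc := cP c (itv_left cd); have cPd := cP d (itv_right cd).
have cQa := cQ a (itv_left ab); have cQb := cQ b (itv_right ab).
have ii2 f g x y : icontinuous f x y -> icontinuous g x y ->
    iint f x y - iint g x y = iint (fun z => f z - g z) x y.
  by move=> cf cg; rewrite /iint RintegralB//; exact: icontinuous_integrable.
have ic2 f g x y : icontinuous f x y -> icontinuous g x y -> icontinuous (fun z => f z - g z) x y.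
  by move=> cf cg z zxy; apply: continuousB; [exact: cf|exact: cg].
have dist (x y z w : R) : x <= y -> x <= z -> z <= y -> x <= w -> w <= y -> `|z - w| <= y - x.
  by move=> *; rewrite ler_norml; apply/andP; split; lra.
set w := b - a; set v := d - c.
have w0 : 0 <= w by rewrite subr_ge0.
have v0 : 0 <= v by rewrite subr_ge0.
(* The main terms be (c - d) w here and be (b - a) v below are opposite, since w = b - a and v = d -
   c. *)
have EP : `|iint (P ^~ c) a b - iint (P ^~ d) a b - be * (c - d) * w| <= 2 * e * (w + v) * w.
  rewrite ii2//; apply: iint_approx => //; first exact: ic2.
  move=> x; rewrite in_itv/= => /andP[ax xb].
  have xs : `|x - s| <= w by apply: dist.
  have cT : `|c - t| <= v by apply: dist.
  have dT : `|d - t| <= v by apply: dist.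
  have {}h := h1 x; have := h c (le_lt_trans xs w1) (le_lt_trans cT v1).
  have := h d (le_lt_trans xs w1) (le_lt_trans dT v1).
  rewrite !ler_norml => /andP[l1 l2] /andP[l3 l4].
  have l5 : e * (`|x - s| + `|d - t|) <= e * (w + v) by rewrite ler_pM2l// lerD.
  have l6 : e * (`|x - s| + `|c - t|) <= e * (w + v) by rewrite ler_pM2l// lerD.
  by apply/andP; split; nra.
have EQ : `|iint (Q b) c d - iint (Q a) c d - be * (b - a) * v| <= 2 * e * (w + v) * v.
  rewrite ii2//; apply: iint_approx => //; first exact: ic2.
  move=> x; rewrite in_itv/= => /andP[ax xb].
  have xs : `|x - t| <= v by apply: dist.
  have cT : `|a - s| <= w by apply: dist.
  have dT : `|b - s| <= w by apply: dist.
  have := h2 a x (le_lt_trans cT w2) (le_lt_trans xs v2).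
  have := h2 b x (le_lt_trans dT w2) (le_lt_trans xs v2).
  rewrite !ler_norml => /andP[l1 l2] /andP[l3 l4].
  have l5 : e * (`|a - s| + `|x - t|) <= e * (w + v) by rewrite ler_pM2l// lerD.
  have l6 : e * (`|b - s| + `|x - t|) <= e * (w + v) by rewrite ler_pM2l// lerD.
  by apply/andP; split; nra.
have -> : bint a b c d =
   (iint (P ^~ c) a b - iint (P ^~ d) a b - be * (c - d) * w) +
   (iint (Q b) c d - iint (Q a) c d - be * (b - a) * v) by rewrite /bint /w /v; ring.
apply: le_trans (ler_normD _ _) _; apply: le_trans (lerD EP EQ) _.
by rewrite expr2; lra.
Qed.

End rectangle.

End goursat.

Section goursat_theorem.
Variable R : realType.
Implicit Types P Q : R -> R -> R.

(** [x] lists the left ends and [w] the widths; the supremum of the left ends lies in every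
    segment. *)
Lemma nested_segments (x w : nat -> R) :
  (forall k, x k <= x k.+1) -> (forall k, x k.+1 + w k.+1 <= x k + w k) ->
  (forall k, 0 <= w k) -> exists s, forall k, x k <= s /\ s <= x k + w k.
Proof.
move=> xS wS w0.
have xm i j : (i <= j)%N -> x i <= x j.
  by move=> /subnK <-; elim: (j - i)%N => // n ih; rewrite addSn (le_trans ih).
have wm i j : (i <= j)%N -> x j + w j <= x i + w i.
  by move=> /subnK <-; elim: (j - i)%N => // n ih; rewrite addSn (le_trans (wS _)).
have xw i j : x i <= x j + w j.
  case: (leqP i j) => ij; first by rewrite (le_trans (xm _ _ ij))// lerDl.
  by rewrite (le_trans _ (wm _ _ (ltnW ij)))// lerDl.
exists (sup (range x)) => k; split.
  apply: ub_le_sup; last by exists k.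
  by exists (x 0 + w 0) => _ [j _ <-]; exact: xw.
apply: ge_sup; first by exists (x 0), 0.
by move=> _ [j _ <-]; exact: xw.
Qed.

Lemma exp2_small (W r : R) : 0 < r -> exists k0, forall k, (k0 <= k)%N -> W / 2 ^+ k < r.
Proof.
move=> r0; exists (Num.bound (W / r)) => k kb.
rewrite ltr_pdivrMr ?exprn_gt0// mulrC -ltr_pdivrMr//.
apply: (@lt_le_trans _ _ (Num.bound (W / r))%:R).
  have [h|h] := ltP (W / r) 0; first exact: lt_le_trans h _.
  by rewrite archi_boundP.
by rewrite -natrX ler_nat (leq_trans kb)// ltnW// ltn_expl.
Qed.

Theorem goursat P Q a b c d : a < b -> c < d -> closed_on P Q a b c d ->
  bint P Q a b c d = 0.
Proof.
move=> ab cd cl; apply/eqP; rewrite -normr_eq0; apply: contraT => B0.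
set W := b - a; set V := d - c.
have W0 : 0 < W by rewrite subr_gt0.
have V0 : 0 < V by rewrite subr_gt0.
pose w k := W / 2 ^+ k; pose v k := V / 2 ^+ k.
have w0 k : 0 < w k by rewrite divr_gt0// exprn_gt0.
have v0 k : 0 < v k by rewrite divr_gt0// exprn_gt0.
have wS k : w k = w k.+1 + w k.+1.
  by rewrite /w exprS; field; rewrite expf_neq0.
have vS k : v k = v k.+1 + v k.+1.
  by rewrite /v exprS; field; rewrite expf_neq0.
(* Half of the ratio of the integral to the area, so that the initial rectangle satisfies the strict
   inequality of [bad]. *)
pose e := `|bint P Q a b c d| / (2 * (W * V)).
have e0 : 0 < e by rewrite divr_gt0 ?mulr_gt0// lt_neqAle eq_sym B0 normr_ge0.
pose bad k (p : R * R) := [/\ e * (w k * v k) < `|bint P Q p.1 (p.1 + w k) p.2 (p.2 + v k)|,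
  a <= p.1, p.1 + w k <= b, c <= p.2 & p.2 + v k <= d].
pose next k (p q : R * R) := [/\ bad k.+1 q, p.1 <= q.1, q.1 + w k.+1 <= p.1 + w k,
  p.2 <= q.2 & q.2 + v k.+1 <= p.2 + v k].
have cl_sub a' b' c' d' : a <= a' -> b' <= b -> c <= c' -> d' <= d -> closed_on P Q a' b' c' d'.
  move=> aa bb cc dd s t; rewrite !in_itv/= => /andP[h1 h2] /andP[h3 h4].
  by apply: cl; rewrite in_itv/= ?(le_trans aa)//= ?(le_trans h2)// ?(le_trans cc)//= (le_trans h4).
(* The claim covers all rectangles, so that [choice] returns a total function; for one that is not
   bad the implication is vacuous. Among four quarters one is bad, since the areas add up. *)
have step kp : exists q, bad kp.1 kp.2 -> next kp.1 kp.2 q.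
  case: kp => k p /=; have [|nb] := pselect (bad k p); last by exists p.
  move=> -[hB ap pb cp pd]; have w1 := w0 k.+1; have v1 := v0 k.+1.
  apply: contrapT => /forallNP nx.
  have small q : q \in [:: p; (p.1 + w k.+1, p.2); (p.1, p.2 + v k.+1);
      (p.1 + w k.+1, p.2 + v k.+1)] ->
      `|bint P Q q.1 (q.1 + w k.+1) q.2 (q.2 + v k.+1)| <= e * (w k.+1 * v k.+1).
    move=> qp; have := nx q; rewrite leNgt => nxq; apply/negP => hq; apply: nxq => _.
    move: qp hq; rewrite !inE => /or4P[] /eqP ->; rewrite /next /bad /=
      (wS k) (vS k) in ap pb cp pd *;
      by move=> hq; split; first split => //; lra.
  have E1 : p.1 + w k = p.1 + w k.+1 + w k.+1 by rewrite -addrA -wS.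
  have E2 : p.2 + v k = p.2 + v k.+1 + v k.+1 by rewrite -addrA -vS.
  have clp := cl_sub _ _ _ _ ap pb cp pd.
  move: hB; rewrite (@bint_split _ P Q _ _ _ _ (p.1 + w k.+1) (p.2 + v k.+1))
    ?E1 ?E2 ?lerDl ?(ltW w1) ?(ltW v1)//; last first.
    by rewrite -E1 -E2.
  have s1 := small p; have s2 := small (p.1 + w k.+1, p.2).
  have s3 := small (p.1, p.2 + v k.+1); have s4 := small (p.1 + w k.+1, p.2 + v k.+1).
  move: s1 s2 s3 s4; rewrite !inE !eqxx !orbT /= => /(_ isT) s1 /(_ isT) s2 /(_ isT) s3 /(_ isT) s4.
  rewrite ltNge => /negP; apply.
  apply: le_trans (ler_normD _ _) _; apply:
    le_trans (lerD (le_trans (ler_normD _ _) (lerD (ler_normD _ _) (lexx _))) (lexx _)) _.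
  apply: le_trans (lerD (lerD (lerD s1 s2) s3) s4) _.
  by rewrite (wS k) (vS k) le_eqVlt; apply/orP; left; apply/eqP; ring.
have [g hg] := choice step.
pose u := fix u k : R * R := if k is k'.+1 then g (k', u k') else (a, c).
have ub k : bad k (u k).
  elim: k => [|k /(hg (k, _))[]//].
  rewrite /bad/= /w /v expr0 !divr1 /W /V ![_ + (_ - _)]addrC !subrK; split => //.
  rewrite -/W -/V.
  have -> : e * (W * V) = `|bint P Q a b c d| / 2.
    by rewrite /e; field; rewrite !gt_eqF.
  have : 0 < `|bint P Q a b c d| by rewrite lt_neqAle eq_sym B0 normr_ge0.
  by lra.
have un k : next k (u k) (u k.+1) by exact: (hg (k, u k)).
have [s hs] : exists s, forall k, (u k).1 <= s /\ s <= (u k).1 + w k.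
  apply: nested_segments => k; [by have [] := un k|by have [] := un k|exact/ltW].
have [t ht] : exists t, forall k, (u k).2 <= t /\ t <= (u k).2 + v k.
  apply: nested_segments => k; [by have [] := un k|by have [] := un k|exact/ltW].
have st : closed_at P Q s t.
  apply: cl; rewrite in_itv/=; [have [h1 h2] := hs 0|have [h1 h2] := ht 0];
  have [_ ? ? ? ?] := ub 0; apply/andP; split; lra.
(* All rectangles are similar, so 2 e' (w k + v k)^2 is exactly half of e (w k)(v k), which
   contradicts badness. *)
have e' : 0 < e * (W * V) / (4 * (W + V) ^+ 2).
  have WV2 : 0 < (W + V) ^+ 2 by apply: exprn_gt0; exact: addr_gt0.
  by apply: divr_gt0; apply: mulr_gt0 => //; exact: mulr_gt0.
have [r r0 hr] := bint_small st e'.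
have [k1 hk1] := exp2_small W r0; have [k2 hk2] := exp2_small V r0.
pose k := maxn k1 k2.
have [hB ap pb cp pd] := ub k.
have := hr (u k).1 ((u k).1 + w k) (u k).2 ((u k).2 + v k) (cl_sub _ _ _ _ ap pb cp pd).
have [h1 h2] := hs k; have [h3 h4] := ht k.
rewrite !in_itv/= h1 h2 h3 h4 => /(_ isT isT).
rewrite ![_ + _ - _]addrAC !subrr !add0r => /(_ (hk1 _ (leq_maxl _ _)) (hk2 _ (leq_maxr _ _))).
rewrite leNgt => /negP; case; apply: le_lt_trans hB.
rewrite /w /v -mulrDl expr_div_n.
have WV : W + V != 0 by rewrite gt_eqF// addr_gt0.
have K0 : 2 ^+ k != 0 :> R by rewrite expf_neq0.
have -> : 2 * (e * (W * V) / (4 * (W + V) ^+ 2)) * ((W + V) ^+ 2 / (2 ^+ k) ^+ 2) =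
   2^-1 * (e * (W / 2 ^+ k * (V / 2 ^+ k))) by field; rewrite WV K0.
have : 0 < e * (W / 2 ^+ k * (V / 2 ^+ k)) by apply: mulr_gt0 => //; apply: mulr_gt0; [exact:
  (w0 k)|exact: (v0 k)].
by lra.
Qed.

End goursat_theorem.

(** * The mean value property on circles *)

Section mean_value.
Local Open Scope complex_scope.
Variable R : realType.
Local Notation mu := (@lebesgue_measure R).
Implicit Types (h : R[i] -> R[i]) (z w : R[i]).

Definition cderiv h z (A : R[i]) := forall e : R, 0 < e -> exists2 d : R, 0 < d &
  forall z', cmod (z' - z) < d -> cmod (h z' - h z - A * (z' - z)) <= e * cmod (z' - z).

Definition holo h := forall z, cmod z < 1 -> exists A, cderiv h z A.

(** The exponential of s + i t: a disk minus its centre becomes a half-plane of logarithmic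
    coordinates, and circles become segments. *)
Definition polar (s t : R) : R[i] := (expR s * cos t) +i* (expR s * sin t).

Lemma polarD s t s' t' : polar (s + s') (t + t') = polar s t * polar s' t'.
Proof. by rewrite /polar expRD cosD sinD; congr (_ +i* _); ring. Qed.

Lemma cmod_polar s t : cmod (polar s t) = expR s.
Proof.
apply/eqP; rewrite -(@eqrXn2 _ 2)// ?cmod_ge0 ?expR_ge0//.
by rewrite cmod_sqr/= !exprMn -mulrDr cos2Dsin2 mulr1.
Qed.

Lemma polar_2pi s : polar s (pi *+ 2) = polar s 0.
Proof. by rewrite /polar cos2pi sin2pi cos0 sin0. Qed.

Lemma is_derive_expansion (f : R -> R) (x l : R) : is_derive x 1 f l ->
  forall e, 0 < e -> exists2 d, 0 < d &
    forall x', `|x' - x| < d -> `|f x' - f x - l * (x' - x)| <= e * `|x' - x|.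
Proof.
move=> [dfx <-] e e0.
have /cvgrPdist_le /(_ _ e0) := dfx.
rewrite near_withinE => /nbhs_ballP[d /= d0 hd]; exists d => // x' xx'.
have [->|x'x] := eqVneq x' x; first by rewrite !subrr normr0 !mulr0 subrr normr0.
have y0 : x' - x != 0 by rewrite subr_eq0.
have := hd (x' - x); rewrite /ball/= sub0r normrN => /(_ xx' y0).
rewrite /GRing.scale/= mulr1 subrK => h.
set D := 'D_1 f x in h *.
have -> : f x' - f x - D * (x' - x) = - ((D - (x' - x)^-1 * (f x' - f x)) * (x' - x)).
  by field.
by rewrite normrN normrM ler_wpM2r.
Qed.

Lemma polar_expansion (e : R) : 0 < e -> exists2 d, 0 < d & forall x y, `|x| < d -> `|y| < d ->
  cmod (polar x y - 1 - x +i* y) <= e * (`|x| + `|y|).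
Proof.
(* The factors 3, 3 and 2 of the three errors in y below add up to 8. *)
move=> e0; have [e1 [e10 e1e e11]] : exists e1, [/\ 0 < e1, e1 <= e / 8 & e1 <= 1].
  exists (Num.min (e / 8) 1).
  by split; [rewrite lt_min divr_gt0//=|rewrite ge_min lexx|rewrite ge_min lexx orbT].
have dE : is_derive (0 : R) 1 expR 1 by apply: is_derive_eq; exact: expR0.
have dC : is_derive (0 : R) 1 cos 0 by apply: is_derive_eq; rewrite sin0 oppr0.
have dS : is_derive (0 : R) 1 sin 1 by apply: is_derive_eq; exact: cos0.
have [d1 d10 h1] := is_derive_expansion dE e10.
have [d2 d20 h2] := is_derive_expansion dC e10.
have [d3 d30 h3] := is_derive_expansion dS e10.
exists (Num.min e1 (Num.min d1 (Num.min d2 d3))); first by rewrite !lt_min e10 d10 d20.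
move=> x y; rewrite !lt_min => /and4P[xe xd1 xd2 xd3] /and4P[ye yd1 yd2 yd3].
have := h1 x; have := h2 y; have := h3 y.
rewrite !subr0 expR0 sin0 cos0 !subr0 mul0r subr0 !mul1r => /(_ yd3) S /(_ yd2) C /(_ xd1) E.
apply: le_trans (cmod_le_ReIm _) _; rewrite /=.
rewrite [X in `|X| + _](_ : _ = (expR x - 1 - x) + expR x * (cos y - 1)); last by ring.
rewrite [X in _ + `|X|](_ : _ = expR x * (sin y - y) + (expR x - 1) * y); last by ring.
have Ex : `|expR x - 1| <= 2 * `|x|.
  rewrite -[X in `|X|](subrK x) (le_trans (ler_normD _ _))//.
  by have := normr_ge0 x; nra.
have Ex2 : `|expR x| <= 3.
  rewrite -[X in `|X|](subrK 1) (le_trans (ler_normD _ _))// normr1.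
  by lra.
have A1 : `|expR x * (cos y - 1)| <= 3 * (e1 * `|y|) by rewrite normrM ler_pM.
have A2 : `|expR x * (sin y - y)| <= 3 * (e1 * `|y|) by rewrite normrM ler_pM.
have A3 : `|(expR x - 1) * y| <= 2 * (e1 * `|y|).
  rewrite normrM mulrA ler_wpM2r// (le_trans Ex)// ler_pM2l// ltW//.
apply: le_trans (lerD (ler_normD _ _) (ler_normD _ _)) _.
have := ler_wpM2r (normr_ge0 x) e1e; have := ler_wpM2r (normr_ge0 y) e1e.
have := mulr_ge0 (ltW e0) (normr_ge0 x).
by lra.
Qed.

(* The chain rule for [h] along the complex-analytic map [(s, t) |-> e^(s + i t) w]. *)
Lemma polar_gradient h w A s t (al be : R) :
  cderiv h (polar s t * w) A -> A * (polar s t * w) = al +i* be ->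
  has_gradient (fun s t => complex.Re (h (polar s t * w))) s t al (- be) /\
  has_gradient (fun s t => complex.Im (h (polar s t * w))) s t be al.
Proof.
move=> hA Az.
set z := polar s t * w.
suff key : forall e, 0 < e -> exists2 d, 0 < d & forall s' t', `|s' - s| < d -> `|t' - t| < d ->
    cmod (h (polar s' t' * w) - h z - A * z * ((s' - s) +i* (t' - t))) <=
      e * (`|s' - s| + `|t' - t|).
  split=> e /key[d d0 hd]; exists d => // s' t' ss' tt'; apply: le_trans (hd s' t' ss' tt').
    apply: le_trans (normr_Re_cmod _); rewrite Az /z.
    by case: (h _) => ? ?; case: (h _) => ? ? /=; rewrite mulNr.
  apply: le_trans (normr_Im_cmod _); rewrite Az /z.
  by case: (h _) => ? ?; case: (h _) => ? ? /=; rewrite [be * _ + _]addrC [al * _ + _]addrC.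
move=> e e0.
(* The errors add up to e1 (2 |z| + |A z|) times the increment, at most 2 e1 M times it; the bound
   e/(4 M) on e1 leaves room. *)
pose M := cmod z + cmod A * cmod z + 1.
have Cz := cmod_ge0 z; have CA := cmod_ge0 A; have CAz : 0 <= cmod A * cmod z by rewrite mulr_ge0.
have M0 : 0 < M by rewrite /M; lra.
have [e1 [e10 e1e e11]] : exists e1, [/\ 0 < e1, e1 <= e / (4 * M) & e1 <= 1].
  exists (Num.min (e / (4 * M)) 1).
  by split; [rewrite lt_min ltr01 andbT; apply: divr_gt0 => //; exact:
    mulr_gt0|rewrite ge_min lexx|rewrite ge_min lexx orbT].
have e1M : e1 * M <= e / 4.
  by rewrite -ler_pdivlMr// -mulrA -invfM.
have [d1 d10 hd1] := hA _ e10.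
have [d2 d20 hd2] := polar_expansion e10.
have [d [d0 dd2 dM]] : exists d, [/\ 0 < d, d <= d2 & d <= d1 / (8 * M)].
  exists (Num.min d2 (d1 / (8 * M))).
  by split; [rewrite lt_min d20; apply: divr_gt0 => //; exact:
    mulr_gt0|rewrite ge_min lexx|rewrite ge_min lexx orbT].
exists d => // s' t' ss' tt'.
have -> : polar s' t' * w = z * polar (s' - s) (t' - t).
  by rewrite /z mulrAC -polarD [s + _]addrC [t + _]addrC !subrK.
set n := `|s' - s| + `|t' - t|.
have n0 : 0 <= n by rewrite addr_ge0.
have nd : n < 2 * d by rewrite mulr_natl mulr2n ltrD.
set D := (s' - s) +i* (t' - t).
have Dn : cmod D <= n by exact: cmod_le_ReIm.
pose q := polar (s' - s) (t' - t) - 1 - D.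
have qn : cmod q <= e1 * n by apply: hd2; exact: lt_le_trans dd2.
have qE : z * polar (s' - s) (t' - t) - z = z * (D + q) by rewrite /q; ring.
have zD : cmod (z * (D + q)) <= 2 * cmod z * n.
  rewrite cmodM -mulrA mulrCA ler_wpM2l// (le_trans (cmodD _ _))//.
  by nra.
have zd1 : cmod (z * (D + q)) < d1.
  apply: le_lt_trans zD _.
  have zM : cmod z <= M by rewrite /M; lra.
  have : d * (8 * M) <= d1 by rewrite -ler_pdivlMr// mulr_gt0.
  have : cmod z * n <= M * (2 * d) by rewrite ler_pM// ltW.
  by lra.
have := hd1 (z * polar (s' - s) (t' - t)); rewrite qE => /(_ zd1) H.
rewrite (_ : _ - _ - _ = (h (z * polar (s' - s) (t' - t)) - h z - A * (z * (D + q))) +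
  A * z * q); last by ring.
apply: le_trans (cmodD _ _) _; rewrite [cmod (A * z * q)]cmodM [cmod (A * z)]cmodM.
have H2 := le_trans H (ler_wpM2l (ltW e10) zD).
have H3 := ler_wpM2l CAz qn.
have H4 : e1 * n * M <= n * (e / 4) by rewrite -mulrA mulrCA ler_wpM2l.
have H5 : e1 * n * (2 * cmod z + cmod A * cmod z) <= e1 * n * (2 * M).
  by rewrite ler_wpM2l ?mulr_ge0 ?(ltW e10)// /M; lra.
have := mulr_ge0 (ltW e0) n0.
by lra.
Qed.

(** In logarithmic coordinates the Cauchy-Riemann equations say that Im h ds + Re h dt is closed, so
    the integral of Re h over a circle can be computed on ever smaller circles, where h tends to h 0
    = 0. *)
Lemma mean_zero h w : holo h -> h 0 = 0 -> cmod w < 1 ->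
  icontinuous (fun t => complex.Re (h (polar 0 t * w))) 0 (pi *+ 2) /\
  iint (fun t => complex.Re (h (polar 0 t * w))) 0 (pi *+ 2) = 0.
Proof.
move=> hh h0 w1.
pose P s t := complex.Im (h (polar s t * w)).
pose Q s t := complex.Re (h (polar s t * w)).
have pi20 : 0 < pi *+ 2 :> R by rewrite pmulrn_lgt0// pi_gt0.
have in_disk s t : s <= 0 -> cmod (polar s t * w) < 1.
  move=> s0; rewrite cmodM cmod_polar (le_lt_trans _ w1)// ler_piMl ?cmod_ge0//.
  by rewrite -expR0 ler_expR.
have cl s : s < 0 -> closed_on P Q s 0 0 (pi *+ 2).
  move=> s0 x t; rewrite in_itv/= => /andP[_ x0] _.
  have [A hA] := hh _ (in_disk x t x0).
  case E : (A * (polar x t * w)) => [al be].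
  have [h1 h2] := polar_gradient hA E.
  by exists be, al, (- be).
have cQ s : s <= 0 -> icontinuous (Q s) 0 (pi *+ 2).
  move=> s0; have [_ h2] := closed_on_continuous (cl (s - 1) (ltr_wnDl s0 (ltrN10 _))).
  by apply: h2; rewrite in_itv/= s0 andbT gerBl.
split; first exact: (cQ 0).
(* The sides t = 0 and t = 2 pi of the rectangle cancel by periodicity; the other two are the
   circles. *)
have M s : s < 0 -> iint (Q 0) 0 (pi *+ 2) = iint (Q s) 0 (pi *+ 2).
  move=> s0; have := goursat s0 pi20 (cl s s0); rewrite /bint.
  have -> : P ^~ (pi *+ 2) = P ^~ 0 by apply/funext => x; rewrite /P polar_2pi.
  by rewrite subrr add0r => /eqP; rewrite subr_eq0 => /eqP.
apply/eqP; rewrite -normr_eq0 eq_le normr_ge0 andbT; apply/ler_addgt0Pr => e e0.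
have [A hA] : exists A, cderiv h 0 A by apply: hh; rewrite cmod0.
have [d d0 hd] := hA _ ltr01.
have CA := cmod_ge0 A.
(* On the circle of radius x, |h| is at most (1 + |A|) x for small x, so the integral is at most K
   x. *)
pose K := (1 + cmod A) * (pi *+ 2).
have K0 : 0 < K by rewrite mulr_gt0// ltr_pwDl.
have [x [x0 x1 xd xe]] : exists x, [/\ 0 < x, x < 1, x < d & K * x <= e].
  exists (Num.min (1 / 2) (Num.min (d / 2) (e / K))).
  have [m1 m2 m3] : [/\ Num.min (1 / 2) (Num.min (d / 2) (e / K)) <= 1 / 2,
     Num.min (1 / 2) (Num.min (d / 2) (e / K)) <= d / 2 &
     Num.min (1 / 2) (Num.min (d / 2) (e / K)) <= e / K].
    by split; rewrite !ge_min lexx ?orbT.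
  split; [by rewrite !lt_min !divr_gt0|lra|lra|].
  by rewrite mulrC -ler_pdivlMr.
have lx0 : ln x < 0 by rewrite ln_lt0// x0.
rewrite add0r (M _ lx0).
have := @iint_approx R (Q (ln x)) 0 (pi *+ 2) 0 ((1 + cmod A) * x) (ltW pi20) (cQ _ (ltW lx0)).
rewrite mul0r !subr0 => bd; apply: le_trans (bd _) _; last by rewrite mulrAC.
move=> t _; rewrite subr0; apply: le_trans (normr_Re_cmod _) _.
set z := polar _ _ * w.
have zx : cmod z <= x.
  by rewrite /z cmodM cmod_polar lnK// ler_piMr// ltW.
have := hd z; rewrite !subr0 h0 !subr0 mul1r => /(_ (le_lt_trans zx xd)) hz.
rewrite -(subrK (A * z) (h z)); apply: le_trans (cmodD _ _) _; rewrite cmodM.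
have := ler_wpM2l CA zx.
by lra.
Qed.

End mean_value.

(** * Composition with automorphisms, and mean squares on circles *)

Section mean_square.
Local Open Scope complex_scope.
Variable R : realType.
Local Notation mu := (@lebesgue_measure R).
Implicit Types (h g : R[i] -> R[i]) (z w : R[i]).

Lemma cderiv_cst_mul h z A c : cderiv h z A -> cderiv (fun z => c * h z) z (c * A).
Proof.
move=> hA e e0; have c0 : 0 < cmod c + 1 by rewrite ltr_wpDl ?cmod_ge0.
have [d d0 hd] := hA _ (divr_gt0 e0 c0); exists d => // z' zz'.
rewrite -mulrBr -mulrA -mulrBr cmodM.
have H := hd _ zz'; have C0 := cmod_ge0 c.
have H2 := ler_wpM2l C0 H; apply: le_trans H2 _.
rewrite mulrA ler_wpM2r ?cmod_ge0// mulrCA ler_piMr ?(ltW e0)//.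
by rewrite ler_pdivrMr// mul1r lerDl.
Qed.

Lemma cderiv_addr_cst h z A c : cderiv h z A -> cderiv (fun z => h z + c) z A.
Proof.
move=> hA e /hA[d d0 hd]; exists d => // z' /hd; congr (cmod _ <= _).
by rewrite opprD addrACA subrr addr0.
Qed.

Lemma cderiv_comp h g z A B : cderiv g z B -> cderiv h (g z) A ->
  cderiv (fun z => h (g z)) z (A * B).
Proof.
move=> hB hA e e0.
have CA := cmod_ge0 A; have CB := cmod_ge0 B.
pose M := cmod A + cmod B + 1.
have M0 : 0 < M by rewrite /M; lra.
have [e1 [e10 e1e e11]] : exists e1, [/\ 0 < e1, e1 <= e / (2 * M) & e1 <= 1].
  exists (Num.min (e / (2 * M)) 1).
  by split; [rewrite lt_min ltr01 andbT; apply: divr_gt0 => //; exact: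
    mulr_gt0|rewrite ge_min lexx|rewrite ge_min lexx orbT].
have e1M : e1 * M <= e / 2 by rewrite -ler_pdivlMr// -mulrA -invfM.
have [d1 d10 h1] := hA _ e10; have [d2 d20 h2] := hB _ e10.
exists (Num.min d2 (d1 / M)); first by rewrite lt_min d20 divr_gt0.
move=> z'; rewrite lt_min => /andP[zd2 zd1].
have n0 := cmod_ge0 (z' - z).
have H2 := h2 _ zd2.
have gz : cmod (g z' - g z) <= (cmod B + e1) * cmod (z' - z).
  rewrite -(subrK (B * (z' - z)) (g z' - g z)); apply: le_trans (cmodD _ _) _.
  by rewrite [cmod (B * _)]cmodM mulrDl addrC lerD2l.
have gM : cmod (g z' - g z) <= M * cmod (z' - z).
  by apply: le_trans gz _; rewrite ler_wpM2r// /M; lra.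
have gd1 : cmod (g z' - g z) < d1.
  by apply: le_lt_trans gM _; rewrite mulrC -ltr_pdivlMr.
have H1 := h1 _ gd1.
rewrite (_ : _ - _ - _ = (h (g z') - h (g z) - A * (g z' - g z)) +
  A * (g z' - g z - B * (z' - z))); last by ring.
apply: le_trans (cmodD _ _) _; rewrite [cmod (A * _)]cmodM.
have H3 := ler_wpM2l (ltW e10) gz.
have H4 := ler_wpM2l CA H2.
have H5 := ler_wpM2r n0 e1M.
have H6 : e1 * ((cmod B + e1) * cmod (z' - z)) <= e1 * ((cmod B + 1) * cmod (z' - z)).
  by rewrite ler_wpM2l ?(ltW e10)// ler_wpM2r// lerD2l.
have H7 := mulr_ge0 (ltW e0) n0.
by move: H5; rewrite /M; lra.
Qed.

Lemma cderiv_mob a b z : su a b -> cmod z < 1 ->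
  cderiv (mob a b) z ((b^* * z + a^*) ^- 2).
Proof.
move=> ab z1.
pose D z := b^* * z + a^*.
have D0 : D z != 0 by exact: mob_den_neq0.
have D0' : 0 < cmod (D z) by rewrite lt_neqAle eq_sym cmod_eq0 D0 cmod_ge0.
have diff z' : D z' != 0 -> mob a b z' - mob a b z - D z ^- 2 * (z' - z) =
    - (b^* * (z' - z) / (D z' * D z ^+ 2)) * (z' - z).
  move=> D0z; have e : a * a^* - b * b^* = 1.
    by rewrite !mulcJ -rmorphB; move: ab; rewrite /su => ->.
  rewrite /mob -/(D z) -/(D z').
  have -> : (a * z' + b) / D z' - (a * z + b) / D z = (a * a^* - b * b^*) * (z' - z) / (D z' * D z).
    by move: D0 D0z; rewrite /D => D0 D0z; field; rewrite D0 D0z.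
  rewrite e mul1r.
  have -> : b^* * (z' - z) = D z' - D z by rewrite /D; ring.
  by field; rewrite D0 D0z.
move=> e e0.
have B0 := cmod_ge0 b.
pose q := cmod (D z).
(* Within q / (2 (|b| + 1)) of z the denominator stays at least q / 2; the remainder in [diff] is
   then at most K |z' - z|^2. *)
pose K := 2 * (cmod b + 1) / q ^+ 3.
have q0 : 0 < q by [].
have b1 : 0 < 2 * (cmod b + 1) by lra.
have K0 : 0 < K by apply: divr_gt0 => //; exact: exprn_gt0.
exists (Num.min (q / (2 * (cmod b + 1))) (e / K)).
  by rewrite lt_min; apply/andP; split; exact: divr_gt0.
move=> z'; rewrite lt_min => /andP[zq ze].
have n0 := cmod_ge0 (z' - z).
have qz : cmod b * cmod (z' - z) <= q / 2.
  move: zq; rewrite ltr_pdivlMr; last by lra.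
  by lra.
have Dz' : q / 2 <= cmod (D z').
  have : cmod (D z) <= cmod (D z') + cmod (b^* * (z - z')).
    apply: le_trans (cmodD _ _); rewrite /D le_eqVlt; apply/orP; left; apply/eqP; congr cmod; ring.
  by rewrite cmodM cmodJ (cmodB z) -/q; lra.
have Dz0 : 0 < cmod (D z') by apply: lt_le_trans Dz'; rewrite divr_gt0.
rewrite diff -?cmod_eq0 ?gt_eqF// cmodM ler_wpM2r// cmodN !cmodM cmodV cmodM cmodX cmodJ -/q.
rewrite ler_pdivrMr; last by rewrite mulr_gt0// exprn_gt0.
have zK : cmod (z' - z) * K <= e by rewrite -ler_pdivlMr// ltW.
have q2 : 0 < q ^+ 2 by rewrite exprn_gt0.
have : cmod (z' - z) * K * (q / 2 * q ^+ 2) <= e * (cmod (D z') * q ^+ 2).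
  apply: ler_pM => //; first by rewrite mulr_ge0// ltW.
    by rewrite mulr_ge0 ?ltW// divr_gt0.
  by rewrite ler_pM2r.
have -> : cmod (z' - z) * K * (q / 2 * q ^+ 2) = cmod (z' - z) * (cmod b + 1).
  by rewrite /K; field; rewrite gt_eqF.
by lra.
Qed.

Lemma holo_mob h a b : su a b -> holo h -> holo (fun z => h (mob a b z)).
Proof.
move=> ab hh z z1; have [A hA] := hh _ (mob_disk ab z1).
eexists; apply: cderiv_comp hA; exact: cderiv_mob.
Qed.

Lemma iint_cst (c a b : R) : a <= b -> iint (fun=> c) a b = c * (b - a).
Proof.
move=> ab; apply/eqP; rewrite -subr_eq0 -normr_eq0 eq_le normr_ge0 andbT.
rewrite -[leRHS](mul0r (b - a)); apply: iint_approx => //.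
  by move=> x _; exact: cst_continuous.
by move=> x _; rewrite subrr normr0.
Qed.

Lemma integral_iint (f : R -> R) a b : icontinuous f a b ->
  (\int[mu]_(x in `[a, b]) (f x)%:E = (iint f a b)%:E)%E.
Proof.
move=> cf; rewrite /iint /Rintegral fineK//; apply: integrable_fin_num => //.
exact: icontinuous_integrable.
Qed.

Lemma icontinuous_cst (c a b : R) : icontinuous (fun=> c) a b.
Proof. by move=> t _; exact: cst_continuous. Qed.

Lemma icontinuousD (f g : R -> R) a b : icontinuous f a b -> icontinuous g a b ->
  icontinuous (fun x => f x + g x) a b.
Proof. by move=> cf cg x xab; apply: cvgD; [exact: cf|exact: cg]. Qed.

Lemma icontinuousM (f g : R -> R) a b : icontinuous f a b -> icontinuous g a b ->
  icontinuous (fun x => f x * g x) a b.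
Proof. by move=> cf cg x xab; apply: cvgM; [exact: cf|exact: cg]. Qed.

(** Expanding |h|^2 about h 0, the cross term is twice the real part of conj (h 0) (h - h 0), a
    holomorphic function vanishing at 0, whose mean is zero. *)
Lemma mean_square h w : holo h -> cmod w < 1 ->
  (\int[mu]_(t in `[0%R, (pi *+ 2)%R]) (cmod (h (polar 0 t * w)) ^+ 2)%:E =
   (cmod (h 0) ^+ 2 * (pi *+ 2))%:E +
   \int[mu]_(t in `[0%R, (pi *+ 2)%R]) (cmod (h (polar 0 t * w) - h 0) ^+ 2)%:E)%E.
Proof.
move=> hh w1.
have pi20 : 0 <= pi *+ 2 :> R by rewrite pmulrn_lge0// pi_ge0.
have hc c : holo (fun z => c * (h z - h 0)).
  move=> z z1; have [A hA] := hh z z1; exists (c * A).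
  by apply: cderiv_cst_mul; exact: cderiv_addr_cst.
have h00 c : c * (h 0 - h 0) = 0 by rewrite subrr mulr0.
(* The factors 1 and -i select the real and imaginary parts of h - h 0, of which only continuity is
   taken. *)
have [c1 _] := mean_zero (hc 1) (h00 1) w1.
have [c2 _] := mean_zero (hc (- 'i)) (h00 (- 'i)) w1.
have [c3 i3] := mean_zero (hc (h 0)^*) (h00 (h 0)^*) w1.
pose k t := h (polar 0 t * w) - h 0.
have cg : icontinuous (fun t => cmod (k t) ^+ 2) 0 (pi *+ 2).
  rewrite (_ : (fun t => _) = (fun t => complex.Re (1 * k t) * complex.Re (1 * k t) +
      complex.Re (- 'i * k t) * complex.Re (- 'i * k t))).
    by apply: icontinuousD; exact: icontinuousM.
  apply/funext => t; rewrite cmod_sqr mul1r -!expr2; congr (_ + _ ^+ 2).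
  by case: (k t) => x y /=; rewrite oppr0 mul0r sub0r mulN1r opprK.
have E t : cmod (h (polar 0 t * w)) ^+ 2 =
    cmod (h 0) ^+ 2 + (cmod (k t) ^+ 2 + 2 * complex.Re ((h 0)^* * k t)).
  rewrite /k !cmod_sqr; case: (h _) => a b; case: (h 0) => c d /=; ring.
have cr : icontinuous (fun t => cmod (k t) ^+ 2 + 2 * complex.Re ((h 0)^* * k t)) 0 (pi *+ 2).
  by apply: icontinuousD => //; apply: icontinuousM => //; exact: icontinuous_cst.
rewrite (integral_iint cg).
under eq_integral do rewrite E.
rewrite integral_iint; last first.
  by apply: icontinuousD => //; exact: icontinuous_cst.
rewrite -EFinD; congr EFin.
have i1 := icontinuous_integrable (@icontinuous_cst (cmod (h 0) ^+ 2) 0 (pi *+ 2)).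
have i2 := icontinuous_integrable cr.
have i4 := icontinuous_integrable cg.
have i5 := icontinuous_integrable (icontinuousM (@icontinuous_cst 2 0 (pi *+ 2)) c3).
rewrite /iint (RintegralD _ i1 i2)//.
congr (_ + _); first by rewrite -[LHS]/(iint _ _ _) iint_cst// subr0.
rewrite (RintegralD _ i4 i5)//.
rewrite RintegralZl//; last exact: (icontinuous_integrable c3).
by rewrite -[X in 2 * X]/(iint _ _ _) i3 mulr0 addr0.
Qed.

End mean_square.

(** * Integration against the hyperbolic area *)

Section hint_theory.
Local Open Scope complex_scope.
Variable R : realType.
Local Notation mu := (@lebesgue_measure R).
Local Notation mu2 := (mu \x mu)%E.
Local Notation P := (measurableTypeR R * measurableTypeR R)%type.
Implicit Types (h g : R[i] -> \bar R).

(* The library's own instance for products is shadowed by a later one. *)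
Definition area : set P -> \bar R := (mu \x mu)%E.

HB.instance Definition _ := Measure.copy area (mu \x mu)%E.

Lemma area_sigma_finite : sigma_finite setT area.
Proof.
have /sigma_finiteP[F [TF ndF Foo]] := sigma_finiteT mu.
exists (fun n => F n `*` F n).
  rewrite -setXTT TF predeqE => -[x y]; split.
    move=> [/= [n _ Fnx] [k _ Gky]]; exists (maxn n k) => //; split.
    - by move: x Fnx; exact/subsetPset/ndF/leq_maxl.
    - by move: y Gky; exact/subsetPset/ndF/leq_maxr.
  by move=> [n _ []/= ? ?]; split; exists n.
move=> k; have [? ?] := Foo k; split; first exact: measurableX.
by rewrite /area product_measure1E// lte_mul_pinfty// ge0_fin_numE.
Qed.

HB.instance Definition _ := Measure_isSigmaFinite.Build _ _ _ area area_sigma_finite.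

Definition cmeasurable2 d (T : measurableType d) (k : R[i] -> R[i] -> T) :=
  measurable_fun [set: P * P] (fun p => k (cx p.1) (cx p.2)).

Definition cmeasurable3 d (T : measurableType d) (k : R[i] -> R[i] -> R[i] -> T) :=
  measurable_fun [set: P * P * P] (fun p => k (cx p.1.1) (cx p.1.2) (cx p.2)).

Lemma hint_ge0 h : (forall z, 0 <= h z)%E -> (0 <= hint h)%E.
Proof.
by move=> h0; apply: integral_ge0 => p _; rewrite mule_ge0// lee_fin rho_ge0.
Qed.

Lemma eq_hint h g : (forall z, cmod z < 1 -> h z = g z) -> hint h = hint g.
Proof.
move=> hg; apply: eq_integral => p _.
by rewrite /rho; case: ifP => [/hg ->//|]; rewrite !mul0e.
Qed.

Lemma cmeasurable_rhoM h : cmeasurable h ->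
  measurable_fun [set: P] (fun p => (rho (cx p))%:E * h (cx p))%E.
Proof.
by move=> mh; apply: emeasurable_funM => //; apply/measurable_EFinP; exact: cmeasurable_rho.
Qed.

Lemma le_hint h g : cmeasurable h -> cmeasurable g -> (forall z, 0 <= h z)%E ->
  (forall z, 0 <= g z)%E ->
  (forall z, cmod z < 1 -> (h z <= g z)%E) -> (hint h <= hint g)%E.
Proof.
move=> mh mg h0 g0 hg; apply: ge0_le_integral => //.
- by move=> p _; rewrite mule_ge0// lee_fin rho_ge0.
- exact: cmeasurable_rhoM.
- exact: cmeasurable_rhoM.
- move=> p _; rewrite /rho; case: ifP => [/hg hp|_]; last by rewrite !mul0e.
  by rewrite lee_wpmul2l// lee_fin divr_ge0// sqr_ge0.
Qed.

Lemma hintD h g : cmeasurable h -> cmeasurable g -> (forall z, 0 <= h z)%E ->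
  (forall z, 0 <= g z)%E ->
  (hint (fun z => h z + g z) = hint h + hint g)%E.
Proof.
move=> mh mg h0 g0; rewrite /hint -ge0_integralD//.
- by apply: eq_integral => p _; rewrite ge0_muleDr.
- by move=> p _; rewrite mule_ge0// lee_fin rho_ge0.
- exact: cmeasurable_rhoM.
- by move=> p _; rewrite mule_ge0// lee_fin rho_ge0.
- exact: cmeasurable_rhoM.
Qed.

Lemma hintZl h k : cmeasurable h -> (forall z, 0 <= h z)%E -> (0 <= k)%E ->
  (hint (fun z => k * h z) = k * hint h)%E.
Proof.
move=> mh h0 k0; rewrite /hint -ge0_integralZl//.
- by apply: eq_integral => p _; rewrite muleCA.
- exact: cmeasurable_rhoM.
- by move=> p _; rewrite mule_ge0// lee_fin rho_ge0.
Qed.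

Lemma hint_nneseries (h : nat -> R[i] -> \bar R) : (forall n, cmeasurable (h n)) ->
  (forall n z, 0 <= h n z)%E ->
  (hint (fun z => \sum_(0 <= n <oo) h n z) = \sum_(0 <= n <oo) hint (h n))%E.
Proof.
move=> mh h0; rewrite /hint -integral_nneseries//.
- by apply: eq_integral => p _; rewrite nneseriesZl.
- by move=> n; exact: cmeasurable_rhoM.
- by move=> n p _; rewrite mule_ge0// lee_fin rho_ge0.
Qed.

Lemma cmeasurable_section d (T : measurableType d) (k : R[i] -> R[i] -> T) z :
  cmeasurable2 k -> cmeasurable (k z).
Proof.
case: z => x y mk.
exact: (measurableT_comp mk (pair1_measurable ((x, y) : P))).
Qed.

Lemma cmeasurable2_swap d (T : measurableType d) (k : R[i] -> R[i] -> T) :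
  cmeasurable2 k -> cmeasurable2 (fun z w => k w z).
Proof. by move=> mk; exact: (measurableT_comp mk (@measurable_swap _ _ P P)). Qed.

Lemma cmeasurable2_rhoM (k : R[i] -> R[i] -> \bar R) : cmeasurable2 k ->
  measurable_fun [set: P * P] (fun p => (rho (cx p.2))%:E * k (cx p.1) (cx p.2))%E.
Proof.
move=> mk; apply: emeasurable_funM => //; apply/measurable_EFinP.
exact: (measurableT_comp (@cmeasurable_rho R) (@measurable_snd _ _ P P)).
Qed.

Lemma cmeasurable_hint (k : R[i] -> R[i] -> \bar R) : cmeasurable2 k ->
  (forall z w, 0 <= k z w)%E -> cmeasurable (fun z => hint (k z)).
Proof.
move=> mk k0.
have K0 (p : P * P) : (0 <= (rho (cx p.2))%:E * k (cx p.1) (cx p.2))%E.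
  by rewrite mule_ge0// lee_fin rho_ge0.
exact: (@measurable_fun_fubini_tonelli_F _ _ P P R area _ (cmeasurable2_rhoM mk) K0).
Qed.

Lemma cmeasurable2_hint (k : R[i] -> R[i] -> R[i] -> \bar R) : cmeasurable3 k ->
  (forall z w v, 0 <= k z w v)%E -> cmeasurable2 (fun z w => hint (k z w)).
Proof.
move=> mk k0.
have K0 (p : P * P * P) : (0 <= (rho (cx p.2))%:E * k (cx p.1.1) (cx p.1.2) (cx p.2))%E.
  by rewrite mule_ge0// lee_fin rho_ge0.
have mK : measurable_fun [set: P * P * P]
    (fun p => (rho (cx p.2))%:E * k (cx p.1.1) (cx p.1.2) (cx p.2))%E.
  apply: emeasurable_funM => //; apply/measurable_EFinP.
  exact: (measurableT_comp (@cmeasurable_rho R) (@measurable_snd _ _ (P * P)%type P)).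
exact: (@measurable_fun_fubini_tonelli_F _ _ (P * P)%type P R area _ mK K0).
Qed.

Lemma hint_tonelli (k : R[i] -> R[i] -> \bar R) : cmeasurable2 k ->
  (forall z w, 0 <= k z w)%E ->
  hint (fun z => hint (k z)) = hint (fun w => hint (k^~ w)).
Proof.
move=> mk k0.
pose K (p : P * P) := ((rho (cx p.1))%:E * ((rho (cx p.2))%:E * k (cx p.1) (cx p.2)))%E.
have mK : measurable_fun setT K.
  apply: emeasurable_funM; last exact: cmeasurable2_rhoM.
  apply/measurable_EFinP.
  exact: (measurableT_comp (@cmeasurable_rho R) (@measurable_fst _ _ P P)).
have r0 (z : R[i]) : (0 <= (rho z)%:E)%E by rewrite lee_fin rho_ge0.
have K0 p : (0 <= K p)%E by rewrite !mule_ge0.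
have H := @fubini_tonelli _ _ P P R area area K mK K0.
have E1 (x : P) : ((rho (cx x))%:E * \int[area]_y ((rho (cx y))%:E * k (cx x) (cx y)) =
    \int[area]_y K (x, y))%E.
  have mx := cmeasurable_rhoM (cmeasurable_section (cx x) mk).
  have x0 (q : P) : [set: P] q -> (0 <= (rho (cx q))%:E * k (cx x) (cx q))%E by rewrite mule_ge0.
  exact/esym/(@ge0_integralZl _ P R area setT measurableT _ mx (rho (cx x))%:E x0 (r0 _)).
have E2 (y : P) : ((rho (cx y))%:E * \int[area]_x ((rho (cx x))%:E * k (cx x) (cx y)) =
    \int[area]_x K (x, y))%E.
  have my := cmeasurable_rhoM (cmeasurable_section (cx y) (cmeasurable2_swap mk)).
  have -> : (\int[area]_x K (x, y) =
      \int[area]_x ((rho (cx y))%:E * ((rho (cx x))%:E * k (cx x) (cx y))))%E.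
    by apply: eq_integral => x _; rewrite /K/= muleCA.
  have y0 (q : P) : [set: P] q -> (0 <= (rho (cx q))%:E * k (cx q) (cx y))%E by rewrite mule_ge0.
  exact/esym/(@ge0_integralZl _ P R area setT measurableT _ my (rho (cx y))%:E y0 (r0 _)).
transitivity (\int[area]_x ((rho (cx x))%:E *
    \int[area]_y ((rho (cx y))%:E * k (cx x) (cx y))))%E; first by [].
transitivity (\int[area]_y ((rho (cx y))%:E *
    \int[area]_x ((rho (cx x))%:E * k (cx x) (cx y))))%E; last by [].
transitivity (\int[area]_x \int[area]_y K (x, y))%E; first exact: eq_integral.
by rewrite H; apply: eq_integral.
Qed.

End hint_theory.

(** * Joint measurability of continuous functions *)

Section measurability.
Local Open Scope complex_scope.
Variable R : realType.
Local Notation P := (measurableTypeR R * measurableTypeR R)%type.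

(** A preimage is a countable union of fibres of [phi], whatever the function [g]. *)
Lemma measurable_countable_comp d d' (X : measurableType d) (Y : measurableType d')
    (I : countType) (phi : X -> I) (g : I -> Y) :
  (forall i, measurable (phi @^-1` [set i])) -> measurable_fun setT (fun x => g (phi x)).
Proof.
move=> mphi _ B mB; rewrite setTI.
rewrite (_ : _ @^-1` _ = \bigcup_(i in g @^-1` B) (phi @^-1` [set i])); last first.
  by apply/seteqP; split => x /=; [exists (phi x)|move=> [i gi e]; rewrite /= -e in gi].
rewrite bigcup_mkcond; apply: countable_bigcupT_measurable; first exact: countableP.
by move=> i; case: ifP.
Qed.

Definition grid (n : nat) (x : R) : int := Num.floor (x * n.+1%:R).

Lemma measurable_grid n i : measurable (grid n @^-1` [set i] : set (measurableTypeR R)).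
Proof.
rewrite (_ : _ @^-1` _ = `[i%:~R / n.+1%:R, (i + 1)%:~R / n.+1%:R[%classic)//.
have n0 : 0 < n.+1%:R :> R by rewrite ltr0n.
apply/seteqP; split => x /=; rewrite /grid in_itv/= ler_pdivrMr// ltr_pdivlMr//.
  by move=> <-; exact: floor_itv.
exact: floor_def.
Qed.

Lemma grid_dist n x : `|(grid n x)%:~R / n.+1%:R - x| <= n.+1%:R^-1.
Proof.
have n0 : 0 < n.+1%:R :> R by rewrite ltr0n.
have /andP[h1 h2] := floor_itv (x * n.+1%:R).
rewrite -(ler_pM2r n0) mulVf ?gt_eqF// -[X in _ * X]gtr0_norm// -normrM mulrBl divfK ?gt_eqF//.
rewrite rmorphD/= in h2.
by rewrite ler_norml; apply/andP; split; rewrite /grid; lra.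
Qed.

Definition gridc n (z : R[i]) : R[i] :=
  ((grid n (complex.Re z))%:~R / n.+1%:R) +i* ((grid n (complex.Im z))%:~R / n.+1%:R).

Lemma gridc_cvg (z : R[i]) (d : R) : 0 < d ->
  exists N, forall n, (N <= n)%N -> cmod (gridc n z - z) < d.
Proof.
move=> d0; exists (Num.bound (2 / d)) => n Nn.
apply: le_lt_trans (cmod_le_ReIm _) _; case: z => x y /=.
apply: le_lt_trans (lerD (grid_dist n x) (grid_dist n y)) _.
have n0 : 0 < n.+1%:R :> R by rewrite ltr0n.
have -> : n.+1%:R^-1 + n.+1%:R^-1 = 2 / n.+1%:R :> R by ring.
rewrite ltr_pdivrMr// mulrC -ltr_pdivrMr//.
apply: (@lt_le_trans _ _ (Num.bound (2 / d))%:R); first by rewrite archi_boundP// divr_ge0// ltW.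
by rewrite ler_nat (leq_trans Nn).
Qed.

Lemma cmeasurable2_gridc n d (T : measurableType d) (F : R[i] -> R[i] -> T) :
  cmeasurable2 (fun z w => F (gridc n z) (gridc n w)).
Proof.
pose phi (p : P * P) : (int * int) * (int * int) :=
  ((grid n p.1.1, grid n p.1.2), (grid n p.2.1, grid n p.2.2)).
pose c (i : int * int) : R[i] := (i.1%:~R / n.+1%:R) +i* (i.2%:~R / n.+1%:R).
apply: (measurable_countable_comp (phi := phi) (fun i => F (c i.1) (c i.2))) => -[[i j] [k l]].
rewrite (_ : _ @^-1` _ = (grid n @^-1` [set i] `*` grid n @^-1` [set j]) `*`
  (grid n @^-1` [set k] `*` grid n @^-1` [set l])).
  by apply: measurableX; apply: measurableX; exact: measurable_grid.
apply/seteqP; split => -[[x y] [z w]] /=; first by rewrite /phi/= => -[<- <- <- <-].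
by move=> [[<- <-] [<- <-]].
Qed.

Definition in_disk (z : R[i]) : bool := cmod z < 1.

Lemma cmeasurable_in_disk : cmeasurable in_disk.
Proof. by apply: measurable_fun_ltr => //; exact: cmeasurable_cmod. Qed.

Lemma cmeasurable2_fst d (T : measurableType d) (h : R[i] -> T) :
  cmeasurable h -> cmeasurable2 (fun z w => h z).
Proof. by move=> mh; exact: (measurableT_comp mh (@measurable_fst _ _ P P)). Qed.

Lemma cmeasurable2_snd d (T : measurableType d) (h : R[i] -> T) :
  cmeasurable h -> cmeasurable2 (fun z w => h w).
Proof. by move=> mh; exact: (measurableT_comp mh (@measurable_snd _ _ P P)). Qed.

(** A continuous function is the pointwise limit of its values at nearby grid points, and these
    approximations factor through a countable set. *)
Lemma continuous_cmeasurable2 (F : R[i] -> R[i] -> R) :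
  (forall z w, in_disk z -> in_disk w -> forall e, 0 < e -> exists2 d, 0 < d &
    forall z' w', cmod (z' - z) < d -> cmod (w' - w) < d -> `|F z' w' - F z w| < e) ->
  cmeasurable2 (fun z w => if in_disk z && in_disk w then F z w else 0).
Proof.
move=> cF.
have mD : cmeasurable2 (fun z w => in_disk z && in_disk w).
  by apply: measurable_and; [exact: (cmeasurable2_fst cmeasurable_in_disk)|
    exact: (cmeasurable2_snd cmeasurable_in_disk)].
(* Membership in the disk is tested at the point itself: a grid point may fall outside, but not for
   large n. *)
rewrite /cmeasurable2; apply: (@measurable_fun_cvg _ (P * P)%type R setT (fun n (p : P * P) =>
   if in_disk (cx p.1) && in_disk (cx p.2) then F (gridc n (cx p.1)) (gridc n (cx p.2)) else 0)) => //.
  move=> n; apply: measurable_fun_ifT => //; exact: cmeasurable2_gridc.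
move=> [p q] _ /=; case: ifPn => [/andP[pD qD]|_]; last exact: cvg_cst.
apply/cvgrPdist_lt => e e0.
have [d d0 hd] := cF _ _ pD qD e e0.
have [N1 hN1] := gridc_cvg (cx p) d0; have [N2 hN2] := gridc_cvg (cx q) d0.
near=> n; rewrite distrC; apply: hd; [apply: hN1|apply: hN2]; near: n; exact: nbhs_infty_ge.
Unshelve. all: by end_near. Qed.

End measurability.

(** * Radial kernels and the mean value identity *)

Section kernels.
Local Open Scope complex_scope.
Variable R : realType.
Local Notation mu := (@lebesgue_measure R).
Local Notation P := (measurableTypeR R * measurableTypeR R)%type.
Implicit Types (h : R[i] -> R[i]).

(* The density with respect to [w] of the law of a random point at a random
   distance of [z], in a uniform direction. *)
Record radial_kernel (Psi : R[i] -> R[i] -> \bar R) : Prop := RadialKernel {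
  kernel_measurable : cmeasurable2 Psi;
  kernel_ge0 : forall z w, (0 <= Psi z w)%E;
  kernel_mob : forall a b, su a b -> forall z w, cmod z < 1 -> cmod w < 1 ->
    Psi (mob a b z) (mob a b w) = Psi z w;
  kernel_mass : forall z, cmod z < 1 -> hint (Psi z) = 1%E
}.

Lemma su_polar s : su (polar 0 s : R[i]) 0.
Proof. by rewrite /su cmod0 expr0n subr0 cmod_polar expR0 expr1n. Qed.

(** A diagonal matrix acts through the quotient of its conjugate entries, which doubles the angle;
    hence t / 2. *)
Lemma mob_polar t w : mob (polar 0 (t / 2)) 0 w = polar 0 t * w :> R[i].
Proof.
have aJ : Num.conj (polar 0 (t / 2) : R[i]) = polar 0 (- (t / 2)).
  by rewrite /polar cosN sinN mulrN.
rewrite /mob addr0 rmorph0 mul0r add0r aJ.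
have a0 : polar 0 (- (t / 2)) != 0 :> R[i] by rewrite -cmod_eq0 cmod_polar expR0 oner_eq0.
apply: (mulIf a0); rewrite divfK// mulrAC -polarD addr0.
by congr (polar _ _ * _); field.
Qed.

Lemma exists_mob (z : R[i]) : cmod z < 1 -> exists a b, su a b /\ mob a b 0 = z.
Proof.
move=> z1; have z2 : 0 < 1 - cmod z ^+ 2 by rewrite subr_gt0 -cmod_lt1.
(* With a = 1/r and b = z/r, 0 goes to b / conj a = z, and |a|^2 - |b|^2 = 1. *)
pose r := Num.sqrt (1 - cmod z ^+ 2); have r0 : 0 < r by rewrite sqrtr_gt0.
have r2 : r ^+ 2 = 1 - cmod z ^+ 2 by rewrite sqr_sqrtr// ltW.
exists (r^-1)%:C, (z * (r^-1)%:C); split.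
  rewrite /su cmodM !cmod_real gtr0_norm ?invr_gt0// exprMn exprVn r2.
  by field; rewrite gt_eqF.
have cr : Num.conj (r^-1)%:C = (r^-1)%:C by exact: conjc_real.
rewrite /mob !mulr0 !add0r cr mulfK//.
by rewrite -cmod_eq0 cmod_real normr_eq0 invr_eq0 gt_eqF.
Qed.

Lemma measurable_rotation (G : R[i] -> \bar R) : cmeasurable G ->
  measurable_fun [set: measurableTypeR R * P] (fun q => G (polar 0 q.1 * cx q.2)).
Proof.
move=> mG.
have m1 := @measurable_fst _ _ (measurableTypeR R) P.
have m2 := @measurable_snd _ _ (measurableTypeR R) P.
have mcos : measurable_fun setT (@cos R) by apply: continuous_measurable_fun; exact: continuous_cos.
have msin : measurable_fun setT (@sin R) by apply: continuous_measurable_fun; exact: continuous_sin.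
have mc := measurableT_comp mcos m1; have ms := measurableT_comp msin m1.
have mx := measurableT_comp (@measurable_fst _ _ (measurableTypeR R) (measurableTypeR R)) m2.
have my := measurableT_comp (@measurable_snd _ _ (measurableTypeR R) (measurableTypeR R)) m2.
have mT : measurable_fun [set: measurableTypeR R * P]
    (fun q => (expR 0 * cos q.1 * q.2.1 - expR 0 * sin q.1 * q.2.2,
               expR 0 * cos q.1 * q.2.2 + expR 0 * sin q.1 * q.2.1)).
  apply: measurable_fun_pair.
    exact: (measurable_funB (measurable_funM (measurable_mulr (expR 0) mc) mx)
                            (measurable_funM (measurable_mulr (expR 0) ms) my)).
  exact: (measurable_funD (measurable_funM (measurable_mulr (expR 0) mc) my)
                          (measurable_funM (measurable_mulr (expR 0) ms) mx)).
exact: (measurableT_comp mG mT).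
Qed.

(** The kernel at 0 is invariant under rotations, so the left integral is the same after any
    rotation of [G]; integrating over the angle and exchanging the integrals gives the right
    side. *)
Lemma hint_rotation_average (Psi : R[i] -> R[i] -> \bar R) (G : R[i] -> \bar R) :
  radial_kernel Psi -> cmeasurable G -> (forall z, 0 <= G z)%E ->
  (hint (fun w => Psi 0%R w * G w) * (pi *+ 2)%:E =
   hint (fun w => Psi 0%R w * \int[mu]_(t in `[0%R, (pi *+ 2)%R]) G (polar 0 t * w)%R))%E.
Proof.
move=> [mPsi Psi0 Psi_mob _] mG G0.
have mrot := measurable_rotation mG.
have pi20 : 0 < pi *+ 2 :> R by rewrite pmulrn_lgt0// pi_gt0.
have mPG : cmeasurable (fun w => Psi 0%R w * G w)%E.
  by apply: emeasurable_funM => //; exact: (cmeasurable_section 0 mPsi).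
have PG0 (w : R[i]) : (0 <= Psi 0%R w * G w)%E by rewrite mule_ge0.
pose I : set R := `[0, pi *+ 2]%classic.
have inv (t : R) : hint (fun w => Psi 0%R w * G w)%E = hint (fun w =>
  Psi 0%R w * G (polar 0 t * w)%R)%E.
  rewrite -(hint_mob (su_polar (t / 2)) mPG PG0); apply: eq_hint => w w1.
  rewrite mob_polar; congr (_ * _)%E.
  rewrite -(Psi_mob _ _ (su_polar (t / 2)) 0 w) ?cmod0//.
  by rewrite !mob_polar mulr0.
(* The range of the angle is put into the integrand, so that Tonelli applies on the whole line. *)
pose k (t : R) (w : R[i]) := if 0 <= t <= pi *+ 2 then (Psi 0%R w * G (polar 0 t * w)%R)%E else 0%E.
have k0 (t : R) (w : R[i]) : (0 <= k t w)%E by rewrite /k; case: ifP => // _; rewrite mule_ge0.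
pose K (p : measurableTypeR R * P) := ((rho (cx p.2))%:E * k p.1 (cx p.2))%E.
have K0 p : (0 <= K p)%E by rewrite mule_ge0// lee_fin rho_ge0.
have mK : measurable_fun setT K.
  have m1 := @measurable_fst _ _ (measurableTypeR R) P.
  have m2 := @measurable_snd _ _ (measurableTypeR R) P.
  apply: emeasurable_funM.
    by apply/measurable_EFinP; exact: (measurableT_comp (@cmeasurable_rho R) m2).
  apply: measurable_fun_ifT => //.
    by apply: measurable_and; apply: measurable_fun_ler.
  apply: emeasurable_funM.
    exact: (measurableT_comp (cmeasurable_section 0 mPsi) m2).
  exact: mrot.
have H := @fubini_tonelli _ _ (measurableTypeR R) P R mu (@area R) K mK K0.
transitivity (\int[mu]_t \int[@area R]_p K (t, p))%E.
  transitivity (\int[mu]_(t in I) (cst (hint (fun w => Psi 0%R w * G w)) t))%E.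
    have muI : mu I = (pi *+ 2)%:E.
      by rewrite /I lebesgue_measure_itv/= lte_fin pi20 oppr0 adde0.
    rewrite -muI; apply/esym; exact: (integral_cst mu (measurable_itv _)).
  rewrite [LHS]integral_mkcond; apply: eq_integral => t _; rewrite patchE mem_setE in_itv/= /K/= /k.
  case: ifP => _; first exact: inv.
  by rewrite integral0_eq// => p _; rewrite mule0.
rewrite H; apply: eq_integral => p _.
have mGp : measurable_fun I (fun t => G (polar 0 t * cx p)).
  by apply: measurable_funTS; exact: (measurableT_comp mrot (pair2_measurable p)).
have r0 : (0 <= (rho (cx p))%:E * Psi 0%R (cx p))%E by rewrite mule_ge0// lee_fin rho_ge0.
transitivity (\int[mu]_(t in I) ((rho (cx p))%:E * Psi 0%R (cx p) * G (polar 0 t * cx p)%R))%E.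
  rewrite [RHS]integral_mkcond; apply: eq_integral => t _.
  rewrite patchE mem_setE in_itv/= /K/= /k; case: ifP => _; first by rewrite muleA.
  by rewrite mule0.
have Gp0 (t : R) : I t -> (0 <= G (polar 0 t * cx p)%R)%E by [].
rewrite (ge0_integralZl mu (measurable_itv _) mGp Gp0 r0).
by rewrite -muleA.
Qed.

(** Kernel and area are both invariant, so the automorphism passes from the centre to the
    function. *)
Lemma radial_kernel_recenter (Psi : R[i] -> R[i] -> \bar R) (G : R[i] -> \bar R) a b z :
  radial_kernel Psi -> cmeasurable G -> (forall z, 0 <= G z)%E ->
  su a b -> cmod z < 1 ->
  hint (fun w => Psi (mob a b z) w * G w)%E = hint (fun w => Psi z w * G (mob a b w))%E.
Proof.
move=> [mPsi Psi0 Psi_mob _] mG G0 ab z1.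
rewrite -(hint_mob ab (h := fun w => Psi (mob a b z) w * G w)%E).
- by apply: eq_hint => w w1; rewrite Psi_mob.
- by apply: emeasurable_funM => //; exact: (cmeasurable_section _ mPsi).
- by move=> w; rewrite mule_ge0.
Qed.

Definition cmod2 (z : R[i]) : \bar R := (cmod z ^+ 2)%:E.

Lemma cmod2_ge0 z : (0 <= cmod2 z)%E.
Proof. by rewrite lee_fin sqr_ge0. Qed.

Lemma cmeasurable_cmod2 : cmeasurable cmod2.
Proof. by apply/measurable_EFinP; apply: measurable_funX; exact: cmeasurable_cmod. Qed.

Lemma plane_map_cmod2 h : plane_map h -> cmeasurable (fun z => cmod2 (h z)).
Proof. exact: cmeasurable_comp cmeasurable_cmod2. Qed.

Lemma plane_mapB_cst h c : plane_map h -> plane_map (fun z => h z - c).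
Proof.
move=> mh; apply: (plane_map_comp (T1 := fun z => z - c)) => //.
have := plane_map_affine 1 (- c); congr (plane_map _); by apply/funext => z; rewrite mul1r.
Qed.

Lemma radial_kernel_holo0 (Psi : R[i] -> R[i] -> \bar R) h :
  radial_kernel Psi -> plane_map h -> holo h ->
  hint (fun w => Psi 0%R w * cmod2 (h w))%E =
  (cmod2 (h 0%R) + hint (fun w => Psi 0%R w * cmod2 (h w - h 0)%R))%E.
Proof.
move=> kP mh hh; have [mPsi Psi0 _ mass] := kP.
have pi20 : 0 < pi *+ 2 :> R by rewrite pmulrn_lgt0// pi_gt0.
have m1 := plane_map_cmod2 mh.
have m2 := plane_map_cmod2 (plane_mapB_cst (h 0) mh).
have mP0 := cmeasurable_section 0 mPsi.
(* The integrals over circles are not normalised, whence the factor 2 pi on both sides. *)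
suff : (hint (fun w => Psi 0%R w * cmod2 (h w)) * (pi *+ 2)%:E =
  (cmod2 (h 0%R) + hint (fun w => Psi 0%R w * cmod2 (h w - h 0)%R)) * (pi *+ 2)%:E)%E.
  move=> /(congr1 (fun x => x * (pi *+ 2)^-1%:E)%E).
  by rewrite -!muleA -EFinM divff ?gt_eqF// !mule1.
have h20 : (0 <= hint (fun w => Psi 0%R w * cmod2 (h w - h 0)%R))%E.
  by apply: hint_ge0 => w; rewrite mule_ge0// cmod2_ge0.
have c1 z : (0 <= cmod2 (h z))%E by exact: cmod2_ge0.
have c2 z : (0 <= cmod2 (h z - h 0)%R)%E by exact: cmod2_ge0.
rewrite [RHS]ge0_muleDl// (hint_rotation_average kP m1 c1) (hint_rotation_average kP m2 c2).
pose S w := (\int[mu]_(t in `[0%R, (pi *+ 2)%R]) cmod2 (h (polar 0 t * w) - h 0)%R)%E.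
have S0 w : (0 <= S w)%E by apply: integral_ge0 => t _.
have mS : cmeasurable S.
  rewrite /cmeasurable /S; under eq_fun do rewrite integral_mkcond.
  pose I : set R := `[0, pi *+ 2]%classic.
  pose K (q : P * measurableTypeR R) := if 0 <= q.2 <= pi *+ 2 then
    cmod2 (h (polar 0 q.2 * cx q.1) - h 0) else 0%E.
  have mK : measurable_fun setT K.
    apply: measurable_fun_ifT => //.
      by apply: measurable_and; apply: measurable_fun_ler.
    exact: (measurableT_comp (measurable_rotation m2) (@measurable_swap _ _ P (measurableTypeR R))).
  have K0 q : (0 <= K q)%E by rewrite /K; case: ifP => // _; exact: cmod2_ge0.
  have := @measurable_fun_fubini_tonelli_F _ _ P (measurableTypeR R) R mu K mK K0.
  congr (measurable_fun _ _); apply/funext => p; apply: eq_integral => t _.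
  by rewrite patchE mem_setE in_itv.
pose c := (cmod2 (h 0%R) * (pi *+ 2)%:E)%E.
have c0 : (0 <= c)%E by rewrite mule_ge0// ?cmod2_ge0// lee_fin ltW.
transitivity (hint (fun w => c * Psi 0%R w + Psi 0%R w * S w)%E).
  apply: eq_hint => w w1.
  have -> : (\int[mu]_(t in `[0%R, (pi *+ 2)%R]) cmod2 (h (polar 0 t * w)%R) = c + S w)%E.
    by rewrite /cmod2 mean_square// EFinM.
  by rewrite ge0_muleDr// [(c * _)%E]muleC.
rewrite hintD//.
- rewrite hintZl// mass ?cmod0// mule1//.
- exact: emeasurable_funM.
- exact: emeasurable_funM.
- by move=> w; rewrite mule_ge0.
- by move=> w; rewrite mule_ge0.
Qed.

(** The defect of the sub-mean-value property of |h|^2 is kept exactly: it is what makes the energy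
    grow. *)
Theorem radial_kernel_holo (Psi : R[i] -> R[i] -> \bar R) h z :
  radial_kernel Psi -> plane_map h -> holo h -> cmod z < 1 ->
  hint (fun w => Psi z w * cmod2 (h w))%E =
  (cmod2 (h z) + hint (fun w => Psi z w * cmod2 (h w - h z)%R))%E.
Proof.
move=> kP mh hh z1; have [a [b [ab <-]]] := exists_mob z1.
have m1 := plane_map_cmod2 mh.
have m2 := plane_map_cmod2 (plane_mapB_cst (h (mob a b 0)) mh).
have o1 : cmod (0 : R[i]) < 1 by rewrite cmod0.
rewrite (radial_kernel_recenter kP m1 _ ab o1); last by move=> w; exact: cmod2_ge0.
rewrite (radial_kernel_recenter kP m2 _ ab o1); last by move=> w; exact: cmod2_ge0.
apply: (radial_kernel_holo0 (h := fun w => h (mob a b w)) kP); last exact: holo_mob.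
by apply: plane_map_comp => //; exact: plane_map_mob.
Qed.

End kernels.

(** The scalar may be infinite; the series is read as an integral for the counting measure. *)
Lemma nneseriesZl_ereal (R : realType) (x : \bar R) (f : nat -> \bar R) : (0 <= x)%E ->
  (forall n, 0 <= f n)%E ->
  (\sum_(0 <= n <oo) x * f n = x * \sum_(0 <= n <oo) f n)%E.
Proof.
move=> x0 f0; rewrite -!ge0_integral_count//; last by move=> n; rewrite mule_ge0.
by rewrite ge0_integralZl.
Qed.

(** * Unfolding integrals over the group *)

Section unfolding.
Local Open Scope complex_scope.
Variable R : realType.
Local Notation P := (measurableTypeR R * measurableTypeR R)%type.

(* [T] enumerates the group (over the indices where [a] holds), [T'] the
   inverses; [F] is the indicator of a strict fundamental domain. *)
Variables (a : nat -> bool) (T T' : nat -> R[i] -> R[i]) (F : R[i] -> \bar R).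
Hypothesis T_mob : forall n, exists c d, su c d /\ T n = mob c d.
Hypothesis T'_mob : forall n, exists c d, su c d /\ T' n = mob c d.
Hypothesis TK : forall n z, cmod z < 1 -> T' n (T n z) = z.
Hypothesis mF : cmeasurable F.
Hypothesis F0 : forall z, (0 <= F z)%E.
Hypothesis FT : forall z, cmod z < 1 -> (\sum_(0 <= n <oo) (if a n then F (T n z) else 0) = 1)%E.
Hypothesis FT' : forall z, cmod z < 1 -> (\sum_(0 <= n <oo) (if a n then F (T' n z) else 0) = 1)%E.

Lemma plane_map_T n : plane_map (T n).
Proof. by have [c [d [cd ->]]] := T_mob n; exact: plane_map_mob. Qed.

Lemma plane_map_T' n : plane_map (T' n).
Proof. by have [c [d [cd ->]]] := T'_mob n; exact: plane_map_mob. Qed.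

Lemma hint_T n (h : R[i] -> \bar R) : cmeasurable h -> (forall z, 0 <= h z)%E ->
  hint (fun z => h (T n z)) = hint h.
Proof. by move=> mh h0; have [c [d [cd ->]]] := T_mob n; exact: hint_mob. Qed.

Lemma hint_cut (u : nat -> R[i] -> \bar R) (N : R[i] -> \bar R) :
  (forall n, cmeasurable (u n)) -> (forall n z, 0 <= u n z)%E ->
  cmeasurable N -> (forall z, 0 <= N z)%E ->
  hint (fun z => (\sum_(0 <= n <oo) (if a n then u n z else 0)) * N z)%E =
  (\sum_(0 <= n <oo) (if a n then hint (fun z => u n z * N z)%E else 0))%E.
Proof.
move=> mu u0 mN N0.
transitivity (hint (fun z => \sum_(0 <= n <oo) ((if a n then u n z else 0) * N z))%E).
  apply: eq_hint => z _; rewrite muleC -nneseriesZl_ereal//.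
    by apply: eq_eseriesr => n _; rewrite muleC.
  by move=> n; case: ifP.
rewrite hint_nneseries.
- apply: eq_eseriesr => n _; case: ifP => // _.
  by rewrite /hint integral0_eq// => p _; rewrite mul0e mule0.
- by move=> n; apply: emeasurable_funM => //; case: (a n) => //; exact: mu.
- by move=> n z; rewrite mule_ge0//; case: ifP.
Qed.

Lemma FT_measurable n : cmeasurable (fun z => F (T n z)).
Proof. exact: (cmeasurable_comp mF (plane_map_T n)). Qed.

Lemma FT'_measurable n : cmeasurable (fun z => F (T' n z)).
Proof. exact: (cmeasurable_comp mF (plane_map_T' n)). Qed.

(** A substitution by T n, after which u sees T' n (T n z) = z. *)
Lemma hint_shift n (u v : R[i] -> \bar R) : cmeasurable u -> (forall z, 0 <= u z)%E ->
  cmeasurable v -> (forall z, 0 <= v z)%E ->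
  hint (fun z => u z * v (T n z))%E = hint (fun z => u (T' n z) * v z)%E.
Proof.
move=> mu u0 mv v0.
have m1 : cmeasurable (fun z => u (T' n z)) by exact: (cmeasurable_comp mu (plane_map_T' n)).
rewrite -[RHS](hint_T n); last 2 first.
- exact: emeasurable_funM.
- by move=> z; rewrite mule_ge0.
by apply: eq_hint => z z1; rewrite TK.
Qed.

(** Both sides integrate [k] over pairs of points modulo the diagonal action, restricting the first
    or the second point to the domain. *)
Lemma unfolding_swap (k : R[i] -> R[i] -> \bar R) :
  cmeasurable2 k -> (forall z w, 0 <= k z w)%E ->
  (forall n z w, a n -> cmod z < 1 -> cmod w < 1 -> k (T n z) (T n w) = k z w) ->
  hint (fun z => F z * hint (k z))%E = hint (fun z => F z * hint (k^~ z))%E.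
Proof.
move=> mk k0 kT.
have mFk : cmeasurable2 (fun z w => F w * k z w)%E.
  by apply: emeasurable_funM => //; exact: cmeasurable2_snd.
have Fk0 (z w : R[i]) : (0 <= F w * k z w)%E by rewrite mule_ge0.
pose Q z := hint (fun w => F w * k z w)%E.
have mQ : cmeasurable Q by apply: cmeasurable_hint mFk _.
have Q0 z : (0 <= Q z)%E by apply: hint_ge0.
(* The sum of the F (T n w) is inserted as a factor 1, and invariance of [k] turns translation of w
   into translation of z. *)
have step1 z : cmod z < 1 ->
    hint (k z) = (\sum_(0 <= n <oo) (if a n then Q (T n z) else 0))%E.
  move=> z1.
  transitivity (hint (fun w => (\sum_(0 <= n <oo) (if a n then F (T n w) else 0)) * k z w)%E).
    by apply: eq_hint => w w1; rewrite FT// mul1e.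
  rewrite (hint_cut FT_measurable (fun n w => F0 (T n w)) (cmeasurable_section z mk) (k0 z)).
  apply: eq_eseriesr => n _; case: ifP => // an.
  rewrite /Q -[RHS](hint_T n).
  - by apply: eq_hint => w w1; rewrite kT.
  - exact: (cmeasurable_section _ mFk).
  - by move=> w; exact: Fk0.
transitivity (hint (fun z => (\sum_(0 <= n <oo) (if a n then Q (T n z) else 0)) * F z)%E).
  by apply: eq_hint => z z1; rewrite step1// muleC.
have mQT n : cmeasurable (fun z => Q (T n z)) by exact: (cmeasurable_comp mQ (plane_map_T n)).
rewrite (hint_cut mQT (fun n z => Q0 (T n z)) mF F0).
transitivity (\sum_(0 <= n <oo) (if a n then hint (fun z => F (T' n z) * Q z)%E else 0))%E.
  apply: eq_eseriesr => n _; case: ifP => // an.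
  by rewrite -hint_shift//; apply: eq_hint => z _; rewrite muleC.
rewrite -(hint_cut FT'_measurable (fun n z => F0 (T' n z)) mQ Q0).
(* The translates of [F] now act on z and sum to 1, so z becomes unrestricted while w lies in the
   domain. *)
transitivity (hint Q); first by apply: eq_hint => z z1; rewrite FT'// mul1e.
rewrite /Q hint_tonelli//; apply: eq_hint => w _; rewrite hintZl//.
exact: (cmeasurable_section _ (cmeasurable2_swap mk)).
Qed.

Variable N : R[i] -> \bar R.
Hypothesis mN : cmeasurable N.
Hypothesis N0 : forall z, (0 <= N z)%E.
Hypothesis NT : forall n z, a n -> cmod z < 1 -> N (T n z) = N z.

(** Each orbit meets [D], so F N is at most the sum of its products with the translates of [D];
    shifting these translates onto [F] leaves D N. Overlaps only enlarge the right side. *)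
Lemma unfolding_le (D : R[i] -> \bar R) : cmeasurable D -> (forall z, 0 <= D z)%E ->
  (forall z, cmod z < 1 -> exists2 n, a n & (1 <= D (T n z))%E) ->
  (hint (fun z => F z * N z) <= hint (fun z => D z * N z))%E.
Proof.
move=> mD D0 Dcov.
have mDT n : cmeasurable (fun z => D (T n z)) by exact: (cmeasurable_comp mD (plane_map_T n)).
have mFN : cmeasurable (fun z => F z * N z)%E by exact: emeasurable_funM.
have mDN : cmeasurable (fun z => D z * N z)%E by exact: emeasurable_funM.
have FN0 z : (0 <= F z * N z)%E by rewrite mule_ge0.
have DN0 z : (0 <= D z * N z)%E by rewrite mule_ge0.
pose S z := (\sum_(0 <= n <oo) (if a n then D (T n z) else 0))%E.
have S0 z : (0 <= S z)%E by apply: nneseries_ge0 => n _ _; case: ifP.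
have mS : cmeasurable S.
  apply: ge0_emeasurable_sum => [n p _ _|n _]; first by case: ifP.
  by case: (a n) => //; exact: mDT.
apply: (@le_trans _ _ (hint (fun z => S z * (F z * N z))%E)).
  apply: le_hint => //; first exact: emeasurable_funM.
    by move=> z; rewrite mule_ge0.
  move=> z z1; rewrite -[leLHS]mul1e lee_wpmul2r//.
  have [n an Dn] := Dcov z z1; apply: (le_trans Dn).
  rewrite /S (@nneseriesD1 _ _ n)//; last by move=> i _; case: ifP.
  by rewrite an leeDl// nneseries_ge0// => i _ _; case: ifP.
rewrite hint_cut// le_eqVlt; apply/orP; left; apply/eqP.
transitivity (\sum_(0 <= n <oo) (if a n then hint (fun z => F (T' n z) * (D z * N z))%E else 0))%E.
  apply: eq_eseriesr => n _; case: ifP => // an.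
  rewrite -hint_shift//; apply: eq_hint => z z1.
  by rewrite NT// muleCA.
rewrite -hint_cut//; last exact: FT'_measurable.
by apply: eq_hint => z z1; rewrite FT'// mul1e.
Qed.

(** The integral of the invariant [N] splits into translates of its integral over the domain. *)
Lemma unfolding_eq0 : hint (fun z => F z * N z)%E = 0%E -> hint N = 0%E.
Proof.
move=> FN.
transitivity (hint (fun z => (\sum_(0 <= n <oo) (if a n then F (T n z) else 0)) * N z)%E).
  by apply: eq_hint => z z1; rewrite FT// mul1e.
rewrite hint_cut//; last exact: FT_measurable.
rewrite eseries0// => n _ _; case: ifP => // an; rewrite -FN.
rewrite -[RHS](hint_T n); last 2 first.
- exact: emeasurable_funM.
- by move=> z; rewrite mule_ge0.
by apply: eq_hint => z z1; rewrite NT.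
Qed.

End unfolding.

(** * The normalised indicator of a hyperbolic ball *)

Section ball_kernel.
Local Open Scope complex_scope.
Variable R : realType.
Local Notation mu := (@lebesgue_measure R).
Local Notation P := (measurableTypeR R * measurableTypeR R)%type.
Implicit Types z w : R[i].

(** A ball of radius s for the pseudo-hyperbolic distance |w - z| / |1 - conj z w|, with the
    denominator cleared. *)
Definition in_ball (s : R) z w : bool := cmod (w - z) < s * cmod (1 - z^* * w).

Lemma in_ball_sym s z w : in_ball s z w = in_ball s w z.
Proof.
rewrite /in_ball cmodB -[cmod (1 - _)]cmodJ; congr (_ < _ * cmod _).
by case: z w => [a b] [c d]; congr (_ +i* _); ring.
Qed.

Lemma in_ball0 s w : in_ball s 0 w = (cmod w < s).
Proof. by rewrite /in_ball subr0 rmorph0 mul0r subr0 cmod1 mulr1. Qed.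

Lemma in_ball_mob s a b z w : su a b -> cmod z < 1 -> cmod w < 1 ->
  in_ball s (mob a b z) (mob a b w) = in_ball s z w.
Proof.
move=> ab z1 w1.
have Dz := mob_den_neq0 ab z1; have Dw := mob_den_neq0 ab w1.
pose dz := b^* * z + a^*; pose dw := b^* * w + a^*.
have e : a * a^* - b * b^* = 1.
  by rewrite !mulcJ -rmorphB; move: ab; rewrite /su => ->.
(* Here and in [E2] the denominators have the same modulus, so the comparison is unchanged. *)
have E1 : mob a b w - mob a b z = (w - z) / (dw * dz).
  rewrite -[w - z]mul1r -e /mob -/dz -/dw.
  by move: Dz Dw; rewrite /dz /dw => Dz Dw; field; rewrite Dz Dw.
have E2 : 1 - (mob a b z)^* * mob a b w = (1 - z^* * w) / (dz^* * dw).
  have dzJ : (dz^*)%R = b * z^* + a by rewrite /dz rmorphD rmorphM /= !conjCK.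
  have Dz' : b * z^* + a != 0 by rewrite -dzJ conjC_eq0.
  have key : (b * z^* + a) * (b^* * w + a^*) - (a^* * z^* + b^*) * (a * w + b) = 1 - z^* * w.
    transitivity ((a * a^* - b * b^*) * (1 - z^* * w)); first by ring.
    by rewrite e mul1r.
  rewrite -key /mob -/dz -/dw rmorphM fmorphV rmorphD rmorphM /= -/dz dzJ.
  by move: Dw; rewrite /dw => Dw; field; rewrite Dz' Dw.
rewrite /in_ball E1 E2 !cmodM !cmodV !cmodM cmodJ.
rewrite [cmod dw * _]mulrC mulrA ltr_pM2r// invr_gt0 mulr_gt0//
  lt_neqAle cmod_ge0 andbT eq_sym cmod_eq0//.
Qed.

Lemma cmeasurable2_in_ball s : 0 < s -> cmeasurable2 (in_ball s).
Proof.
move=> s0.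
have e z w : in_ball s z w = (cmod (w - z) ^+ 2 < s ^+ 2 * cmod (1 - z^* * w) ^+ 2).
  by rewrite -exprMn ltr_pXn2r// ?nnegrE ?cmod_ge0// mulr_ge0 ?cmod_ge0// ltW.
pose A (p : P * P) := (p.2.1 - p.1.1) ^+ 2 + (p.2.2 - p.1.2) ^+ 2.
pose B (p : P * P) := (1 - (p.1.1 * p.2.1 + p.1.2 * p.2.2)) ^+ 2 + (p.1.1 * p.2.2 - p.1.2 * p.2.1) ^+ 2.
have f1 := @measurable_fst _ _ P P; have f2 := @measurable_snd _ _ P P.
have x1 := measurableT_comp (@measurable_fst _ _ (measurableTypeR R) (measurableTypeR R)) f1.
have y1 := measurableT_comp (@measurable_snd _ _ (measurableTypeR R) (measurableTypeR R)) f1.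
have x2 := measurableT_comp (@measurable_fst _ _ (measurableTypeR R) (measurableTypeR R)) f2.
have y2 := measurableT_comp (@measurable_snd _ _ (measurableTypeR R) (measurableTypeR R)) f2.
have mA : measurable_fun setT A.
  by apply: measurable_funD; apply: measurable_funX; exact: measurable_funB.
have mB : measurable_fun setT B.
  apply: measurable_funD; apply: measurable_funX.
    apply: measurable_funB => //; apply: measurable_funD; [exact: (measurable_funM x1 x2)|exact:
      (measurable_funM y1 y2)].
  exact: (measurable_funB (measurable_funM x1 y2) (measurable_funM y1 x2)).
rewrite /cmeasurable2 (_ : (fun p => _) = (fun p => A p < s ^+ 2 * B p)).
  by apply: measurable_fun_ltr => //; exact: measurable_mulr.
apply/funext => -[[a b] [c d]] /=; rewrite e !cmod_sqr /A /B /cx/=.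
by congr (_ < _ * _); ring.
Qed.

Lemma integral_box (X Y : set (measurableTypeR R)) (c : \bar R) :
  measurable X -> measurable Y ->
  (\int[@area R]_(p in X `*` Y) (cst c p) = c * (mu X * mu Y))%E.
Proof.
move=> mX mY; apply: eq_trans; first exact: (integral_cst (@area R) (measurableX mX mY)).
congr (_ * _)%E; exact: product_measure1E.
Qed.

Definition ball_mass (s : R) : \bar R := hint (fun w => if cmod w < s then 1%E else 0%E).

Lemma cmeasurable_lt (s : R) : cmeasurable (fun w => if cmod w < s then 1%E else 0%E : \bar R).
Proof.
apply: measurable_fun_ifT => //.
by apply: measurable_fun_ltr => //; exact: cmeasurable_cmod.
Qed.

Lemma ball_mass_lty s : 0 < s -> s < 1 -> (ball_mass s < +oo)%E.
Proof.
move=> s0 s1.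
have s21 : 0 < 1 - s ^+ 2 by rewrite subr_gt0 expr_lt1// ltW.
(* The Poincare density on the circle of radius s, its maximum inside; the ball lies in the square
   of side 2. *)
pose M : R := 4 / (1 - s ^+ 2) ^+ 2.
have M0 : 0 <= M by rewrite divr_ge0// sqr_ge0.
pose I : set (measurableTypeR R) := `[-1, 1]%classic.
have mI : measurable (I `*` I) by apply: measurableX; exact: measurable_itv.
apply: (@le_lt_trans _ _ (\int[@area R]_(p in I `*` I) (cst M%:E p))%E).
  rewrite [leRHS]integral_mkcond; apply: ge0_le_integral => //.
  - by move=> p _; rewrite mule_ge0 ?lee_fin ?rho_ge0//; case: ifP.
  - exact: (cmeasurable_rhoM (cmeasurable_lt s)).
  - by apply/(measurable_restrictT _ _).1 => //; exact: measurable_cst.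
  move=> [x y] _; rewrite patchE; case: ifPn => zs; last first.
    by rewrite mule0; case: ifP => // _; rewrite lee_fin.
  have xs := le_lt_trans (normr_Re_cmod (cx (x, y))) zs.
  have ys := le_lt_trans (normr_Im_cmod (cx (x, y))) zs.
  rewrite ifT; last first.
    rewrite inE; split; rewrite /I /= in_itv/= -ler_norml ltW//; exact: lt_trans s1.
  rewrite mule1 lee_fin /rho (lt_trans zs s1) /poincare_density /M ler_pM2l//.
  have zs2 : cmod (cx (x, y)) ^+ 2 <= s ^+ 2 by rewrite lerXn2r ?nnegrE ?cmod_ge0 ?ltW.
  rewrite lef_pV2 ?posrE ?exprn_gt0//; last by lra.
  by rewrite lerXn2r ?nnegrE; lra.
have muI : (mu I = 2%:E)%E by rewrite /I lebesgue_measure_itv/= lte_fin ifT; [congr EFin|]; lra.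
rewrite integral_box; [|exact: measurable_itv..].
by rewrite [X in (_ * (X * X))%E]muI -!EFinM ltry.
Qed.

(** The density is smallest at the centre, where it is 4. *)
Lemma rho_ge4 z : cmod z < 1 -> 4 <= rho z.
Proof.
move=> z1; rewrite /rho z1 /poincare_density ler_pdivlMr; last first.
  by rewrite exprn_gt0// subr_gt0 -cmod_lt1.
rewrite ler_piMr//; have := sqr_ge0 (cmod z); move: z1; rewrite cmod_lt1 => h1 h2.
by rewrite exprn_ile1//; lra.
Qed.

Definition near_box (d : R) c z : bool :=
  (`|complex.Re z - complex.Re c| < d) && (`|complex.Im z - complex.Im c| < d).

Lemma cmeasurable_near_box d c : cmeasurable (near_box d c).
Proof.
have mx := @measurable_fst _ _ (measurableTypeR R) (measurableTypeR R).
have my := @measurable_snd _ _ (measurableTypeR R) (measurableTypeR R).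
apply: measurable_and; apply: measurable_fun_ltr => //.
  by apply: (measurableT_comp (@normr_measurable R setT)); exact: measurable_funB.
by apply: (measurableT_comp (@normr_measurable R setT)); exact: measurable_funB.
Qed.

Lemma hint_box_gt0 d c (h : R[i] -> \bar R) (e : R) : 0 < d -> 0 < e -> cmeasurable h ->
  (forall z, 0 <= h z)%E ->
  (forall z, near_box d c z -> cmod z < 1 /\ (e%:E <= h z)%E) -> (0 < hint h)%E.
Proof.
move=> d0 e0 mh h0 hd.
pose X : set (measurableTypeR R) := `](complex.Re c - d), (complex.Re c + d)[%classic.
pose Y : set (measurableTypeR R) := `](complex.Im c - d), (complex.Im c + d)[%classic.
have mXY : measurable (X `*` Y) by apply: measurableX; exact: measurable_itv.
apply: (@lt_le_trans _ _ (\int[@area R]_(p in X `*` Y) (cst (4 * e)%:E p))%E).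
  have len (x : R) : (mu `](x - d)%R, (x + d)%R[%classic = (d + d)%:E)%E.
    rewrite lebesgue_measure_itv/= lte_fin ifT; last by lra.
    by rewrite -EFinB; congr EFin; lra.
  rewrite integral_box; [|exact: measurable_itv..].
  rewrite [X in (_ * (X * _))%E]len [X in (_ * (_ * X))%E]len -!EFinM lte_fin.
  by apply: mulr_gt0; apply: mulr_gt0 => //; exact: addr_gt0.
rewrite [leLHS]integral_mkcond; apply: ge0_le_integral => //.
- by move=> p _; rewrite patchE; case: ifP => // _; rewrite lee_fin mulr_ge0// ltW.
- by apply/(measurable_restrictT _ _).1 => //; exact: measurable_cst.
- exact: (cmeasurable_rhoM mh).
move=> [x y] _; rewrite patchE; case: ifPn => [|_]; last by rewrite mule_ge0// lee_fin rho_ge0.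
rewrite inE /X /Y /= !in_itv/= => -[/andP[x1 x2] /andP[y1 y2]].
have nb : near_box d c (cx (x, y)).
  by rewrite /near_box /= !ltr_norml; apply/andP; split; apply/andP; split; lra.
have [z1 eh] := hd _ nb.
by rewrite EFinM lee_pmul// ?lee_fin ?(ltW e0)// rho_ge4.
Qed.

Lemma near_box_cmod d c z : near_box d c z -> cmod (z - c) < 2 * d.
Proof.
move=> /andP[h1 h2]; apply: le_lt_trans (cmod_le_ReIm _) _; rewrite mulr_natl mulr2n.
by move: h1 h2; case: z c => [x y] [a b] /= *; rewrite ltrD.
Qed.

Lemma ball_mass_gt0 s : 0 < s -> s < 1 -> (0 < ball_mass s)%E.
Proof.
move=> s0 s1; apply: (@hint_box_gt0 (s / 2) 0 _ 1) => //.
- by rewrite divr_gt0.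
- exact: cmeasurable_lt.
- by move=> z; case: ifP.
- move=> z /near_box_cmod; rewrite subr0 mulrC divfK// => zs.
  by rewrite zs; split => //; exact: lt_trans s1.
Qed.

Definition ball_kernel s z w : \bar R :=
  if in_ball s z w then ((fine (ball_mass s))^-1)%:E else 0%E.

Lemma ball_kernel_sym s z w : ball_kernel s z w = ball_kernel s w z.
Proof. by rewrite /ball_kernel in_ball_sym. Qed.

Lemma ball_kernel_radial s : 0 < s -> s < 1 -> radial_kernel (ball_kernel s).
Proof.
move=> s0 s1.
have V0 := ball_mass_gt0 s0 s1; have Voo := ball_mass_lty s0 s1.
have Vf : ball_mass s \is a fin_num by rewrite ge0_fin_numE// ltW.
have V1 : 0 < fine (ball_mass s) by rewrite fine_gt0// V0.
have mK : cmeasurable2 (ball_kernel s).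
  by apply: measurable_fun_ifT => //; exact: cmeasurable2_in_ball.
have K0 z w : (0 <= ball_kernel s z w)%E.
  by rewrite /ball_kernel; case: ifP => // _; rewrite lee_fin invr_ge0 ltW.
have Kmob a b : su a b -> forall z w, cmod z < 1 -> cmod w < 1 ->
    ball_kernel s (mob a b z) (mob a b w) = ball_kernel s z w.
  by move=> ab z w z1 w1; rewrite /ball_kernel in_ball_mob.
split => //.
move=> z z1; have [a [b [ab az]]] := exists_mob z1.
rewrite -(hint_mob ab (cmeasurable_section z mK))//.
transitivity (hint (fun w => ((fine (ball_mass s))^-1)%:E * (if (cmod w < s)%R then 1 else 0))%E).
  apply: eq_hint => w w1; rewrite -az Kmob ?cmod0//.
  by rewrite /ball_kernel in_ball0; case: ifP => _; rewrite ?mule1 ?mule0.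
rewrite hintZl.
- by rewrite -/(ball_mass s) -{2}(fineK Vf) -EFinM mulVf// gt_eqF.
- exact: cmeasurable_lt.
- by move=> w; case: ifP.
- by rewrite lee_fin invr_ge0 ltW.
Qed.

End ball_kernel.

(** * Functions of three points and composition of kernels *)

Section triple_measurability.
Variable R : realType.
Local Notation P := (measurableTypeR R * measurableTypeR R)%type.
Variables (d : measure_display) (T : measurableType d).

Let p1 : measurable_fun [set: P * P * P] (fun p => p.1.1) :=
  measurableT_comp (@measurable_fst _ _ P P) (@measurable_fst _ _ (P * P)%type P).
Let p2 : measurable_fun [set: P * P * P] (fun p => p.1.2) :=
  measurableT_comp (@measurable_snd _ _ P P) (@measurable_fst _ _ (P * P)%type P).
Let p3 : measurable_fun [set: P * P * P] (fun p => p.2) := @measurable_snd _ _ (P * P)%type P.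

(** In this name and the next three, the digits tell which of the three points are passed to [k], in
    order. *)
Lemma cmeasurable3_12 (k : R[i] -> R[i] -> T) : cmeasurable2 k ->
  cmeasurable3 (fun z w v => k z w).
Proof. by move=> mk; exact: (measurableT_comp mk (measurable_fun_pair p1 p2)). Qed.

Lemma cmeasurable3_13 (k : R[i] -> R[i] -> T) : cmeasurable2 k ->
  cmeasurable3 (fun z w v => k z v).
Proof. by move=> mk; exact: (measurableT_comp mk (measurable_fun_pair p1 p3)). Qed.

Lemma cmeasurable3_32 (k : R[i] -> R[i] -> T) : cmeasurable2 k ->
  cmeasurable3 (fun z w v => k v w).
Proof. by move=> mk; exact: (measurableT_comp mk (measurable_fun_pair p3 p2)). Qed.

Lemma cmeasurable3_23 (k : R[i] -> R[i] -> T) : cmeasurable2 k ->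
  cmeasurable3 (fun z w v => k w v).
Proof. by move=> mk; exact: (measurableT_comp mk (measurable_fun_pair p2 p3)). Qed.

Lemma cmeasurable3_section (k : R[i] -> R[i] -> R[i] -> T) z : cmeasurable3 k ->
  cmeasurable2 (k z).
Proof.
case: z => x y mk.
have m1 := measurable_fun_pair (@measurable_cst _ _ (P * P)%type P setT (x,
  y)) (@measurable_fst _ _ P P).
exact: (measurableT_comp mk (measurable_fun_pair m1 (@measurable_snd _ _ P P))).
Qed.

Lemma cmeasurable_diag (k : R[i] -> R[i] -> T) : cmeasurable2 k -> cmeasurable (fun z => k z z).
Proof.
have mid := @measurable_id _ P setT.
by move=> mk; exact: (measurableT_comp mk (measurable_fun_pair mid mid)).
Qed.

End triple_measurability.

Section weighted_tonelli.
Variable R : realType.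

Lemma hint_weighted_tonelli (A B : R[i] -> \bar R) (k : R[i] -> R[i] -> \bar R) :
  cmeasurable A -> (forall z, 0 <= A z)%E -> cmeasurable B -> (forall z, 0 <= B z)%E ->
  cmeasurable2 k -> (forall z w, 0 <= k z w)%E ->
  hint (fun v => A v * hint (fun w => B w * k v w))%E =
  hint (fun w => B w * hint (fun v => A v * k v w))%E.
Proof.
move=> mA A0 mB B0 mk k0.
have mABk : cmeasurable2 (fun v w => A v * (B w * k v w))%E.
  apply: emeasurable_funM; first exact: cmeasurable2_fst.
  by apply: emeasurable_funM => //; exact: cmeasurable2_snd.
transitivity (hint (fun v => hint (fun w => A v * (B w * k v w))%E)).
  apply: eq_hint => v _; rewrite hintZl//; last by move=> w; rewrite mule_ge0.
  by apply: emeasurable_funM => //; exact: cmeasurable_section mk.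
rewrite hint_tonelli//; last by move=> v w; rewrite !mule_ge0.
apply: eq_hint => w _; rewrite -hintZl//.
- by apply: eq_hint => v _; rewrite muleCA.
- by apply: emeasurable_funM => //; exact: cmeasurable_section (cmeasurable2_swap mk).
- by move=> v; rewrite mule_ge0.
Qed.

End weighted_tonelli.

Lemma cderivB (R : realType) (g h : R[i] -> R[i]) (z A B : R[i]) :
  cderiv g z A -> cderiv h z B -> cderiv (fun z => g z - h z) z (A - B).
Proof.
move=> gA hB e e0; have e20 : 0 < e / 2 by rewrite divr_gt0.
have [d1 d10 h1] := gA _ e20; have [d2 d20 h2] := hB _ e20.
exists (Num.min d1 d2) => [|z']; first by rewrite lt_min d10.
rewrite lt_min => /andP[/h1 k1 /h2 k2].
rewrite (_ : _ - _ = (g z' - g z - A * (z' - z)) - (h z' - h z - B * (z' - z))); last by ring.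
apply: le_trans (cmodD _ _) _; rewrite cmodN (splitr e) mulrDl; exact: lerD.
Qed.

Section composed_kernel.
Local Open Scope complex_scope.
Variable R : realType.
Implicit Types Psi Chi : R[i] -> R[i] -> \bar R.

(** The law of a two-step walk: one step from z by [Chi], then one by [Psi]. *)
Definition kernel_comp Chi Psi z w := hint (fun v => Chi z v * Psi v w)%E.

Lemma kernel_comp_radial Chi Psi :
  radial_kernel Chi -> radial_kernel Psi -> radial_kernel (kernel_comp Chi Psi).
Proof.
move=> [mC C0 Cmob C1] [mP P0 Pmob P1].
have m3 : cmeasurable3 (fun z w v => Chi z v * Psi v w)%E.
  by apply: emeasurable_funM; [exact: cmeasurable3_13|exact: cmeasurable3_32].
have k30 (z w v : R[i]) : (0 <= Chi z v * Psi v w)%E by rewrite mule_ge0.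
split.
- exact: (cmeasurable2_hint m3).
- by move=> z w; apply: hint_ge0.
- move=> a b ab z w z1 w1; rewrite /kernel_comp.
  rewrite -(hint_mob ab (h := fun v => Chi (mob a b z) v * Psi v (mob a b w))%E)//.
    by apply: eq_hint => v v1; rewrite Cmob// Pmob.
  apply: emeasurable_funM; first exact: (cmeasurable_section _ mC).
  exact: (cmeasurable_section _ (cmeasurable2_swap mP)).
- move=> z z1.
  have mz : cmeasurable2 (fun w v => Chi z v * Psi v w)%E.
    apply: emeasurable_funM; last exact: (cmeasurable2_swap mP).
    exact: (cmeasurable2_snd (cmeasurable_section z mC)).
  transitivity (hint (fun v => hint (fun w => Chi z v * Psi v w)%E)).
    exact: (hint_tonelli mz (fun w v => k30 z w v)).
  rewrite -(C1 _ z1); apply: eq_hint => v v1.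
  rewrite hintZl ?P1 ?mule1//; exact: (cmeasurable_section _ mP).
Qed.

End composed_kernel.

(** * Growth of the energy under composition *)

Section energy.
Local Open Scope complex_scope.
Variable R : realType.
Local Notation P := (measurableTypeR R * measurableTypeR R)%type.
Variables (a : nat -> bool) (T T' : nat -> R[i] -> R[i]) (F : R[i] -> \bar R).
Hypothesis T_mob : forall n, exists c d, su c d /\ T n = mob c d.
Hypothesis T'_mob : forall n, exists c d, su c d /\ T' n = mob c d.
Hypothesis TK : forall n z, cmod z < 1 -> T' n (T n z) = z.
Hypothesis mF : cmeasurable F.
Hypothesis F0 : forall z, (0 <= F z)%E.
Hypothesis FT : forall z, cmod z < 1 -> (\sum_(0 <= n <oo) (if a n then F (T n z) else 0) = 1)%E.
Hypothesis FT' : forall z, cmod z < 1 -> (\sum_(0 <= n <oo) (if a n then F (T' n z) else 0) = 1)%E.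

Variable f : R[i] -> R[i] -> R[i].
Hypothesis mRe : cmeasurable2 (fun z w => complex.Re (f z w)).
Hypothesis mIm : cmeasurable2 (fun z w => complex.Im (f z w)).
Hypothesis holo1 : forall w, cmod w < 1 -> holo (fun z => f z w).
Hypothesis holo2 : forall z, cmod z < 1 -> holo (f z).
Hypothesis fT : forall n z w, a n -> cmod z < 1 -> cmod w < 1 -> f (T n z) (T n w) = f z w.

Definition energy Psi : \bar R :=
  hint (fun z => F z * hint (fun w => Psi z w * cmod2 (f z w)))%E.

Variable C : \bar R.
Hypothesis C_fin : (C < +oo)%E.
Hypothesis C_ub : forall Psi, radial_kernel Psi -> (energy Psi <= C)%E.

Variable s : R.
Hypothesis s0 : 0 < s.
Hypothesis s1 : s < 1.

Let Chi := @ball_kernel R s.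
Let radC : radial_kernel Chi. Proof. exact: ball_kernel_radial. Qed.

(** The mean oscillation of f in its first variable over the ball around z, the second variable
    being frozen at z. *)
Definition variation z : \bar R := hint (fun v => Chi z v * cmod2 (f v z - f z z)%R)%E.

Let mC := kernel_measurable radC.
Let C0 := kernel_ge0 radC.

Let plane_f1 w : plane_map (fun z => f z w).
Proof.
apply: measurable_fun_pair.
  exact: (cmeasurable_section w (cmeasurable2_swap mRe)).
exact: (cmeasurable_section w (cmeasurable2_swap mIm)).
Qed.

Let plane_f2 z : plane_map (f z).
Proof.
apply: measurable_fun_pair.
  exact: (cmeasurable_section z mRe).
exact: (cmeasurable_section z mIm).
Qed.

Let plane_mapB (g h : R[i] -> R[i]) : plane_map g -> plane_map h -> plane_map (fun z => g z - h z).
Proof.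
rewrite /plane_map => /measurable_fun_pairP[/= g1 g2] /measurable_fun_pairP[/= h1 h2].
rewrite (_ : (fun p => _) = (fun p : R * R =>
   (complex.Re (g (cx p)) - complex.Re (h (cx p)), complex.Im (g (cx p)) - complex.Im (h (cx p))))).
  by apply: measurable_fun_pair; exact: measurable_funB.
by apply/funext => p; case: (g _) (h _) => [? ?] [? ?].
Qed.

Let mf2 : cmeasurable2 (fun z w => cmod2 (f z w)).
Proof.
rewrite /cmeasurable2 (_ : (fun p => _) = (fun p : _ * _ =>
  (complex.Re (f (cx p.1) (cx p.2)) ^+ 2 + complex.Im (f (cx p.1) (cx p.2)) ^+ 2)%:E)).
  apply/measurable_EFinP; apply: measurable_funD; exact: measurable_funX.
by apply/funext => p; rewrite /cmod2 cmod_sqr.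
Qed.

Let mdiff : cmeasurable3 (fun z w v => cmod2 (f v w - f z w)).
Proof.
rewrite /cmeasurable3 (_ : (fun p => _) = (fun p : _ * _ * _ =>
  ((complex.Re (f (cx p.2) (cx p.1.2)) - complex.Re (f (cx p.1.1) (cx p.1.2))) ^+ 2 +
   (complex.Im (f (cx p.2) (cx p.1.2)) - complex.Im (f (cx p.1.1) (cx p.1.2))) ^+ 2)%:E)).
  apply/measurable_EFinP; apply: measurable_funD; apply: measurable_funX; apply: measurable_funB.
  - exact: (cmeasurable3_32 mRe).
  - exact: (cmeasurable3_12 mRe).
  - exact: (cmeasurable3_32 mIm).
  - exact: (cmeasurable3_12 mIm).
by apply/funext => p; rewrite /cmod2 cmod_sqr; case: (f _ _) (f _ _) => [? ?] [? ?].
Qed.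

Let mdiff2 : cmeasurable2 (fun z v => cmod2 (f v z - f z z)).
Proof.
have f1 := @measurable_fst _ _ P P; have f2 := @measurable_snd _ _ P P.
exact: (measurableT_comp mdiff (measurable_fun_pair (measurable_fun_pair f1 f1) f2)).
Qed.

Lemma cmeasurable2_variation : cmeasurable2 (fun z v => Chi z v * cmod2 (f v z - f z z)%R)%E.
Proof. exact: emeasurable_funM. Qed.

Lemma variation_ge0 z : (0 <= variation z)%E.
Proof. by apply: hint_ge0 => v; rewrite mule_ge0// cmod2_ge0. Qed.

Lemma variation_measurable : cmeasurable variation.
Proof.
apply: (cmeasurable_hint cmeasurable2_variation).
by move=> z v; rewrite mule_ge0// cmod2_ge0.
Qed.

Let hint_T_mob n (h : R[i] -> \bar R) : cmeasurable h -> (forall z, 0 <= h z)%E ->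
  hint (fun z => h (T n z)) = hint h.
Proof. exact: hint_T. Qed.

Let holoB (g h : R[i] -> R[i]) : holo g -> holo h -> holo (fun z => g z - h z).
Proof.
move=> hg hh z z1; have [A gA] := hg z z1; have [B hB] := hh z z1.
by exists (A - B); exact: cderivB.
Qed.

Lemma energy_comp Psi : radial_kernel Psi ->
  (energy Psi + hint (fun z => F z * variation z) <= energy (kernel_comp Chi Psi))%E.
Proof.
move=> radP; have [mP P0 Pmob P1] := radP; have Cmob := kernel_mob radC.
have f20 (z w : R[i]) := cmod2_ge0 (f z w).
pose k x y := hint (fun w => Psi x w * cmod2 (f y w))%E.
have mk : cmeasurable2 k.
  apply: (cmeasurable2_hint (k := fun x y w => Psi x w * cmod2 (f y w))%E).
    by apply: emeasurable_funM; [exact: (cmeasurable3_13 mP)|exact: (cmeasurable3_23 mf2)].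
  by move=> x y w; rewrite mule_ge0.
have k0 x y : (0 <= k x y)%E by apply: hint_ge0 => w; rewrite mule_ge0.
have kT n x y : a n -> cmod x < 1 -> cmod y < 1 -> k (T n x) (T n y) = k x y.
  move=> an x1 y1; rewrite /k -(hint_T_mob n); last 2 first.
  - by apply: emeasurable_funM; [exact: cmeasurable_section mP|exact: cmeasurable_section mf2].
  - by move=> w; rewrite mule_ge0.
  apply: eq_hint => w w1; rewrite fT//; congr (_ * _)%E.
  by have [c [d [cd ->]]] := T_mob n; rewrite Pmob.
have -> : energy (kernel_comp Chi Psi) = hint (fun z => F z * hint (fun v => Chi z v * k z v))%E.
  transitivity (hint (fun z => F z * hint (fun v => Chi z v * k v z))%E).
    apply: eq_hint => z z1; congr (_ * _)%E.
    transitivity (hint (fun w => cmod2 (f z w) * hint (fun v => Chi z v * Psi v w))%E).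
      by apply: eq_hint => w _; rewrite muleC.
    transitivity (hint (fun v => Chi z v * hint (fun w => cmod2 (f z w) * Psi v w))%E).
      apply: (hint_weighted_tonelli (k := fun w v => Psi v w)) => //.
      - exact: (cmeasurable_section z mf2).
      - exact: (cmeasurable_section z mC).
      - exact: cmeasurable2_swap.
    by apply: eq_hint => v _; congr (_ * _)%E; apply: eq_hint => w _; rewrite muleC.
  (* Unfolding renames (z, v) as (v, z); symmetry of [Chi] then restores its arguments, and the
     kernel [Psi] is now centred at z. *)
  transitivity (hint (fun z => F z * hint (fun v => Chi v z * k z v))%E).
    apply: (unfolding_swap T_mob T'_mob TK mF F0 FT FT' (k := fun z v => Chi z v * k v z)%E).
    - by apply: emeasurable_funM => //; exact: cmeasurable2_swap.
    - by move=> z w; rewrite mule_ge0.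
    - move=> n z w an z1 w1; rewrite kT//; congr (_ * _)%E.
      by have [c [d [cd ->]]] := T_mob n; rewrite Cmob.
  apply: eq_hint => z _; congr (_ * _)%E; apply: eq_hint => v _.
  by rewrite /Chi ball_kernel_sym.
pose e z := hint (fun w => Psi z w * cmod2 (f z w))%E.
have me : cmeasurable e by exact: cmeasurable_diag mk.
have e0 z : (0 <= e z)%E by exact: k0.
have mFe : cmeasurable (fun z => F z * e z)%E by exact: emeasurable_funM.
have mFV : cmeasurable (fun z => F z * variation z)%E.
  by apply: emeasurable_funM => //; exact: variation_measurable.
have Fe0 z : (0 <= F z * e z)%E by rewrite mule_ge0.
have FV0 z : (0 <= F z * variation z)%E by rewrite mule_ge0// variation_ge0.
have -> : (energy Psi + hint (fun z => F z * variation z) =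
    hint (fun z => F z * e z + F z * variation z))%E by rewrite (hintD mFe mFV Fe0 FV0).
have mCk : cmeasurable (fun z => hint (fun v => Chi z v * k z v)%E).
  apply: (cmeasurable_hint (k := fun z v => Chi z v * k z v)%E).
    exact: emeasurable_funM.
  by move=> z v; rewrite mule_ge0.
apply: le_hint.
- exact: emeasurable_funD.
- exact: emeasurable_funM.
- by move=> z; rewrite adde_ge0.
- by move=> z; rewrite mule_ge0// hint_ge0// => v; rewrite mule_ge0.
move=> z z1; rewrite -ge0_muleDr//; last exact: variation_ge0.
rewrite lee_wpmul2l//.
have mCz : cmeasurable (Chi z) by exact: cmeasurable_section mC.
have mPz : cmeasurable (Psi z) by exact: cmeasurable_section mP.
have mdz : cmeasurable2 (fun w v => cmod2 (f v w - f z w)) by exact: cmeasurable3_section mdiff.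
have -> : hint (fun v => Chi z v * k z v)%E =
    hint (fun w => Psi z w * hint (fun v => Chi z v * cmod2 (f v w)))%E.
  rewrite (hint_weighted_tonelli mCz (C0 z) mPz (P0 z) mf2)//.
have mI : cmeasurable (fun w => hint (fun v => Chi z v * cmod2 (f v w - f z w)%R)%E).
  apply: (cmeasurable_hint (k := fun w v => Chi z v * cmod2 (f v w - f z w)%R)%E).
    by apply: emeasurable_funM => //; exact: cmeasurable2_snd.
  by move=> w v; rewrite mule_ge0// cmod2_ge0.
have I0 w : (0 <= hint (fun v => Chi z v * cmod2 (f v w - f z w)%R)%E)%E.
  by apply: hint_ge0 => v; rewrite mule_ge0// cmod2_ge0.
(* Mean value identity in the first variable of f, at fixed w; the main term is the energy density
   of [Psi]. *)
have -> : hint (fun w => Psi z w * hint (fun v => Chi z v * cmod2 (f v w)))%E =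
    (e z + hint (fun w => Psi z w * hint (fun v => Chi z v * cmod2 (f v w - f z w)%R)))%E.
  transitivity (hint (fun w => Psi z w * cmod2 (f z w) +
     Psi z w * hint (fun v => Chi z v * cmod2 (f v w - f z w)%R))%E).
    apply: eq_hint => w w1; rewrite -ge0_muleDr//; congr (_ * _)%E.
    exact: (radial_kernel_holo radC (plane_f1 w) (holo1 w1) z1).
  apply: hintD.
  - by apply: emeasurable_funM => //; exact: cmeasurable_section mf2.
  - exact: emeasurable_funM.
  - by move=> w; rewrite mule_ge0.
  - by move=> w; rewrite mule_ge0.
apply: leeD2l.
have -> : hint (fun w => Psi z w * hint (fun v => Chi z v * cmod2 (f v w - f z w)%R))%E =
   hint (fun v => Chi z v * hint (fun w => Psi z w * cmod2 (f v w - f z w)%R))%E.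
  apply: hint_weighted_tonelli => // w v; exact: cmod2_ge0.
have J0 v : (0 <= hint (fun w => Psi z w * cmod2 (f v w - f z w)%R)%E)%E.
  by apply: hint_ge0 => w; rewrite mule_ge0// cmod2_ge0.
apply: le_hint.
- by apply: emeasurable_funM => //; exact: cmeasurable_section mdiff2.
- apply: emeasurable_funM => //.
  apply: (cmeasurable_hint (k := fun v w => Psi z w * cmod2 (f v w - f z w)%R)%E).
    by apply: emeasurable_funM; [exact: cmeasurable2_snd|exact: (cmeasurable2_swap mdz)].
  by move=> w v; rewrite mule_ge0// cmod2_ge0.
- by move=> v; rewrite mule_ge0// cmod2_ge0.
- by move=> v; rewrite mule_ge0.
move=> v v1; apply: lee_wpmul2l => //.
(* Mean value identity in the second variable, for f v - f z at the centre z; the non-negative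
   remainder, which depends on [Psi], is dropped. *)
have mvz := plane_mapB (plane_f2 v) (plane_f2 z).
rewrite (radial_kernel_holo radP mvz (holoB (holo2 v1) (holo2 z1)) z1).
by rewrite leeDl// hint_ge0// => w; rewrite mule_ge0// cmod2_ge0.
Qed.

Let variation_T n z : a n -> cmod z < 1 -> variation (T n z) = variation z.
Proof.
move=> an z1; rewrite /variation -(hint_T_mob n); last 2 first.
- apply: emeasurable_funM; [exact: cmeasurable_section mC|exact: cmeasurable_section mdiff2].
- by move=> v; rewrite mule_ge0// cmod2_ge0.
apply: eq_hint => v v1; rewrite !fT//; congr (_ * _)%E.
by have [c [d [cd ->]]] := T_mob n; rewrite (kernel_mob radC).
Qed.

(** The gain g0 is the same for every kernel, so it can be added to the supremum L of the energies
    without exceeding L. *)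
Lemma variation_eq0 : hint variation = 0%E.
Proof.
apply: (unfolding_eq0 T_mob mF F0 FT variation_measurable variation_ge0 variation_T).
pose S := [set energy Psi | Psi in @radial_kernel R].
pose L := ereal_sup S; pose g0 := hint (fun z => F z * variation z)%E.
have g00 : (0 <= g0)%E by apply: hint_ge0 => z; rewrite mule_ge0// variation_ge0.
have e0 Psi : radial_kernel Psi -> (0 <= energy Psi)%E.
  move=> kP; apply: hint_ge0 => z; rewrite mule_ge0// hint_ge0// => w.
  by rewrite mule_ge0// ?cmod2_ge0// (kernel_ge0 kP).
have L0 : (0 <= L)%E.
  by apply: le_trans (e0 _ radC) _; apply: ereal_sup_ubound; exists Chi.
have Lfin : L \is a fin_num.
  rewrite ge0_fin_numE//; apply: le_lt_trans C_fin; apply: ge_ereal_sup => _ [Psi kP <-].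
  exact: C_ub.
have L_step Psi : radial_kernel Psi -> (energy Psi + g0 <= L)%E.
  move=> kP; apply: le_trans (energy_comp kP) _; apply: ereal_sup_ubound.
  by exists (kernel_comp Chi Psi) => //; exact: kernel_comp_radial.
(* Finiteness of g0, needed to subtract it, comes from a single step. *)
have g0L : (g0 <= L)%E.
  apply: (@le_trans _ _ (energy Chi + g0)%E); last exact: (L_step _ radC).
  rewrite -[leLHS]add0e; apply: leeD2r; exact: (e0 _ radC).
have Loo : (L < +oo)%E by rewrite ltey_eq Lfin.
have g0fin : g0 \is a fin_num by rewrite (ge0_fin_numE g00) (le_lt_trans g0L Loo).
have LL : (L <= L - g0)%E.
  apply: ge_ereal_sup => _ [Psi kP <-]; rewrite leeBrDr; last exact: g0fin.
  exact: L_step.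
apply/eqP; rewrite eq_le; apply/andP; split; last exact: g00.
move: LL; rewrite leeBrDr; last exact: g0fin.
by rewrite -[X in (_ <= X)%E]adde0 (leeD2lE _ _ Lfin).
Qed.

End energy.

(** * From vanishing variation to an identity on the diagonal *)

Section vanishing_variation.
Local Open Scope complex_scope.
Variable R : realType.
Variable f : R[i] -> R[i] -> R[i].

Definition jointly_continuous := forall z w : R[i], cmod z < 1 -> cmod w < 1 ->
  forall e : R, 0 < e -> exists2 d : R, 0 < d &
  forall z' w', cmod (z' - z) < d -> cmod (w' - w) < d -> cmod (f z' w' - f z w) < e.

Hypothesis mRe : cmeasurable2 (fun z w => complex.Re (f z w)).
Hypothesis mIm : cmeasurable2 (fun z w => complex.Im (f z w)).
Hypothesis cf : jointly_continuous.

(** The difference of the squares is (1 - |z|^2)(1 - |w|^2). *)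
Lemma schwarz_pick (z w : R[i]) : cmod z < 1 -> cmod w < 1 -> cmod (w - z) < cmod (1 - z^* * w).
Proof.
rewrite !cmod_lt1 => z1 w1.
rewrite -(@ltr_pXn2r _ 2)// ?nnegrE ?cmod_ge0// -subr_gt0.
rewrite (_ : _ - _ = (1 - cmod z ^+ 2) * (1 - cmod w ^+ 2)); first by rewrite mulr_gt0; lra.
by case: z w {z1 w1} => [a b] [c d]; rewrite !cmod_sqr /=; ring.
Qed.

Lemma in_ball_near s (z w : R[i]) : 0 < s -> in_ball s z w -> exists2 d : R, 0 < d &
  forall z' w', cmod (z' - z) < d -> cmod (w' - w) < d -> in_ball s z' w'.
Proof.
move=> s0; rewrite {1}/in_ball -subr_gt0; set g := s * _ - _ => g0; rewrite /in_ball.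
have Z0 := cmod_ge0 z; have W0 := cmod_ge0 w.
(* Moving both points by at most m <= 1 changes |w - z| by at most 2 m, and the right side of the
   comparison by at most the rest of M times m. *)
pose M := 2 + s * (cmod z + cmod w + 1).
have sM : 0 <= s * (cmod z + cmod w + 1) by rewrite mulr_ge0 ?ltW//; lra.
have M0 : 0 < M by rewrite /M; lra.
exists (Num.min 1 (g / M)) => [|z' w']; first by rewrite lt_min ltr01 divr_gt0.
rewrite !lt_min => /andP[z1 zg] /andP[w1 wg].
have lipB (x y : R[i]) : cmod x <= cmod y + cmod (x - y).
  by rewrite -{1}(subrKC y x); exact: cmodD.
have H1 := lipB (w' - z') (w - z); have H2 := lipB (1 - z^* * w) (1 - z'^* * w').
have E1 : cmod (w' - z' - (w - z)) <= cmod (w' - w) + cmod (z' - z).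
  rewrite [cmod (z' - z)]cmodB; apply: le_trans (cmodD _ _).
  by rewrite le_eqVlt; apply/orP; left; apply/eqP; congr cmod; ring.
have E2 : cmod (1 - z^* * w - (1 - z'^* * w')) <=
  (cmod z + 1) * cmod (w' - w) + cmod (z' - z) * cmod w.
  rewrite (_ : _ - _ = z'^* * (w' - w) + (z' - z)^* * w); last by rewrite rmorphB /=; ring.
  apply: le_trans (cmodD _ _) _; rewrite !cmodM; apply: lerD; last by rewrite cmodJ.
  rewrite cmodJ ler_wpM2r ?cmod_ge0//; have := lipB z' z; lra.
have z0 := cmod_ge0 (z' - z); have w0 := cmod_ge0 (w' - w).
pose m := Num.max (cmod (z' - z)) (cmod (w' - w)).
have zm : cmod (z' - z) <= m by rewrite le_max lexx.
have wm : cmod (w' - w) <= m by rewrite le_max lexx orbT.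
have mg : m * M < g by rewrite -ltr_pdivlMr// gt_max zg wg.
have F2 : (cmod z + 1) * cmod (w' - w) + cmod (z' - z) * cmod w <= (cmod z + cmod w + 1) * m.
  have k1 : (cmod z + 1) * cmod (w' - w) <= (cmod z + 1) * m by rewrite ler_wpM2l//; lra.
  have k2 : cmod (z' - z) * cmod w <= m * cmod w by rewrite ler_wpM2r.
  by lra.
have F3 : s * cmod (1 - z^* * w) <= s * (cmod (1 - z'^* * w') + (cmod z + cmod w + 1) * m).
  by apply: ler_wpM2l; [exact: ltW|lra].
move: mg F3; rewrite /M /g. by lra.
Qed.

Lemma variation_eq0_const : (forall s : R, 0 < s -> s < 1 -> hint (variation f s) = 0%E) ->
  forall z v : R[i], cmod z < 1 -> cmod v < 1 -> f v z = f z z.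
Proof.
move=> V0 z v z1 v1; apply/eqP; apply/negPn/negP => neq.
(* Two perturbations of size e leave a difference of at least 2 e. *)
pose e := cmod (f v z - f z z) / 4.
have e0 : 0 < e by rewrite divr_gt0// lt_neqAle cmod_ge0 andbT eq_sym cmod_eq0 subr_eq0.
have SP := schwarz_pick z1 v1.
have D0 : 0 < cmod (1 - z^* * v) by exact: le_lt_trans (cmod_ge0 _) SP.
(* Halfway between the pseudo-hyperbolic distance of z and v and 1: the ball around z then contains
   v. *)
pose s := (1 + cmod (v - z) / cmod (1 - z^* * v)) / 2.
have q0 : 0 <= cmod (v - z) / cmod (1 - z^* * v) by rewrite divr_ge0 ?cmod_ge0.
have q1 : cmod (v - z) / cmod (1 - z^* * v) < 1 by rewrite ltr_pdivrMr// mul1r.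
have s0 : 0 < s by rewrite /s; lra.
have s1 : s < 1 by rewrite /s; lra.
have zv : in_ball s z v by rewrite /in_ball -ltr_pdivrMr// /s; lra.
have [d1 d10 h1] := in_ball_near s0 zv.
have [d2 d20 h2] := cf v1 z1 e0.
have [d3 d30 h3] := cf z1 z1 e0.
(* Halved because two points of a box of half-side d about its centre are compared through the
   modulus bound 2 d. *)
pose d := Num.min d1 (Num.min d2 (Num.min d3 (Num.min (1 - cmod z) (1 - cmod v)))) / 2.
have d0 : 0 < d by rewrite divr_gt0// !lt_min d10 d20 d30 !subr_gt0 z1 v1.
pose c := (e ^+ 2 * (fine (ball_mass s))^-1)%R.
have V1 : 0 < fine (ball_mass s).
  by apply: fine_gt0; rewrite ball_mass_gt0// ball_mass_lty.
have c0 : 0 < c by rewrite mulr_gt0 ?exprn_gt0 ?invr_gt0.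
(* A lower bound of the integrand near v that is uniform for x near z, so that both integrals are
   bounded below on boxes. *)
pose g (w : R[i]) : \bar R := if near_box d v w then c%:E else 0%E.
have mg : cmeasurable g.
  by apply: measurable_fun_ifT => //; exact: cmeasurable_near_box.
have g0 w : (0 <= g w)%E by rewrite /g; case: ifP => // _; rewrite lee_fin ltW.
have radC := ball_kernel_radial s0 s1.
have K0 (x y : R[i]) : (0 <= ball_kernel s x y * cmod2 (f y x - f x x)%R)%E.
  by rewrite mule_ge0 ?cmod2_ge0 ?(kernel_ge0 radC).
have near x y : near_box d z x -> near_box d v y ->
   [/\ cmod x < 1, cmod y < 1, in_ball s x y & e <= cmod (f y x - f x x)].
  move=> /near_box_cmod; rewrite mulrC divfK// !lt_min => /and5P[x1 x2 x3 x4 x5].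
  move=> /near_box_cmod; rewrite mulrC divfK// !lt_min => /and5P[y1 y2 y3 y4 y5].
  split; last 2 first.
  - exact: h1.
  - have k2 := h2 _ _ y2 x2; have k3 := h3 _ _ x3 x3.
    have : cmod (f v z - f z z) <= cmod (f y x - f x x) + cmod (f y x - f v z) + cmod (f x x - f z z).
      rewrite [cmod (f y x - f v z)]cmodB.
      apply: le_trans (lerD (cmodD _ _) (lexx _)); apply: le_trans (cmodD _ _).
      by rewrite le_eqVlt; apply/orP; left; apply/eqP; congr cmod; ring.
    rewrite (_ : cmod (f v z - f z z) = 4 * e); last by rewrite /e mulrC divfK.
    by move: k2 k3; lra.
  - rewrite -(subrK z x); apply: le_lt_trans (cmodD _ _) _; lra.
  - rewrite -(subrK v y); apply: le_lt_trans (cmodD _ _) _; lra.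
have gV x : near_box d z x -> (hint g <= variation f s x)%E.
  move=> nx; apply: le_hint => //.
    exact: (cmeasurable_section x (cmeasurable2_variation mRe mIm s0 s1)).
  move=> y y1; rewrite /g; case: ifP => ny; last exact: K0.
  have [_ _ b le] := near _ _ nx ny.
  rewrite /ball_kernel b /cmod2 -EFinM lee_fin /c mulrC ler_pM2l ?invr_gt0//.
  by rewrite lerXn2r// nnegrE ?cmod_ge0// ltW.
have G0 : (0 < hint g)%E.
  apply: (hint_box_gt0 (d := d) (c := v) (e := c)) => // y ny; split.
    have z0 : near_box d z z by rewrite /near_box !subrr !normr0 d0.
    by have [_ ? _ _] := near _ _ z0 ny.
  by rewrite /g ny.
have [e' e'0 e'g] : exists2 e' : R, 0 < e' & (e'%:E <= hint g)%E.
  case: (hint g) G0 => [r| |]//; first by rewrite lte_fin => r0; exists r.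
  by exists 1; rewrite ?leey.
have : (0 < hint (variation f s))%E.
  apply: (hint_box_gt0 (d := d) (c := z) (e := e')) => //.
  - exact: variation_measurable.
  - exact: variation_ge0.
  - move=> x nx; split; last exact: le_trans e'g (gV _ nx).
    have v0 : near_box d v v by rewrite /near_box !subrr !normr0 d0.
    by have [? _ _ _] := near _ _ nx v0.
by rewrite V0// ltxx.
Qed.

End vanishing_variation.

(** * Topology of the disk and of the quotient surface *)

Section disk_topology.
Local Open Scope complex_scope.
Variable R : realType.

Lemma cnbhsP (z : R[i]) (A : set R[i]) :
  nbhs z A <-> exists2 d : R, 0 < d & forall z', cmod (z' - z) < d -> A z'.
Proof.
split.
  (* A positive element of R[i] has imaginary part zero, so the complex radius is a real number. *)
  move=> /nbhs_ballP[e /= e0 eA]; move: e0; rewrite ltcE => /andP[/eqP ie re].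
  exists (complex.Re e) => // z' zz'; apply: eA; rewrite -ball_normE /= distrC cmodE.
  by rewrite ltcE /= ie eqxx.
move=> [d d0 dA]; apply/nbhs_ballP; exists d%:C => /=; first by rewrite ltcR.
by move=> z'; rewrite -ball_normE /= distrC cmodE ltcR; exact: dA.
Qed.

Lemma disk_openP (U : set (disk R)) : open U <->
  forall z, U z -> exists2 d : R, 0 < d & forall z' : disk R,
    cmod (set_val z' - set_val z) < d -> U z'.
Proof.
split.
  move=> [A oA <-] z Az.
  have /cnbhsP[d d0 dA] : nbhs (set_val z) A by rewrite nbhsE; exists A.
  by exists d => // z' /dA.
move=> oU.
exists [set x : R[i] | exists z : disk R, U z /\ exists2 d : R, 0 < d &
   cmod (x - set_val z) < d /\ forall z' : disk R, cmod (set_val z' - set_val z) < d -> U z'].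
  rewrite openE => x [z [Uz [d d0 [xz dU]]]]; apply/cnbhsP.
  exists (d - cmod (x - set_val z)); first by rewrite subr_gt0.
  move=> x' xx'; exists z; split => //; exists d => //; split => //.
  by rewrite -(subrK x x') -addrA (le_lt_trans (cmodD _ _))// -ltrBrDr.
apply/seteqP; split => z /=; first by move=> [y [Uy [d d0 [zd]]]]; exact.
move=> Uz; exists z; split => //; have [d d0 dU] := oU _ Uz; exists d => //.
by rewrite subrr cmod0.
Qed.

Lemma cmod_set_val (z : disk R) : cmod (set_val z) < 1.
Proof. exact: set_mem (valP z). Qed.

Lemma mob_continuous a b (z : R[i]) (e : R) : su a b -> cmod z < 1 -> 0 < e ->
  exists2 d : R, 0 < d & forall z', cmod (z' - z) < d -> cmod (mob a b z' - mob a b z) < e.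
Proof.
move=> ab z1 e0; have := cderiv_mob ab z1; set A := (X in cderiv _ _ X) => hA.
have [d d0 hd] := hA 1 ltr01; have A0 := cmod_ge0 A.
exists (Num.min d (e / (cmod A + 1))) => [|z'].
  by rewrite lt_min d0 divr_gt0// ltr_wpDl.
rewrite lt_min => /andP[/hd zd]; rewrite ltr_pdivlMr ?ltr_wpDl// => ze.
apply: le_lt_trans ze; rewrite mulrC mulrDl mul1r -[X in cmod X](subrK (A * (z' - z))).
by apply: le_trans (cmodD _ _) _; rewrite addrC cmodM lerD2l -[X in _ <= X]mul1r.
Qed.

End disk_topology.

Section group.
Local Open Scope complex_scope.
Variables (R : realType) (G : fuchsian R).

Lemma fuchsian_mob g : G g -> exists a b : R[i], su a b /\
  forall z, set_val (g z) = mob a b (set_val z).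
Proof. by move=> /fuchsian_aut[a [b [ab gE]]]; exists a, b; split. Qed.

Definition orbit_invariant (A : set (disk R)) := forall g z, G g -> A z -> A (g z).

Lemma fuchsian_continuous g (z : disk R) (e : R) : G g -> 0 < e -> exists2 d : R, 0 < d &
  forall z' : disk R, cmod (set_val z' - set_val z) < d ->
    cmod (set_val (g z') - set_val (g z)) < e.
Proof.
move=> /fuchsian_mob[a [b [ab gE]]] e0.
have [d d0 hd] := mob_continuous ab (cmod_set_val z) e0.
by exists d => // z' /hd; rewrite !gE.
Qed.

Local Open Scope quotient_scope.

Lemma surface_piE (z w : disk R) : \pi_(surface G) z = \pi_(surface G) w ->
  exists2 g, G g & g z = w.
Proof.
move=> piE; have : z = w %[mod {eq_quot orbit_equiv G}] by exact: piE.
by move=> /eqmodP /asboolP.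
Qed.

(* Compactness of the surface, as a uniformity principle for invariant families of
   subsets of the disk. *)
Lemma surface_uniform (A : nat -> set (disk R)) : compact [set: surface G] ->
  (forall n, orbit_invariant (A n)) ->
  (forall n m, (n <= m)%N -> A n `<=` A m) ->
  (forall z : disk R, exists n, exists2 d : R, 0 < d & forall z' : disk R,
    cmod (set_val z' - set_val z) < d -> A n z') ->
  exists n, forall z, A n z.
Proof.
move=> cpt GA monoA locA; apply: contrapT => noA.
have /choice[u uA] : forall n, exists z, ~ A n z.
  by move=> n; apply/existsNP => An; apply: noA; exists n.
(* The classes of the counterexamples cluster at some p. Near p some A n holds, hence at some u m
   with m >= n, against the choice of u m. *)
have := cpt ((fun n => \pi_(surface G) (u n)) @ \oo) _ filterT.
case=> p [_ clp].
have [n [d d0 dA]] := locA (repr p).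
(* The interior of A n. The group acts by homeomorphisms, so it is invariant and descends to an open
   set of the surface. *)
pose V := [set z : disk R | exists2 e : R, 0 < e & forall z' : disk R,
  cmod (set_val z' - set_val z) < e -> A n z'].
have oV : open V.
  apply/disk_openP => z [e e0 eA]; exists (e / 2); first by rewrite divr_gt0.
  move=> z' zz'; exists (e / 2); first by rewrite divr_gt0.
  move=> z'' z'z''; apply: eA; rewrite -(subrK (set_val z') (set_val z'')) -addrA.
  by rewrite (splitr e) (le_lt_trans (cmodD _ _))// ltrD.
have GV : orbit_invariant V.
  move=> g z Gg [e e0 eA]; have [h Gh [gh hg]] := fuchsian_inv Gg.
  have [d' d'0 hd'] := fuchsian_continuous (g z) Gh e0; exists d' => // z' /hd'.
  by rewrite gh => /eA /(GA _ _ _ Gg); rewrite hg.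
pose W : set (surface G) := [set q | V (repr q)].
have VW z : V z <-> W (\pi_(surface G) z).
  have [g Gg gz] : exists2 g, G g & g z = repr (\pi_(surface G) z).
    by apply: surface_piE; rewrite reprK.
  rewrite /W /= -gz; split; first exact: GV.
  have [h Gh [gh hg]] := fuchsian_inv Gg.
  by move=> /(GV _ _ Gh); rewrite gh.
have nW : nbhs p W.
  rewrite nbhsE; exists W => //; split; last by exists d.
  rewrite /open /= /quotient_open (_ : _ @^-1` _ = V)//.
  apply/seteqP; split => z H; [exact: (VW z).2|exact: (VW z).1].
have ev : ((fun m => \pi_(surface G) (u m)) @ \oo)
    [set q | exists2 m, (n <= m)%N & \pi_(surface G) (u m) = q].
  by exists n => // m nm /=; exists m.
have [q [[m nm <-] Wq]] := clp _ _ ev nW; have [e e0 eA] := (VW (u m)).2 Wq.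
by apply: (uA m); apply: (monoA n m nm); apply: eA; rewrite subrr cmod0.
Qed.

End group.

(** * Countability of the group and small balls *)

Section enumeration.
Local Open Scope complex_scope.
Variables (R : realType) (G : fuchsian R).
Hypothesis cov : covering_action G.

Lemma disk_lift (z : R[i]) : cmod z < 1 -> exists y : disk R, set_val y = z.
Proof. by move=> z1; exists (exist _ z (mem_set z1)). Qed.

Lemma covering_ball (z : disk R) : exists2 d : R, 0 < d & forall g (y : disk R), G g ->
  cmod (set_val y - set_val z) < d -> cmod (set_val (g y) - set_val z) < d -> g = id.
Proof.
have [U [oU Uz] GU] := cov z.
have [d d0 dU] := (disk_openP U).1 oU z Uz.
exists d => // g y Gg yz gyz; apply: contrapT => gid.
have : ((g @` U) `&` U) (g y) by split; [exists y => //; exact: dU|exact: dU].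
by rewrite GU.
Qed.

(** If g x = h y, the inverse of h after g sends x to y inside the small ball, hence is the
    identity. *)
Lemma fuchsian_eq g h (z : disk R) (d : R) (y : disk R) :
  (forall k (x : disk R), G k -> cmod (set_val x - set_val z) < d ->
     cmod (set_val (k x) - set_val z) < d -> k = id) ->
  G g -> G h -> forall x, cmod (set_val x - set_val z) < d -> cmod (set_val y - set_val z) < d ->
  g x = h y -> g = h.
Proof.
move=> zd Gg Gh x xz yz gh; have [k Gk [hk kh]] := fuchsian_inv Gh.
have e : k \o g = id.
  by apply: (zd _ x) => //=; [exact: fuchsian_comp|rewrite gh hk].
by apply/funext => w; rewrite -[LHS]kh; move/(congr1 (fun f => f w)): e => /= ->.
Qed.

Definition grid_point (i : nat * (int * int)) : R[i] :=
  (i.2.1%:~R / i.1.+1%:R) +i* (i.2.2%:~R / i.1.+1%:R).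

(* Each element of the group is determined by any rational point in the image of
   a small ball around 0. *)
Lemma fuchsian_countable : exists e : nat -> disk R -> disk R,
  (forall k, G (e k)) /\ forall g, G g -> exists k, e k = g.
Proof.
have z0 : cmod (0 : R[i]) < 1 by rewrite cmod0.
have [oo oo0] := disk_lift z0.
have [d d0 od] := covering_ball oo.
pose good i := [set g : disk R -> disk R | G g /\
  exists2 y : disk R, cmod (set_val y - set_val oo) < d & set_val (g y) = grid_point i].
have good_uniq i g h : good i g -> good i h -> g = h.
  move=> [Gg [x xd gx]] [Gh [y yd hy]]; apply: (fuchsian_eq od Gg Gh xd yd).
  by apply: val_inj; rewrite [LHS]gx [RHS]hy.
(* A code realised by no element is sent to the identity. *)
have /choice[u uP] : forall i, exists g, G g /\ forall h, good i h -> h = g.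
  move=> i; have [[g gi]|ngood] := pselect (exists g, good i g).
    by exists g; split; [exact: gi.1|move=> h /good_uniq; apply].
  exists id; split; first exact: fuchsian_id.
  by move=> h hi; exfalso; apply: ngood; exists h.
exists (fun k => if unpickle k is Some i then u i else id); split=> [k|g Gg].
  by case: (unpickle k) => [i|]; [exact: (uP i).1|exact: fuchsian_id].
have [h Gh [gh hg]] := fuchsian_inv Gg.
(* Rational points close enough to g(oo) are pulled back by the inverse of g into the ball around
   oo. *)
have [d' d'0 hd] := fuchsian_continuous (g oo) Gh d0.
have g1 := cmod_set_val (g oo).
have m0 : 0 < Num.min d' (1 - cmod (set_val (g oo))) by rewrite lt_min d'0 subr_gt0.
have [N hN] := gridc_cvg (set_val (g oo)) m0; have := hN N (leqnn N).
rewrite lt_min => /andP[zd z1].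
have {}z1 : cmod (gridc N (set_val (g oo))) < 1.
  by rewrite -[X in cmod X](subrK (set_val (g oo))) (le_lt_trans (cmodD _ _))// -ltrBrDr.
have [y yE] := disk_lift z1.
pose i := (N, (grid N (complex.Re (set_val (g oo))), grid N (complex.Im (set_val (g oo))))).
have gi : good i g.
  split => //; exists (h y); last by rewrite hg yE.
  by have := hd y; rewrite gh; apply; rewrite yE.
by exists (pickle i); rewrite pickleK -((uP i).2 g gi).
Qed.

Lemma fuchsian_enum : exists (a : nat -> bool) (e : nat -> disk R -> disk R),
  [/\ forall k, G (e k), forall g, G g -> exists2 k, a k & e k = g &
   forall k l, a k -> a l -> e k = e l -> k = l].
Proof.
have [e [Ge surj]] := fuchsian_countable.
(* The flag marks first occurrences, so that flagged indices run once over the group. *)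
exists (fun k => `[< forall m, (m < k)%N -> e m <> e k >]), e; split => // [g Gg|k l].
  have ex : exists k, `[< e k = g >] by have [k kg] := surj g Gg; exists k; apply/asboolP.
  have [k /asboolP kg kmin] := ex_minnP ex; exists k => //; apply/asboolP => m mk emk.
  by have := kmin m (asboolT (etrans emk kg)); rewrite leqNgt mk.
move=> /asboolP ak /asboolP al kl.
by case: (ltngtP k l) => // [/al|/ak]; rewrite kl.
Qed.

(** A countable base of balls; an index that codes nothing stands for the empty ball. *)
Definition rational_ball (m : nat) (z : R[i]) : bool :=
  if unpickle m is Some j then cmod (z - grid_point j.2) < j.1.+1%:R^-1 else false.

Definition thin_ball m := forall g (y : disk R), G g ->
  rational_ball m (set_val y) -> rational_ball m (set_val (g y)) -> g = id.

Lemma thin_ball_cover (z : disk R) : exists2 m, thin_ball m & rational_ball m (set_val z).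
Proof.
have [d d0 zd] := covering_ball z.
(* A radius below d / 2: a ball of this radius containing z lies within d of z. *)
pose k := Num.bound (2 / d).
have k0 : 0 < k.+1%:R^-1 :> R by rewrite invr_gt0.
have k2 : k.+1%:R^-1 + k.+1%:R^-1 < d.
  rewrite (_ : _ + _ = 2 / k.+1%:R); last by ring.
  rewrite ltr_pdivrMr// mulrC -ltr_pdivrMr//.
  apply: (@lt_le_trans _ _ k%:R); first by rewrite archi_boundP// divr_ge0// ltW.
  by rewrite ler_nat leqnSn.
have [N hN] := gridc_cvg (set_val z) k0; have {hN} zN := hN N (leqnn N).
pose i := (N, (grid N (complex.Re (set_val z)), grid N (complex.Im (set_val z)))).
exists (pickle (k, i)); last by rewrite /rational_ball pickleK cmodB.
move=> g y Gg; rewrite /rational_ball pickleK /= => yi gyi.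
by apply: (zd g y) => //; rewrite -(subrK (grid_point i) (set_val _)) -addrA;
  apply: le_lt_trans (cmodD _ _) _; apply: lt_trans k2; apply: ltrD.
Qed.

Lemma cmeasurable_rational_ball m : cmeasurable (rational_ball m).
Proof.
rewrite /rational_ball; case: (unpickle m) => [j|]; last exact: measurable_cst.
apply: measurable_fun_ltr => //.
apply: (cmeasurable_comp (@cmeasurable_cmod R) (g := fun z => z - grid_point j.2)).
apply: (@plane_mapB_cst _ (fun z => z)).
rewrite /plane_map (_ : (fun p => _) = id); first exact: measurable_id.
by apply/funext => -[].
Qed.

End enumeration.

(** * A strict measurable fundamental domain *)

Section fundamental_domain.
Local Open Scope complex_scope.
Variables (R : realType) (G : fuchsian R).
Hypothesis cov : covering_action G.
Local Notation P := (measurableTypeR R * measurableTypeR R)%type.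
Variables (a : nat -> bool) (e : nat -> disk R -> disk R).
Hypothesis Ge : forall k, G (e k).
Hypothesis e_surj : forall g, G g -> exists2 k, a k & e k = g.
Variable T : nat -> R[i] -> R[i].
Hypothesis T_mob : forall n, exists c d, su c d /\ T n = mob c d.
Hypothesis eT : forall n z, set_val (e n z) = T n (set_val z).

(* Choosing the first thin ball met by an orbit gives a fundamental domain that
   meets every orbit exactly once. *)
Definition fund (z : R[i]) : Prop := exists m, [/\ thin_ball G m, rational_ball m z &
  forall m', (m' < m)%N -> thin_ball G m' -> forall k, ~ rational_ball m' (T k z)].

Lemma fund_uniq (z : disk R) : exists2 g, G g & fund (set_val (g z)) /\
  forall h, G h -> fund (set_val (h z)) -> h = g.
Proof.
(* The least such m depends on the orbit only; thinness leaves a single point of the orbit in that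
   ball. *)
pose Q m := `[< thin_ball G m /\ exists2 g, G g & rational_ball m (set_val (g z)) >].
have exP : exists m, Q m.
  have [m tm mz] := thin_ball_cover cov z; exists m; apply/asboolP; split => //.
  by exists id => //; exact: fuchsian_id.
have [m /asboolP[tm [g Gg gz]] mmin] := ex_minnP exP.
exists g => //; split.
  exists m; split => // m' m'm tm' k; apply/negP; rewrite -eT; apply/negP => kz.
  have : Q m'.
    by apply/asboolP; split => //; exists (e k \o g) => //; exact: fuchsian_comp.
  by move=> /mmin; rewrite leqNgt m'm.
move=> h Gh [m2 [tm2 hz h_min]].
have [k Gk [hk kh]] := fuchsian_inv Gh.
have mm2 : (m <= m2)%N by apply: mmin; apply/asboolP; split => //; exists h.
have [n _ en] := e_surj (fuchsian_comp Gg Gk).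
have m2m : m2 = m.
  apply/eqP; rewrite eqn_leq mm2 andbT leqNgt; apply/negP => mlt.
  by apply: (h_min m mlt tm n); rewrite -eT en /= hk.
rewrite m2m in hz.
have gk : g \o k = id.
  by apply: (tm _ (h z)) => //=; [exact: fuchsian_comp|rewrite hk].
by apply/funext => x; move/(congr1 (fun f => f (h x))): gk; rewrite /= hk.
Qed.

Definition fund_indic (z : R[i]) : \bar R := if `[< fund z >] then 1%E else 0%E.

Lemma fund_indic_measurable : cmeasurable fund_indic.
Proof.
apply: measurable_fun_ifT => //.
have m1 : measurable [set true] by [].
apply: (measurable_fun_bool true); rewrite setTI.
pose B m := [set p : R * R | rational_ball m (cx p)].
pose BT m k := [set p : R * R | rational_ball m (T k (cx p))].
have mB m : measurable (B m : set P).
  rewrite -[B m]setTI; exact: (cmeasurable_rational_ball m measurableT m1).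
have mBT m k : measurable (BT m k : set P).
  have [c [d [cd Tk]]] := T_mob k; rewrite /BT Tk.
  have := cmeasurable_comp (@cmeasurable_rational_ball R m) (@plane_map_mob R c d).
  by move=> /(_ measurableT _ m1); rewrite setTI.
rewrite (_ : _ @^-1` _ = \bigcup_(m in [set m | thin_ball G m]) (B m `&`
  \bigcap_(m' in [set m' | (m' < m)%N /\ thin_ball G m']) \bigcap_k ~` BT m' k)).
  apply: bigcup_measurable => m _; apply: measurableI; first exact: mB.
  apply: bigcap_measurableType => m' _; apply: bigcap_measurableType => k _.
  exact: (measurableC (mBT m' k)).
apply/seteqP; split => p /=.
  by move=> /asboolP[m [tm mp h]]; exists m => //; split => // m' [m'm tm'] k _; exact: h.
by move=> [m tm [mp h]]; apply/asboolP; exists m; split => // m' m'm tm' k; exact: h.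
Qed.

Lemma series_single (u : nat -> \bar R) n : a n -> u n = 1%E ->
  (forall m, 0 <= u m)%E -> (forall m, a m -> m != n -> u m = 0%E) ->
  (\sum_(0 <= m <oo) (if a m then u m else 0) = 1)%E.
Proof.
move=> an un u0 uE; rewrite (@nneseriesD1 _ _ n)//; last by move=> m _; case: ifP.
rewrite an un eseries0 ?adde0// => m _ mn; case: ifP => // am; exact: uE.
Qed.

End fundamental_domain.

Section unfolding_data.
Local Open Scope complex_scope.
Variables (R : realType) (G : fuchsian R).
Hypothesis cov : covering_action G.

Lemma fuchsian_unfolding : exists (a : nat -> bool) (T T' : nat -> R[i] -> R[i]) (F : R[i] ->
  \bar R),
  [/\ (forall n, exists c d, su c d /\ T n = mob c d) /\
      (forall n, exists c d, su c d /\ T' n = mob c d),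
      forall n z, cmod z < 1 -> T' n (T n z) = z,
      cmeasurable F /\ forall z, (0 <= F z)%E,
      (forall z, cmod z < 1 -> (\sum_(0 <= n <oo) (if a n then F (T n z) else 0) = 1)%E) /\
      (forall z, cmod z < 1 -> (\sum_(0 <= n <oo) (if a n then F (T' n z) else 0) = 1)%E) &
      (forall n, exists2 g, G g & forall z, set_val (g z) = T n (set_val z)) /\
      (forall g, G g -> exists2 n, a n & forall z, set_val (g z) = T n (set_val z))].
Proof.
have [a [e [Ge e_surj e_inj]]] := fuchsian_enum cov.
have /choice[h hP] : forall n, exists h, G h /\ cancel (e n) h /\ cancel h (e n).
  by move=> n; have [h Gh ?] := fuchsian_inv (Ge n); exists h.
have rep (k : nat -> disk R -> disk R) : (forall n, G (k n)) ->
    exists T : nat -> R[i] -> R[i], forall n, (exists c d, su c d /\ T n = mob c d) /\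
      forall z, set_val (k n z) = T n (set_val z).
  move=> Gk; have /choice[T TP] : forall n, exists Tn : R[i] -> R[i],
      (exists c d, su c d /\ Tn = mob c d) /\ forall z, set_val (k n z) = Tn (set_val z).
    move=> n; have [c [d [cd kE]]] := fuchsian_mob (Gk n).
    by exists (mob c d); split => //; exists c, d.
  by exists T.
have [T TP] := rep e Ge; have [T' T'P] := rep h (fun n => (hP n).1).
pose F := @fund_indic R G T.
have T_mob n := (TP n).1; have eT n := (TP n).2.
have F0 z : (0 <= F z)%E by rewrite /F /fund_indic; case: ifP.
have F1 z : fund G T z -> F z = 1%E by move=> Fz; rewrite /F /fund_indic asboolT.
have F01 z : ~ fund G T z -> F z = 0%E by move=> Fz; rewrite /F /fund_indic asboolF.
exists a, T, T', F; split.
- by split => n; [exact: (TP n).1|exact: (T'P n).1].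
- move=> n z /disk_lift[y <-]; rewrite -eT -(T'P n).2.
  by rewrite (hP n).2.1.
- by split => //; exact: fund_indic_measurable.
- split => z /disk_lift[y <-]; have [g Gg [gy guniq]] := fund_uniq cov Ge e_surj eT y.
    have [n an en] := e_surj g Gg; apply: (@series_single _ a _ n) => //.
      by rewrite -eT en F1.
    move=> m am mn; rewrite -eT; apply: F01 => /(guniq _ (Ge m)) em.
    by move/eqP: mn; apply; apply: e_inj => //; rewrite em en.
  (* The inverses also run once over the group: the index sought is that of the inverse of g. *)
  have [k Gk [gk kg]] := fuchsian_inv Gg.
  have [n an en] := e_surj k Gk.
  have hn : h n = g.
    apply/funext => x; have := (hP n).2.1 (g x); rewrite en gk; exact.
  apply: (@series_single _ a _ n) => //; first by rewrite -(T'P n).2 hn F1.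
  move=> m am mn; rewrite -(T'P m).2; apply: F01 => /(guniq _ (hP m).1) hm.
  move/eqP: mn; apply; apply: e_inj => //; rewrite en; apply/funext => x.
  by rewrite -{1}(kg x) -hm (hP m).2.2.
- split=> [n|g Gg]; first by exists (e n).
  by have [n an <-] := e_surj g Gg; exists n.
Qed.

End unfolding_data.

(** * The Dirichlet domain and the Hardy norm *)

Section dirichlet.
Local Open Scope complex_scope.
Variables (R : realType) (G : fuchsian R).
Local Notation P := (measurableTypeR R * measurableTypeR R)%type.

Lemma bounded_cluster (u : nat -> R[i]) : (forall n, cmod (u n) <= 1) ->
  exists y : R[i], forall d : R, 0 < d -> forall N, exists2 n, (N <= n)%N & cmod (u n - y) < d.
Proof.
move=> u1.
have cpt : compact ((`[(-1 : R), 1] : set R) `*` (`[(-1 : R), 1] : set R)).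
  by apply: compact_setX; exact: segment_compact.
pose v n : R * R := (complex.Re (u n), complex.Im (u n)).
have vn : (v @ \oo) ((`[(-1 : R), 1] : set R) `*` (`[(-1 : R), 1] : set R)).
  exists 0%N => // n _; split; rewrite /= in_itv /= -ler_norml.
    exact: le_trans (normr_Re_cmod _) (u1 n).
  exact: le_trans (normr_Im_cmod _) (u1 n).
have [[x y] [_ cl]] := cpt _ _ vn.
exists (x +i* y) => d d0 N; have d20 : 0 < d / 2 by rewrite divr_gt0.
have ev : (v @ \oo) [set p | exists2 n, (N <= n)%N & v n = p] by exists N => // n Nn /=; exists n.
have nb : nbhs (x, y) (ball x (d / 2) `*` ball y (d / 2)).
  by exists (ball x (d / 2), ball y (d / 2)) => //; split; exact: nbhsx_ballx.
have [_ [[n Nn <-] [/= h1 h2]]] := cl _ _ ev nb; exists n => //.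
apply: le_lt_trans (cmod_le_ReIm _) _; rewrite (splitr d).
move: h1 h2; rewrite /ball /= /ball_ /= => h1 h2.
by case: (u n) h1 h2 => [a b] /= h1 h2; apply: ltrD; rewrite distrC.
Qed.

Hypothesis cov : covering_action G.

(** If the infimum of the moduli over the orbit were not attained, a minimising sequence would
    accumulate inside the disk, and the covering property would make two of its terms equal although
    their moduli differ. *)
Lemma dirichlet_exists (z : disk R) : exists2 g, G g &
  forall h, G h -> cmod (set_val (g z)) <= cmod (set_val (h z)).
Proof.
pose S := [set cmod (set_val (g z)) | g in (G : set (disk R -> disk R))].
have S0 : has_inf S.
  split; first by exists (cmod (set_val z)); exists id => //; exact: fuchsian_id.
  by exists 0 => _ [g _ <-]; exact: cmod_ge0.
have lowS g : G g -> inf S <= cmod (set_val (g z)).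
  by move=> Gg; apply: ge_inf; [exact: S0.2|exists g].
apply: contrapT => nomin.
have big g : G g -> inf S < cmod (set_val (g z)).
  move=> Gg; rewrite lt_neqAle lowS// andbT; apply/negP => /eqP e.
  by apply: nomin; exists g => // h Gh; rewrite -e; exact: lowS.
have /choice[g gP] : forall n, exists g, G g /\ cmod (set_val (g z)) < inf S + n.+1%:R^-1.
  move=> n; have n0 : 0 < n.+1%:R^-1 :> R by rewrite invr_gt0.
  by have [_ [g Gg <-] gz] := inf_adherent n0 S0; exists g.
have [y /= yP] := @bounded_cluster (fun n => set_val (g n z)) (fun n => ltW (cmod_set_val _)).
have small (e : R) : 0 < e -> exists N, forall n, (N <= n)%N -> n.+1%:R^-1 < e.
  move=> e0; exists (Num.bound e^-1) => n Nn.
  rewrite invf_plt ?posrE ?ltr0n//; apply: lt_le_trans (archi_boundP _) _;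
    first by rewrite invr_ge0 ltW.
  by rewrite ler_nat (leq_trans Nn).
(* The moduli approach the infimum, which is at most |z| < 1. *)
have y1 : cmod y < 1.
  apply: le_lt_trans (cmod_set_val z).
  suff H (e : R) : 0 < e -> cmod y <= cmod (set_val z) + e by apply/ler_addgt0Pr.
  move=> e0.
  have e20 : 0 < e / 2 by rewrite divr_gt0.
  have [N hN] := small _ e20; have [n Nn ny] := yP _ e20 N.
  have i1 := big _ (fuchsian_id G); have i2 := (gP n).2; have i3 := hN n Nn.
  have := cmodD (set_val (g n z)) (y - set_val (g n z)); rewrite subrKC cmodB.
  move: i1 i2 i3 ny e0 => /=. clear. move:
    (inf S) (cmod (set_val z)) (cmod (set_val (g n z))) (cmod (_ - y)) (n.+1%:R^-1) (cmod y) =>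
      A B C D E F; lra.
have [y' y'E] := disk_lift y1.
have [d d0 yd] := covering_ball cov y'; rewrite y'E in yd.
have [n _ ny] := yP _ d0 0%N.
(* This gap is positive by assumption; a later term of the sequence falls strictly below |g n z|. *)
have e0 : 0 < cmod (set_val (g n z)) - inf S by rewrite subr_gt0; apply: big; exact: (gP n).1.
have [N hN] := small _ e0; have [m Nm my] := yP _ d0 N.
have gE : g n = g m.
  have [k Gk [hk kh]] := fuchsian_inv (gP n).1.
  have e : g m \o k = id.
    by apply: (yd _ (g n z)) => //=; [exact: (fuchsian_comp (gP m).1 Gk)|rewrite hk].
  by apply/funext => x; move/(congr1 (fun f => f (g n x))): e; rewrite /= hk => ->.
have := (gP m).2; have := hN m Nm; rewrite -gE.
by rewrite ltrBrDl => /lt_trans H /H; rewrite ltxx.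
Qed.

Lemma dirichlet_bounded : compact [set: surface G] ->
  exists r : R, [/\ 0 < r, r < 1 & forall z : disk R,
    (forall g, G g -> cmod (set_val z) <= cmod (set_val (g z))) -> cmod (set_val z) < r].
Proof.
move=> cpt.
(* With n + 2 the radius is positive from n = 0 on. These sets are invariant and exhaust the disk,
   so one of them is the whole disk. *)
pose A n := [set z : disk R | exists2 g, G g & cmod (set_val (g z)) < 1 - n.+2%:R^-1].
have [n An] : exists n, forall z, A n z.
  apply: (@surface_uniform _ G A cpt) => [n g z Gg [h Gh hz]|n m nm z [g Gg gz]|z].
  - have [k Gk [gk kg]] := fuchsian_inv Gg.
    by exists (h \o k); [exact: fuchsian_comp|rewrite /= gk].
  - exists g => //; apply: lt_le_trans gz _; rewrite lerD2l lerN2 lef_pV2 ?posrE ?ltr0n//.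
    by rewrite ler_nat.
  - have z1 := cmod_set_val z; pose e := (1 - cmod (set_val z)) / 2.
    have e0 : 0 < e by rewrite divr_gt0// subr_gt0.
    exists (Num.bound e^-1), e => // z' zz'; exists id; first exact: fuchsian_id.
    have b : (Num.bound e^-1).+2%:R^-1 < e.
      rewrite invf_plt ?posrE ?ltr0n//; apply: lt_le_trans (archi_boundP _) _;
        first by rewrite invr_ge0 ltW.
      by rewrite ler_nat -addn2 leq_addr.
    have := cmodD (set_val z) (set_val z' - set_val z); rewrite subrKC /=.
    by move: b zz'; move: (_.+2%:R^-1) => q; rewrite /e; lra.
exists (1 - n.+2%:R^-1); split.
- by rewrite subr_gt0 invf_lt1 ?ltr0n// ltr1n.
- by rewrite ltrBlDr ltrDl invr_gt0.
- by move=> z zmin; have [g Gg] := An z; exact: le_lt_trans (zmin _ Gg).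
Qed.

Definition dirichlet_indic (z : R[i]) : \bar R :=
  if `[< dirichlet_domain G (complex.Re z, complex.Im z) >] then 1%E else 0%E.

Lemma dirichlet_indicE (z : disk R) : (forall g, G g -> cmod (set_val z) <= cmod (set_val (g z))) ->
  dirichlet_indic (set_val z) = 1%E.
Proof.
move=> zmin; rewrite /dirichlet_indic asboolT//; exists z => //=.
by case: (set_val z).
Qed.

Lemma dirichlet_indic_ge0 z : (0 <= dirichlet_indic z)%E.
Proof. by rewrite /dirichlet_indic; case: ifP. Qed.

(** Countability of the group makes this a countable intersection of closed conditions. *)
Lemma dirichlet_measurable : measurable (dirichlet_domain G : set P).
Proof.
have [a [T [T' [F [[Tm _] _ _ _ [GT TG]]]]]] := fuchsian_unfolding cov.
have -> : dirichlet_domain G = [set p | in_disk (cx p)] `&`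
    \bigcap_n [set p | cmod (cx p) <= cmod (T n (cx p))].
  apply/seteqP; split => [p [z zp zmin]|p [/= p1 pmin]].
    split; first by rewrite /= /in_disk /cx -zp; exact: cmod_set_val.
    by move=> n _ /=; have [g Gg gE] := GT n; rewrite /cx -zp -gE; exact: zmin.
  have [z zp] := disk_lift p1; exists z => // g Gg.
  by have [n an gE] := TG g Gg; rewrite gE zp; exact: pmin.
have m1 : measurable [set true] by [].
apply: measurableI.
  rewrite -[X in measurable X]setTI; exact: (@cmeasurable_in_disk R measurableT _ m1).
apply: bigcap_measurableType => n _; have [c [d [cd ->]]] := Tm n.
rewrite -[X in measurable X]setTI.
apply: (measurable_fun_ler (@cmeasurable_cmod R) _ measurableT m1).
exact: (cmeasurable_comp (@cmeasurable_cmod R) (@plane_map_mob R c d)).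
Qed.

Lemma dirichlet_indic_measurable : cmeasurable dirichlet_indic.
Proof.
apply: measurable_fun_ifT => //; apply: (measurable_fun_bool true); rewrite setTI.
rewrite (_ : _ @^-1` _ = dirichlet_domain G); first exact: dirichlet_measurable.
by apply/seteqP; split => -[x y] /= => [/asboolP|?]; last exact/asboolP.
Qed.

Lemma dirichlet_area : compact [set: surface G] -> (hint dirichlet_indic < +oo)%E.
Proof.
move=> /dirichlet_bounded[r [r0 r1 hr]].
apply: le_lt_trans (ball_mass_lty r0 r1); apply: le_hint.
- exact: dirichlet_indic_measurable.
- exact: cmeasurable_lt.
- exact: dirichlet_indic_ge0.
- by move=> z; case: ifP.
- move=> z z1; rewrite /dirichlet_indic; case: asboolP => [[y yz ymin]|_]; last by case: ifP.
  by have := hr y ymin; rewrite yz /=; case: (z) => ? ? ->.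
Qed.

(** The weight of the associated differential cancels the norm of dz^n, so only the Taylor
    coefficient and the area remain. *)
Lemma diff_L2norm2_assoc (c : nat -> R[i] -> R[i]) n :
  diff_L2norm2 G n (assoc_diff c n) = hint (fun z => dirichlet_indic z * cmod2 (c n z))%E.
Proof.
rewrite /diff_L2norm2 /hint [LHS]integral_mkcond; apply: eq_integral => -[x y] _.
rewrite patchE /dirichlet_indic /= /cx /=.
case: ifPn => [|]; last first.
  by rewrite notin_setE => np; rewrite asboolF// mul0e mule0.
rewrite inE => pD; rewrite asboolT//.
have p1 : cmod (x +i* y) < 1 by case: pD => z <- _; exact: cmod_set_val.
rewrite /rho p1 mul1e /cmod2 -EFinM; congr EFin; rewrite mulrC; congr (_ * _).
rewrite /diff_norm2 /assoc_diff cmodM cmod_real.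
set q := 1 - cmod _ ^+ 2; have q0 : 0 < q by rewrite /q subr_gt0 -cmod_lt1.
have key : ((Num.sqrt 2 / q) ^+ n) ^+ 2 * (q ^+ 2 / 2) ^+ n = 1 :> R.
  rewrite -exprM mulnC exprM -exprMn expr_div_n sqr_sqrtr//.
  by rewrite mulrA divfK ?gt_eqF ?exprn_gt0// divff// expr1n.
rewrite ger0_norm; last by rewrite exprn_ge0// divr_ge0// ltW.
by rewrite exprMn -mulrA key mulr1.
Qed.

End dirichlet.

(** * Limits of complex sequences *)

Section complex_limits.
Local Open Scope complex_scope.
Variable R : realType.
Implicit Types (u : nat -> R[i]) (l : R[i]).

Definition ccvg u l := forall e : R, 0 < e -> exists N, forall n, (N <= n)%N -> cmod (u n - l) < e.

Lemma ccvgP u l : u @ \oo --> l -> ccvg u l.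
Proof.
move=> ul e e0; have nb : nbhs l [set z | cmod (z - l) < e] by apply/cnbhsP; exists e.
by have [N _ hN] := ul _ nb; exists N => n; exact: hN.
Qed.

Lemma ccvg_bounded u l : ccvg u l -> exists K : R, forall n, cmod (u n) <= K.
Proof.
move=> /(_ 1 ltr01)[N hN]; exists (\sum_(k < N) cmod (u k) + (cmod l + 1)) => n.
have S0 : 0 <= \sum_(k < N) cmod (u k) by apply: sumr_ge0 => k _; exact: cmod_ge0.
have [nN|Nn] := ltnP n N.
  rewrite (bigD1 (Ordinal nN))//= -addrA lerDl addr_ge0//; last by rewrite addr_ge0 ?cmod_ge0.
  by apply: sumr_ge0 => k _; exact: cmod_ge0.
rewrite ler_wpDl// -(subrKC l (u n)); apply: le_trans (cmodD _ _) _.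
by rewrite lerD2l ltW// hN.
Qed.

Lemma ccvg_cmod_le u l (a : R[i]) (C : R) : ccvg u l ->
  (forall n, cmod (u n - a) <= C) -> cmod (l - a) <= C.
Proof.
move=> ul uC; suff H (e : R) : 0 < e -> cmod (l - a) <= C + e by apply/ler_addgt0Pr.
move=> /ul[N /(_ N (leqnn N)) h]; rewrite -(subrKA (u N)) addrC.
by apply: le_trans (cmodD _ _) _; rewrite cmodB in h; apply: lerD => //; exact: ltW.
Qed.

Lemma ccvg_comp u l (g : R -> R -> R) :
  ccvg u l -> (forall (e : R), 0 < e -> exists2 d : R, 0 < d & forall z : R[i], cmod (z - l) < d ->
    `|g (complex.Re z) (complex.Im z) - g (complex.Re l) (complex.Im l)| < e) ->
  (fun n => g (complex.Re (u n)) (complex.Im (u n))) @ \oo --> g (complex.Re l) (complex.Im l).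
Proof.
move=> ul gl; apply/cvgrPdist_lt => e e0; have [d d0 hd] := gl e e0; have [N hN] := ul d d0.
by exists N => // n /hN /hd; rewrite distrC.
Qed.

Lemma ccvg_Re u l : ccvg u l -> (fun n => complex.Re (u n)) @ \oo --> complex.Re l.
Proof.
move=> ul; apply: (@ccvg_comp u l (fun x _ => x) ul) => e e0; exists e => // z.
by apply: le_lt_trans; have := normr_Re_cmod (z - l); case: z l {ul} => [? ?] [? ?].
Qed.

Lemma ccvg_Im u l : ccvg u l -> (fun n => complex.Im (u n)) @ \oo --> complex.Im l.
Proof.
move=> ul; apply: (@ccvg_comp u l (fun _ y => y) ul) => e e0; exists e => // z.
by apply: le_lt_trans; have := normr_Im_cmod (z - l); case: z l {ul} => [? ?] [? ?].
Qed.

Lemma ccvg_cmod2 u l : ccvg u l -> (fun n => cmod2 (u n)) @ \oo --> cmod2 l.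
Proof.
move=> ul; rewrite /cmod2; apply: cvg_EFin; first by near=> n.
rewrite cmod_sqr (_ : _ \o _ = fun n => complex.Re (u n) ^+ 2 + complex.Im (u n) ^+ 2).
  by apply: cvgD; apply: cvgM; [exact: ccvg_Re|exact: ccvg_Re|exact: ccvg_Im|exact: ccvg_Im].
by apply/funext => n /=; rewrite cmod_sqr.
Unshelve. all: by end_near. Qed.

Lemma ccvg_plane_map (u : nat -> R[i] -> R[i]) (h : R[i] -> R[i]) :
  (forall n, plane_map (u n)) -> (forall z, ccvg (u^~ z) (h z)) -> plane_map h.
Proof.
move=> mu uh; apply: measurable_fun_pair.
  apply: (measurable_fun_cvg (h := fun n p => complex.Re (u n (cx p)))) => [n|p _].
    by have := mu n; rewrite /plane_map => /measurable_fun_pairP[].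
  exact: ccvg_Re.
apply: (measurable_fun_cvg (h := fun n p => complex.Im (u n (cx p)))) => [n|p _].
  by have := mu n; rewrite /plane_map => /measurable_fun_pairP[].
exact: ccvg_Im.
Qed.

End complex_limits.

(** * Bessel-type bounds for power series *)

Section power_series.
Local Open Scope complex_scope.
Variable R : realType.
Local Notation P := (measurableTypeR R * measurableTypeR R)%type.
Implicit Types (Psi : R[i] -> R[i] -> \bar R).

Lemma limn_einf_ge (u : nat -> \bar R) (y : \bar R) : (forall n, y <= u n)%E ->
  (y <= limn_einf u)%E.
Proof.
move=> yu; rewrite limn_einf_lim; apply: lime_ge; first exact: is_cvg_einfs.
by near=> n; apply: le_ereal_inf_tmp => _ [k _ <-].
Unshelve. all: by end_near. Qed.

Lemma limn_einf_le (u : nat -> \bar R) (y : \bar R) : (forall n, u n <= y)%E ->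
  (limn_einf u <= y)%E.
Proof.
move=> yu; rewrite limn_einf_lim; apply: lime_le; first exact: is_cvg_einfs.
near=> n; apply: (@le_trans _ _ (u n)) => //; apply: ereal_inf_lbound; exists n => //=.
Unshelve. all: by end_near. Qed.

(** The products may fail to converge when c x is of the form 0 times infinity; that product is 0 by
    convention, and the bound is trivial. *)
Lemma mule_limn_einf_le (c x : \bar R) (u : nat -> \bar R) : (0 <= c)%E -> (forall n, 0 <= u n)%E ->
  u @ \oo --> x -> (c * x <= limn_einf (fun n => c * u n))%E.
Proof.
move=> c0 u0 ux; have [cx|] := boolP (c *? x)%E.
  by rewrite (cvg_limn_einf_sup (cvgeM cx (cvg_cst c) ux)).1.
rewrite mule_defE negbK => h; rewrite (_ : c * x = 0)%E.
  by apply: limn_einf_ge => n; rewrite mule_ge0.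
by case/orP: h => /andP[/eqP -> _]; rewrite ?mul0e ?mule0.
Qed.

(* Fatou's lemma; where [psi] is infinite the products need not converge. *)
Lemma hint_cmod2_limit (psi : R[i] -> \bar R) (u : nat -> R[i] -> R[i]) (h : R[i] -> R[i]) (C :
  \bar R) :
  cmeasurable psi -> (forall z, 0 <= psi z)%E -> (forall n, plane_map (u n)) -> plane_map h ->
  (forall z, cmod z < 1 -> ccvg (u^~ z) (h z)) ->
  (forall n, hint (fun z => psi z * cmod2 (u n z)) <= C)%E ->
  (hint (fun z => psi z * cmod2 (h z)) <= C)%E.
Proof.
move=> mpsi psi0 mu mh uh uC.
pose g n (p : P) := ((rho (cx p))%:E * (psi (cx p) * cmod2 (u n (cx p))))%E.
have mg n : measurable_fun setT (g n).
  apply: (cmeasurable_rhoM (h := fun z => psi z * cmod2 (u n z))%E).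
  by apply: emeasurable_funM => //; exact: (plane_map_cmod2 (mu n)).
have r0 (z : R[i]) : (0 <= (rho z)%:E)%E by rewrite lee_fin rho_ge0.
have g0 n p : (0 <= g n p)%E by rewrite !mule_ge0// cmod2_ge0.
apply: (@le_trans _ _ (\int[@area R]_p limn_einf (g^~ p))%E).
  apply: ge0_le_integral => //.
  - by move=> p _; rewrite !mule_ge0// cmod2_ge0.
  - apply: (cmeasurable_rhoM (h := fun z => psi z * cmod2 (h z))%E).
    by apply: emeasurable_funM => //; exact: (plane_map_cmod2 mh).
  - have mN n : measurable_fun setT (fun p => - g n p)%E by exact: measurableT_comp (mg n).
    exact: (measurableT_comp _ (@measurable_fun_limn_esup _ P R setT (fun n p => - g n p)%E mN)).
  move=> p _; rewrite muleA; have [p1|p1] := boolP (cmod (cx p) < 1); last first.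
    by rewrite {1}/rho (negbTE p1) !mul0e; apply: limn_einf_ge => n.
  rewrite (_ : g^~ p = fun n => ((rho (cx p))%:E * psi (cx p)) * cmod2 (u n (cx p)))%E.
    apply: mule_limn_einf_le => [|n|]; [by rewrite mule_ge0|exact: cmod2_ge0|].
    by apply: ccvg_cmod2; exact: uh.
  by apply/funext => n; rewrite /g muleA.
apply: (le_trans (@fatou _ _ R (@area R) setT measurableT g mg (fun n p _ => g0 n p))).
exact: limn_einf_le.
Qed.

Definition psum (a : nat -> R[i]) N (t : R[i]) := \sum_(0 <= k < N) a k * t ^+ k.

Lemma psumS a N t : psum a N.+1 t = a 0%N + t * psum (fun k => a k.+1) N t.
Proof.
rewrite /psum big_nat_recl// expr0 mulr1 mulr_sumr; congr (_ + _).
by apply: eq_bigr => k _; rewrite exprS mulrCA.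
Qed.

Lemma cderiv_mul_id (h : R[i] -> R[i]) (z A : R[i]) : cderiv h z A ->
  cderiv (fun t => t * h t) z (h z + z * A).
Proof.
move=> hA e e0.
have Z0 := cmod_ge0 z; have A0 := cmod_ge0 A.
pose e' := Num.min 1 (e / 2 / (cmod z + 1)).
have e'0 : 0 < e' by rewrite lt_min ltr01 !divr_gt0// ltr_wpDl.
have [d d0 hd] := hA e' e'0.
exists (Num.min d (e / 2 / (cmod A + 1))) => [|z'].
  by rewrite lt_min d0 !divr_gt0// ltr_wpDl.
rewrite lt_min => /andP[/hd zd]; rewrite ltr_pdivlMr ?ltr_wpDl// => zA.
set x := cmod (z' - z) in zd zA *; have x0 : 0 <= x by exact: cmod_ge0.
rewrite (_ : _ - _ = z * (h z' - h z - A * (z' - z)) + (z' - z) * (h z' - h z)); last by ring.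
have e'1 : e' <= 1 by rewrite ge_min lexx.
have e'z : e' * (cmod z + 1) <= e / 2.
  by rewrite -ler_pdivlMr ?ltr_wpDl// ge_min lexx orbT.
have k1 : cmod (z * (h z' - h z - A * (z' - z))) <= e / 2 * x.
  rewrite cmodM; apply: le_trans (ler_wpM2l Z0 zd) _; rewrite mulrA ler_wpM2r//.
  by have := ltW e'0; move: e'z; lra.
have k2 : cmod (h z' - h z) <= (cmod A + 1) * x.
  rewrite -[X in cmod X](subrK (A * (z' - z))); apply: le_trans (cmodD _ _) _.
  rewrite cmodM -/x; have := ler_wpM2r x0 e'1; lra.
have k3 : cmod ((z' - z) * (h z' - h z)) <= e / 2 * x.
  rewrite cmodM -/x; apply: le_trans (ler_wpM2l x0 k2) _.
  by rewrite mulrA ler_wpM2r// ltW.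
by apply: le_trans (cmodD _ _) _; move: k1 k3; lra.
Qed.

Lemma holo_psum a N : holo (psum a N).
Proof.
elim: N a => [|N IH] a z z1.
  exists 0 => e e0; exists 1 => // z' _.
  by rewrite /psum !big_geq// mul0r !subr0 cmod0 mulr_ge0 ?cmod_ge0// ltW.
have [A hA] := IH (fun k => a k.+1) z z1.
exists (psum (fun k => a k.+1) N z + z * A).
have := cderiv_addr_cst (a 0%N) (cderiv_mul_id hA).
by congr cderiv; apply/funext => t; rewrite psumS addrC.
Qed.

Lemma plane_mapD (g h : R[i] -> R[i]) : plane_map g -> plane_map h ->
  plane_map (fun z => g z + h z).
Proof.
rewrite /plane_map => /measurable_fun_pairP[/= g1 g2] /measurable_fun_pairP[/= h1 h2].
rewrite (_ : (fun p => _) = (fun p : R * R =>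
   (complex.Re (g (cx p)) + complex.Re (h (cx p)), complex.Im (g (cx p)) + complex.Im (h (cx p))))).
  by apply: measurable_fun_pair; exact: measurable_funD.
by apply/funext => p; case: (g _) (h _) => [? ?] [? ?].
Qed.

Lemma plane_map_cst (c : R[i]) : plane_map (fun=> c).
Proof. exact: measurable_cst. Qed.

Lemma plane_map_id : plane_map (fun z : R[i] => z).
Proof.
rewrite /plane_map (_ : (fun p => _) = id); first exact: measurable_id.
by apply/funext => -[].
Qed.

Lemma plane_map_psum a N : plane_map (psum a N).
Proof.
elim: N a => [|N IH] a.
  rewrite (_ : psum a 0 = fun=> 0); first exact: plane_map_cst.
  by apply/funext => t; rewrite /psum big_geq.
rewrite (_ : psum a N.+1 = fun t => a 0%N + t * psum (fun k => a k.+1) N t); last first.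
  by apply/funext => t; rewrite psumS.
by apply: plane_mapD; [exact: plane_map_cst|exact: plane_map_mul plane_map_id (IH _)].
Qed.

Lemma cmod2M (x y : R[i]) : cmod2 (x * y) = (cmod2 x * cmod2 y)%E.
Proof. by rewrite /cmod2 cmodM exprMn EFinM. Qed.

(** Orthogonality of the powers would give an equality weighted by the moments of the kernel;
    bounding |t| by 1 at each peeling is enough. *)
Lemma radial_kernel_psum Psi a N : radial_kernel Psi ->
  (hint (fun t => Psi 0%R t * cmod2 (psum a N t)) <= \sum_(0 <= k < N) cmod2 (a k))%E.
Proof.
move=> kP; have P0 := kernel_ge0 kP; have mP := kernel_measurable kP.
have mP0 : cmeasurable (Psi 0) by exact: cmeasurable_section mP.
elim: N a => [|N IH] a.
  rewrite big_geq// [X in (X <= _)%E](_ : _ = hint (fun=> 0%E)).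
    by rewrite /hint integral0_eq// => p _; rewrite mule0.
  by apply: eq_hint => t _; rewrite /psum big_geq// /cmod2 cmod0 expr0n mule0.
have z1 : cmod (0 : R[i]) < 1 by rewrite cmod0.
rewrite (radial_kernel_holo kP (plane_map_psum a N.+1) (@holo_psum a N.+1) z1).
rewrite big_nat_recl//; apply: leeD.
  by rewrite psumS mul0r addr0.
apply: le_trans (IH (fun k => a k.+1)); apply: le_hint.
- apply: emeasurable_funM => //; apply: (plane_map_cmod2 (h := fun w =>
  psum a N.+1 w - psum a N.+1 0)).
  exact: plane_mapB_cst (plane_map_psum _ _).
- by apply: emeasurable_funM => //; exact: plane_map_cmod2 (plane_map_psum _ _).
- by move=> t; rewrite mule_ge0// cmod2_ge0.
- by move=> t; rewrite mule_ge0// cmod2_ge0.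
move=> t t1; apply: lee_wpmul2l => //.
rewrite !psumS mul0r addr0 addrAC subrr add0r cmod2M -[leRHS]mul1e.
rewrite lee_wpmul2r ?cmod2_ge0// lee_fin expr_le1 ?cmod_ge0//; exact: ltW.
Qed.

Lemma radial_kernel_series Psi a (h : R[i] -> R[i]) : radial_kernel Psi -> plane_map h ->
  (forall t, cmod t < 1 -> ccvg (fun N => psum a N t) (h t)) ->
  (hint (fun t => Psi 0%R t * cmod2 (h t)) <= \sum_(0 <= k <oo) cmod2 (a k))%E.
Proof.
move=> kP mh ah; apply: (hint_cmod2_limit (u := psum a)) => //.
- exact: cmeasurable_section (kernel_measurable kP).
- exact: kernel_ge0 kP _.
- exact: plane_map_psum.
- move=> N; apply: le_trans (radial_kernel_psum a N kP) _.
  by apply: nneseries_lim_ge => n _ _; exact: cmod2_ge0.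
Qed.

(* Right continuity at 0 of the sum of a power series. *)
Lemma psum_near0 (a : nat -> R[i]) (q : nat -> R[i]) :
  (forall j, ccvg (fun N => psum a N (j.+2%:R^-1)%:C) (q j)) -> ccvg q (a 0%N).
Proof.
move=> aq; have [K hK] := ccvg_bounded (aq 0%N).
have K0 : 0 <= K by exact: le_trans (cmod_ge0 _) (hK 0%N).
(* For j = 0 the series is taken at t = 1/2: each term is a difference of two partial sums, hence at
   most 2 K. *)
have ak k : cmod (a k) <= 2 * K * 2 ^+ k.
  rewrite -ler_pdivrMr ?exprn_gt0//.
  have -> : cmod (a k) / 2 ^+ k = cmod (psum a k.+1 (2^-1)%:C - psum a k (2^-1)%:C).
    rewrite /psum big_nat_recr//= addrAC subrr add0r cmodM cmodX cmod_real.
    by rewrite ger0_norm// exprVn.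
  apply: le_trans (cmodD _ _) _; rewrite cmodN mulr_natl mulr2n.
  by apply: lerD; exact: hK.
(* For j >= 2, t <= 1/4, so the terms are dominated by a geometric series of ratio 2 t <= 1/2 with
   first term 4 K t; the bound is its partial sum. *)
have step j N : (2 <= j)%N ->
    cmod (psum a N.+1 (j.+2%:R^-1)%:C - a 0%N) <= 8 * K * j.+2%:R^-1 * (1 - (2^-1) ^+ N).
  move=> j2; elim: N => [|N IH].
    by rewrite psumS /psum big_geq// mulr0 addr0 subrr cmod0 expr0 subrr mulr0.
  rewrite /psum big_nat_recr//= -/(psum a N.+1 _) addrAC.
  apply: le_trans (cmodD _ _) _; apply: le_trans (lerD IH (lexx _)) _.
  rewrite cmodM cmodX cmod_real ger0_norm//.
  set t : R := j.+2%:R^-1; have t0 : 0 <= t by rewrite invr_ge0.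
  have t4 : t <= 4^-1 by rewrite lef_pV2 ?posrE ?ltr0n// ler_nat !ltnS.
  have k1 : cmod (a N.+1) * t ^+ N.+1 <= 4 * K * t * (2^-1) ^+ N.
    apply: le_trans (ler_wpM2r _ (ak N.+1)) _; first exact: exprn_ge0.
    rewrite !exprS (_ : 2 * K * (2 * 2 ^+ N) * (t * t ^+ N) = 4 * K * t * (2 ^+ N * t ^+ N));
      last by ring.
    rewrite ler_wpM2l ?mulr_ge0// -exprMn; apply: lerXn2r; rewrite ?nnegrE ?mulr_ge0 ?invr_ge0//.
    by rewrite (_ : (2^-1 : R) = 2 * 4^-1); [rewrite ler_wpM2l|field].
  apply: le_trans (lerD (lexx _) k1) _; rewrite !exprS.
  by move: (2^-1 ^+ N) => x; rewrite le_eqVlt; apply/orP; left; apply/eqP; field.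
move=> e e0; pose b : R := (8 * K + 1) / e.
have b0 : 0 < 8 * K + 1 by rewrite ltr_wpDl// mulr_ge0.
exists (maxn 2 (Num.bound b)) => j; rewrite geq_max => /andP[j2 jb].
apply: (@le_lt_trans _ _ (8 * K * j.+2%:R^-1)).
  apply: (ccvg_cmod_le (u := fun N => psum a N.+1 (j.+2%:R^-1)%:C)).
    by move=> d /(aq j)[N hN]; exists N => n Nn; apply: hN; exact: leqW.
  move=> N; apply: le_trans (step j N j2) _; apply: ler_piMr.
    by rewrite !mulr_ge0// invr_ge0.
  by rewrite gerBl exprn_ge0// invr_ge0.
rewrite ltr_pdivrMr ?ltr0n//.
apply: (@lt_le_trans _ _ (8 * K + 1)); first by rewrite ltrDl.
rewrite -ler_pdivrMl// mulrC -/b; apply: ltW; apply: lt_le_trans (archi_boundP _) _.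
  by rewrite divr_ge0// ltW.
by rewrite ler_nat (leq_trans jb)// -addn2 leq_addr.
Qed.

End power_series.

(** * Energy bounds and measurability for Taylor coefficients *)

Section taylor.
Local Open Scope complex_scope.
Variables (R : realType) (f : R[i] * R[i] -> R[i]) (c : nat -> R[i] -> R[i]).
Local Notation P := (measurableTypeR R * measurableTypeR R)%type.

Definition bidisk_fun (z w : R[i]) : R[i] := if in_disk z && in_disk w then f (z, w) else 0.

Lemma bidisk_funE z w : cmod z < 1 -> cmod w < 1 -> bidisk_fun z w = f (z, w).
Proof. by rewrite /bidisk_fun /in_disk => -> ->. Qed.

Hypothesis mRe : cmeasurable2 (fun z w => complex.Re (bidisk_fun z w)).
Hypothesis mIm : cmeasurable2 (fun z w => complex.Im (bidisk_fun z w)).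
Hypothesis fc : taylor_expansion f c.

Lemma plane_map_bidisk z : plane_map (bidisk_fun z).
Proof.
apply: measurable_fun_pair; first exact: (cmeasurable_section z mRe).
exact: (cmeasurable_section z mIm).
Qed.

(** After recentring by an automorphism, the Taylor coordinate is t up to a rotation. *)
Lemma mob_coordinate (a b t : R[i]) : su a b -> cmod t < 1 ->
  (mob a b t - mob a b 0) / (1 - (mob a b 0)^* * mob a b t) = a / a^* * t.
Proof.
move=> ab t1; have a0 := su_neq0 ab; have D0 := mob_den_neq0 ab t1.
have e : a * a^* - b * b^* = 1 by rewrite !mulcJ -rmorphB; move: ab; rewrite /su => ->.
have aJ0 : a^* != 0 by rewrite conjC_eq0.
have E0 : mob a b 0 = b / a^* by rewrite /mob !mulr0 !add0r.
have E1 : mob a b t - mob a b 0 = t / ((b^* * t + a^*) * a^*).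
  transitivity ((a * a^* - b * b^*) * t / ((b^* * t + a^*) * a^*)); last by rewrite e mul1r.
  by rewrite E0 /mob; field; rewrite D0 aJ0.
have E2 : 1 - (mob a b 0)^* * mob a b t = ((b^* * t + a^*) * a)^-1.
  transitivity ((a * a^* - b * b^*) / ((b^* * t + a^*) * a)); last by rewrite e mul1r.
  rewrite E0 rmorphM fmorphV /= conjCK /mob; field.
  by rewrite D0 a0.
rewrite E1 E2; move: D0; set D := _ + _ => D0; field.
by rewrite D0 a0 aJ0.
Qed.

Lemma taylor_energy Psi z : radial_kernel Psi -> cmod z < 1 ->
  (hint (fun w => Psi z w * cmod2 (bidisk_fun z w)) <= \sum_(0 <= k <oo) cmod2 (c k z))%E.
Proof.
move=> kP z1; have [a [b [ab abz]]] := exists_mob z1.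
have a0 := su_neq0 ab; have aJ0 : a^* != 0 by rewrite conjC_eq0.
have o1 : cmod (0 : R[i]) < 1 by rewrite cmod0.
have mfz := plane_map_cmod2 (plane_map_bidisk z).
have -> : hint (fun w => Psi z w * cmod2 (bidisk_fun z w))%E =
    hint (fun t => Psi 0%R t * cmod2 (bidisk_fun z (mob a b t)))%E.
  rewrite -{1}abz; apply: (radial_kernel_recenter kP mfz _ ab o1) => w.
  exact: cmod2_ge0.
(* The rotation of [mob_coordinate] is absorbed into the coefficients without changing their
   moduli. *)
have -> : (\sum_(0 <= k <oo) cmod2 (c k z) = \sum_(0 <= k <oo) cmod2 (c k z * (a / a^*) ^+ k)%R)%E.
  apply: eq_eseriesr => k _; rewrite /cmod2 cmodM cmodX cmodM cmodV cmodJ.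
  by rewrite divff ?cmod_eq0// expr1n mulr1.
apply: radial_kernel_series => //.
  by apply: plane_map_comp (plane_map_bidisk z) _; exact: plane_map_mob.
move=> t t1; have w1 := mob_disk ab t1; rewrite bidisk_funE//.
have /ccvgP := fc z1 w1; congr ccvg; apply/funext => N.
rewrite /series /psum /=; apply: eq_bigr => k _.
by rewrite -{2 3}abz mob_coordinate// exprMn mulrA.
Qed.

Let tt j : R := j.+2%:R^-1.

(** The point whose Taylor coordinate relative to z is [tt j]. *)
Let ww j (z : R[i]) : R[i] := ((tt j)%:C + z) / (1 + (tt j)%:C * z^*).

Let tt01 j : 0 < tt j < 1.
Proof. by rewrite /tt invr_gt0 ltr0n /= invf_lt1 ?ltr0n// ltr1n. Qed.

Let ww_den j (z : R[i]) : cmod z < 1 -> 1 + (tt j)%:C * z^* != 0.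
Proof.
move=> z1; have /andP[t0 t1] := tt01 j; apply/eqP => h.
have : cmod ((tt j)%:C * z^*) < 1.
  rewrite cmodM cmodJ cmod_real gtr0_norm//; have := cmod_ge0 z; nra.
by rewrite (_ : _ * _ = -1) ?cmodN ?cmod1 ?ltxx//; apply/eqP; rewrite -addr_eq0 addrC h.
Qed.

Let ww_coordinate j (z : R[i]) : cmod z < 1 -> (ww j z - z) / (1 - z^* * ww j z) = (tt j)%:C.
Proof.
move=> z1; have D0 := ww_den j z1.
have Z0 : 1 - z * z^* != 0.
  rewrite mulcJ -(rmorph1 (real_complex R)) -rmorphB /=; apply/eqP => /(congr1 (@complex.Re R)) /=.
  by move: z1; rewrite cmod_lt1; lra.
have E1 : ww j z - z = (tt j)%:C * (1 - z * z^*) / (1 + (tt j)%:C * z^*).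
  by rewrite /ww; field.
have E2 : 1 - z^* * ww j z = (1 - z * z^*) / (1 + (tt j)%:C * z^*).
  by rewrite /ww; field.
by rewrite E1 E2; field; rewrite D0 Z0.
Qed.

Let ww_disk j (z : R[i]) : cmod z < 1 -> cmod (ww j z) < 1.
Proof.
move=> z1; have D0 := ww_den j z1; have /andP[t0 t1] := tt01 j.
rewrite /ww cmodM cmodV ltr_pdivrMr; last by rewrite lt_neqAle cmod_ge0 eq_sym cmod_eq0 D0.
rewrite mul1r -(@ltr_pXn2r _ 2)// ?nnegrE ?cmod_ge0// !cmod_sqr.
have t2 : 0 < 1 - tt j ^+ 2 by rewrite subr_gt0 expr_lt1// ltW.
have z2 : 0 < 1 - (complex.Re z ^+ 2 + complex.Im z ^+ 2) by rewrite subr_gt0 -cmod_sqr -cmod_lt1.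
rewrite -subr_gt0; have := mulr_gt0 t2 z2; congr (_ < _).
by case: z {D0 z1 z2} => x y /=; ring.
Qed.

Definition coef (n : nat) (z : R[i]) : R[i] := if in_disk z then c n z else 0.

(* [quot n j z] is the value at t = 1/(j+2) of the series of the coefficients of
   index at least [n]. *)
Fixpoint quot (n j : nat) (z : R[i]) : R[i] :=
  if n is m.+1 then (j.+2%:R)%:C * (quot m j z - coef m z) else bidisk_fun z (ww j z).

(** Removing the leading coefficient and dividing by t shifts the series by one index. *)
Let quot_series n j z : cmod z < 1 ->
  ccvg (fun N => psum (fun k => c (n + k)%N z) N (tt j)%:C) (quot n j z).
Proof.
move=> z1; elim: n => [|n IH] /=.
  rewrite bidisk_funE ?ww_disk//.
  have /ccvgP := fc z1 (ww_disk j z1); congr ccvg; apply/funext => N.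
  by rewrite /series /psum /=; apply: eq_bigr => k _; rewrite ww_coordinate.
have t0 : (tt j)%:C != 0 :> R[i].
  by have /andP[? _] := tt01 j; rewrite eq_complex /= eqxx andbT gt_eqF.
move=> e e0; have /andP[tt0 _] := tt01 j; have [N hN] := IH _ (mulr_gt0 e0 tt0).
exists N => k Nk; rewrite /coef /in_disk z1.
have := hN k.+1 (leqW Nk); rewrite psumS addn0 -ltr_pdivrMr//.
apply: le_lt_trans; rewrite ler_pdivlMr// -[X in _ * X]gtr0_norm// -cmod_real -cmodM.
rewrite le_eqVlt; apply/orP; left; apply/eqP; congr cmod.
have -> : psum (fun k0 => c (n.+1 + k0)%N z) k (tt j)%:C = psum (fun k0 =>
  c (n + k0.+1)%N z) k (tt j)%:C.
  by rewrite /psum; apply: eq_bigr => i _; rewrite addSnnS.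
rewrite mulrBl mulrAC -rmorphM /= mulfV ?pnatr_eq0// ?rmorph1.
ring.
Qed.

Lemma quot_cvg n z : ccvg (fun j => quot n j z) (coef n z).
Proof.
have [z1|z1] := boolP (in_disk z); last first.
  have q0 m j : quot m j z = 0.
    elim: m => [|m IH] /=; first by rewrite /bidisk_fun (negbTE z1).
    by rewrite IH /coef (negbTE z1) subr0 mulr0.
  by move=> e e0; exists 0%N => j _; rewrite q0 /coef (negbTE z1) subr0 cmod0.
have := psum_near0 (fun j => @quot_series n j z z1); rewrite addn0 /coef z1.
by congr ccvg.
Qed.

Lemma plane_mapJ (h : R[i] -> R[i]) : plane_map h -> plane_map (fun z => (h z)^*).
Proof.
rewrite /plane_map => /measurable_fun_pairP[/= h1 h2].
rewrite (_ : (fun p => _) = (fun p : R * R => (complex.Re (h (cx p)), - complex.Im (h (cx p))))).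
  apply: measurable_fun_pair => //; exact: measurableT_comp.
by apply/funext => p; case: (h _).
Qed.

Let plane_map_ww j : plane_map (ww j).
Proof.
apply: plane_map_mul; first exact: plane_mapD (plane_map_cst _) (@plane_map_id R).
apply: (plane_map_comp (@plane_map_inv R)); apply: plane_mapD; first exact: plane_map_cst.
by apply: plane_map_mul; [exact: plane_map_cst|exact: plane_mapJ (@plane_map_id R)].
Qed.

(** An expansion says nothing of how its coefficients depend on z. They are recovered in turn:
    [coef m] is a limit of the [quot m j], and [quot m.+1] is built from [quot m] and [coef m]. *)
Lemma plane_map_coef n : plane_map (coef n).
Proof.
suff mq m j : plane_map (quot m j) by apply: (ccvg_plane_map (mq n)) => z; exact: quot_cvg.
elim: m j => [|m IH] j /=.
  have mpair : measurable_fun [set: P] (fun p : P => (p, (complex.Re (ww j (cx p)),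
    complex.Im (ww j (cx p))))).
    by apply: measurable_fun_pair; [exact: measurable_id|exact: plane_map_ww].
  have cxE p : cx (complex.Re (ww j (cx p)), complex.Im (ww j (cx p))) = ww j (cx p) by case:
    (ww _ _).
  apply: measurable_fun_pair.
    have := measurableT_comp mRe mpair; apply: eq_measurable_fun => p _ /=.
    by rewrite -[in RHS](cxE p).
  have := measurableT_comp mIm mpair; apply: eq_measurable_fun => p _ /=.
  by rewrite -[in RHS](cxE p).
have mc : plane_map (coef m) by apply: (ccvg_plane_map (IH)) => z; exact: quot_cvg.
apply: plane_map_mul; first exact: plane_map_cst.
have -> : (fun z => quot m j z - coef m z) = (fun z => quot m j z + -1 * coef m z).
  by apply/funext => z; rewrite mulN1r.
apply: plane_mapD => //; apply: plane_map_mul => //; exact: plane_map_cst.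
Qed.

End taylor.

(** Serves functions constant on the bidisk and arbitrary elsewhere, whence the local hypothesis. *)
Lemma near_cst_differentiable (K : numFieldType) (V W : normedModType K) (f : V -> W) p k :
  (\forall q \near p, f q = k) -> differentiable f p.
Proof.
move=> fk; have fpk : f p = k by exact: nbhs_singleton fk.
have fo : f \o shift p = cst (f p) + \0 +o_ 0 id.
  apply/eqaddoP => e e0; move: fk; rewrite (near_shift 0 p) => fk.
  near=> h; rewrite (_ : (_ - _) h = 0); last first.
    rewrite /= -[LHS]/(f (h + p) - (f p + 0)) addr0 fpk.
    have -> : f (h + p) = k by near: h; move: fk; apply: filterS => h /=; rewrite subr0.
    by rewrite subrr.
  by rewrite normr0 mulr_ge0// ltW.
have d0 : ('d f p : V -> W) = 0 by apply/diff_unique => //; exact: cst_continuous.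
by apply/diff_locallyP; rewrite d0; split => //; exact: cst_continuous.
Unshelve. all: by end_near. Qed.

(** * From differentiability in two variables to partial derivatives *)

Section complex_differentiable.
Local Open Scope complex_scope.
Variable R : realType.
Variable f : R[i] * R[i] -> R[i].

Lemma nbhs_bidiskP (z w : R[i]) (A : set (R[i] * R[i])) : nbhs (z, w) A -> exists2 d : R, 0 < d &
  forall z' w', cmod (z' - z) < d -> cmod (w' - w) < d -> A (z', w').
Proof.
move=> [[B C] [/= /cnbhsP[d1 d10 B1] /cnbhsP[d2 d20 C2]] BC].
exists (Num.min d1 d2) => [|z' w']; first by rewrite lt_min d10.
by rewrite !lt_min => /andP[z1 _] /andP[_ w2]; apply: BC; split; [exact: B1|exact: C2].
Qed.

Lemma differentiable_ccontinuous (z w : R[i]) (e : R) : differentiable f (z, w) -> 0 < e ->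
  exists2 d : R, 0 < d & forall z' w', cmod (z' - z) < d -> cmod (w' - w) < d ->
    cmod (f (z', w') - f (z, w)) < e.
Proof.
move=> /differentiable_continuous fc e0; apply: (@nbhs_bidiskP z w [set p | cmod (f p - f (z,
  w)) < e]).
have nb : nbhs (f (z, w)) [set x | cmod (x - f (z, w)) < e] by apply/cnbhsP; exists e.
exact: fc nb.
Qed.

Lemma derivable_cderiv (p v : R[i] * R[i]) : derivable f p v ->
  exists A, cderiv (fun h => f (h *: v + p)) 0 A.
Proof.
move=> /cvg_ex[A hA]; exists A => e e0.
have nb : nbhs A [set x | cmod (x - A) < e] by apply/cnbhsP; exists e.
have /cnbhsP[d d0 hd] := hA _ nb; exists d => // h; rewrite !subr0 => hd'.
have [->|h0] := eqVneq h 0; first by rewrite scale0r add0r subrr mulr0 subrr cmod0 mulr0.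
have := hd h; rewrite subr0 => /(_ hd' h0) /= /ltW H.
rewrite scale0r add0r (_ : _ - _ = h * (h^-1 *: (f (h *: v + p) - f p) - A)).
  by rewrite cmodM mulrC ler_wpM2r ?cmod_ge0.
by rewrite mulrBr [X in _ = X - _](mulVKf h0) [h * A]mulrC.
Qed.

Lemma cderiv_shift (h : R[i] -> R[i]) (z A : R[i]) : cderiv (fun t => h (t + z)) 0 A ->
  cderiv h z A.
Proof.
move=> hA e /hA[d d0 hd]; exists d => // z' zz'; have := hd (z' - z).
by rewrite !subr0 subrK add0r; apply.
Qed.

Lemma differentiable_cderiv1 (z w : R[i]) : differentiable f (z, w) ->
  exists A, cderiv (fun z' => f (z', w)) z A.
Proof.
move=> df; have [A hA] := derivable_cderiv (@diff_derivable R[i] (R[i] * R[i])%type R[i] f (z,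
  w) (1, 0) df); exists A.
apply: cderiv_shift; move: hA; congr cderiv; apply/funext => h.
by congr (f (_, _)); rewrite /= ?[_ *: _]mulr1 ?scaler0 ?add0r.
Qed.

Lemma differentiable_cderiv2 (z w : R[i]) : differentiable f (z, w) ->
  exists A, cderiv (fun w' => f (z, w')) w A.
Proof.
move=> df; have [A hA] := derivable_cderiv (@diff_derivable R[i] (R[i] * R[i])%type R[i] f (z,
  w) (0, 1) df); exists A.
apply: cderiv_shift; move: hA; congr cderiv; apply/funext => h.
by congr (f (_, _)); rewrite /= ?[_ *: _]mulr1 ?scaler0 ?add0r.
Qed.

Lemma cderiv_near (h g : R[i] -> R[i]) (z A : R[i]) (d : R) : 0 < d ->
  (forall z', cmod (z' - z) < d -> h z' = g z') -> cderiv g z A -> cderiv h z A.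
Proof.
move=> d0 hg gA e /gA[d' d'0 hd']; exists (Num.min d d') => [|z'].
  by rewrite lt_min d0.
rewrite lt_min => /andP[zd zd']; rewrite !hg ?subrr ?cmod0//.
exact: hd'.
Qed.

Lemma bidisk_nbhs (z w : R[i]) : cmod z < 1 -> cmod w < 1 ->
  nbhs (z, w) [set p | cmod p.1 < 1 /\ cmod p.2 < 1].
Proof.
have H (x : R[i]) : cmod x < 1 -> nbhs x [set y | cmod y < 1].
  move=> x1; apply/cnbhsP; exists (1 - cmod x); first by rewrite subr_gt0.
  by move=> y xy; rewrite /= -[y](subrK x) (le_lt_trans (cmodD _ _))// -ltrBrDr.
by move=> z1 w1; exists ([set y | cmod y < 1], [set y | cmod y < 1]); [split; exact: H|move=> p []].
Qed.

End complex_differentiable.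

(** * Bounded energy forces independence of the first variable *)

Section liouville.
Local Open Scope complex_scope.
Variables (R : realType) (G : fuchsian R).
Hypothesis cov : covering_action G.
Hypothesis cpt : compact [set: surface G].

Section holomorphic.
Variable F : R[i] -> R[i] -> R[i].
Hypothesis F_out : forall z w, ~~ (in_disk z && in_disk w) -> F z w = 0.
Hypothesis F_continuous : jointly_continuous F.
Hypothesis holo1 : forall w, cmod w < 1 -> holo (fun z => F z w).
Hypothesis holo2 : forall z, cmod z < 1 -> holo (F z).
Hypothesis FG : forall g, G g -> forall z w : disk R,
  F (set_val (g z)) (set_val (g w)) = F (set_val z) (set_val w).

Lemma continuous_Re_measurable : cmeasurable2 (fun z w => complex.Re (F z w)).
Proof.
have -> : (fun z w => complex.Re (F z w)) =
    (fun z w => if in_disk z && in_disk w then complex.Re (F z w) else 0).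
  by apply/funext => z; apply/funext => w; case: ifPn => // /F_out ->.
apply: continuous_cmeasurable2 => z w z1 w1 e e0.
have [d d0 hd] := F_continuous z1 w1 e0; exists d => // z' w' zz' ww'.
apply: le_lt_trans (hd _ _ zz' ww'); apply: le_trans (normr_Re_cmod _).
by case: (F z' w') (F z w) => [? ?] [? ?].
Qed.

Lemma continuous_Im_measurable : cmeasurable2 (fun z w => complex.Im (F z w)).
Proof.
have -> : (fun z w => complex.Im (F z w)) =
    (fun z w => if in_disk z && in_disk w then complex.Im (F z w) else 0).
  by apply/funext => z; apply/funext => w; case: ifPn => // /F_out ->.
apply: continuous_cmeasurable2 => z w z1 w1 e e0.
have [d d0 hd] := F_continuous z1 w1 e0; exists d => // z' w' zz' ww'.
apply: le_lt_trans (hd _ _ zz' ww'); apply: le_trans (normr_Im_cmod _).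
by case: (F z' w') (F z w) => [? ?] [? ?].
Qed.

Let mRe := continuous_Re_measurable.
Let mIm := continuous_Im_measurable.

Lemma cmeasurable2_cmod2 : cmeasurable2 (fun z w => cmod2 (F z w)).
Proof.
rewrite /cmeasurable2 (_ : (fun p => _) = (fun p : _ * _ =>
  (complex.Re (F (cx p.1) (cx p.2)) ^+ 2 + complex.Im (F (cx p.1) (cx p.2)) ^+ 2)%:E)).
  apply/measurable_EFinP; apply: measurable_funD; exact: measurable_funX.
by apply/funext => p; rewrite /cmod2 cmod_sqr.
Qed.

Let mF2 := cmeasurable2_cmod2.

Definition mean_cmod2 (Psi : R[i] -> R[i] -> \bar R) z := hint (fun w => Psi z w * cmod2 (F z w))%E.

Lemma mean_cmod2_ge0 Psi z : radial_kernel Psi -> (0 <= mean_cmod2 Psi z)%E.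
Proof.
by move=> kP; apply: hint_ge0 => w; rewrite mule_ge0 ?cmod2_ge0 ?(kernel_ge0 kP).
Qed.

Lemma mean_cmod2_measurable Psi : radial_kernel Psi -> cmeasurable (mean_cmod2 Psi).
Proof.
move=> kP; apply: (cmeasurable_hint (k := fun z w => Psi z w * cmod2 (F z w))%E).
  by apply: emeasurable_funM => //; exact: (kernel_measurable kP).
by move=> z w; rewrite mule_ge0 ?cmod2_ge0 ?(kernel_ge0 kP).
Qed.

(** The assumed bound lives on the Dirichlet domain; [unfolding_le] carries it to the strict
    fundamental domain that [variation_eq0] requires. *)
Lemma dirichlet_energy_diag (C : \bar R) : (C < +oo)%E ->
  (forall Psi, radial_kernel Psi ->
    (hint (fun z => dirichlet_indic G z * mean_cmod2 Psi z) <= C)%E) ->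
  forall z v, cmod z < 1 -> cmod v < 1 -> F v z = F z z.
Proof.
move=> Coo CP.
have [a [T [T' [I [[Tm T'm] TK [mI I0] [IT IT'] [GT TG]]]]]] := fuchsian_unfolding cov.
have FT n z w : a n -> cmod z < 1 -> cmod w < 1 -> F (T n z) (T n w) = F z w.
  move=> _ /disk_lift[y <-] /disk_lift[x <-]; have [g Gg gE] := GT n.
  by rewrite -!gE; exact: FG.
have C_ub Psi : radial_kernel Psi -> (energy I F Psi <= C)%E.
  move=> kP; apply: le_trans (CP _ kP).
  apply: (unfolding_le Tm T'm TK mI I0 IT').
  - exact: mean_cmod2_measurable.
  - by move=> z; exact: mean_cmod2_ge0.
  - move=> n z an z1; have [c [d [cd Tn]]] := Tm n.
    have mk : cmeasurable (fun w => Psi (T n z) w * cmod2 (F (T n z) w))%E.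
      apply: emeasurable_funM; last exact: (cmeasurable_section (T n z) mF2).
      exact: (cmeasurable_section (T n z) (kernel_measurable kP)).
    have k0 w : (0 <= Psi (T n z) w * cmod2 (F (T n z) w))%E.
      by rewrite mule_ge0 ?cmod2_ge0 ?(kernel_ge0 kP).
    rewrite /mean_cmod2 -(hint_mob cd mk k0); apply: eq_hint => w w1.
    by rewrite -Tn FT// Tn (kernel_mob kP).
  - exact: dirichlet_indic_measurable.
  - exact: dirichlet_indic_ge0.
  - move=> z /disk_lift[y <-]; have [g Gg gmin] := dirichlet_exists cov y.
    have [n an gE] := TG g Gg; exists n => //; rewrite -gE dirichlet_indicE// => h Gh.
    exact: (gmin (h \o g) (fuchsian_comp Gh Gg)).
apply: (variation_eq0_const mRe mIm F_continuous) => s s0 s1.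
exact: (variation_eq0 Tm T'm TK mI I0 IT IT' mRe mIm holo1 holo2 FT Coo C_ub s0 s1).
Qed.

Lemma bounded_diag (M : R) : (forall z w, cmod z < 1 -> cmod w < 1 -> cmod (F z w) <= M) ->
  forall z v, cmod z < 1 -> cmod v < 1 -> F v z = F z z.
Proof.
move=> FM; have mD := dirichlet_indic_measurable cov; have D0 := @dirichlet_indic_ge0 R G.
have M20 : (0 <= (M ^+ 2)%:E :> \bar R)%E by rewrite lee_fin sqr_ge0.
apply: (dirichlet_energy_diag (C := (M ^+ 2)%:E * hint (dirichlet_indic G))%E).
  by rewrite lte_mul_pinfty// dirichlet_area.
move=> Psi kP; rewrite -hintZl//; apply: le_hint.
- by apply: emeasurable_funM => //; exact: mean_cmod2_measurable.
- exact: emeasurable_funM.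
- by move=> z; rewrite mule_ge0 ?mean_cmod2_ge0.
- by move=> z; rewrite mule_ge0.
move=> z z1; rewrite muleC lee_wpmul2r//.
rewrite -[leRHS]mule1 -(kernel_mass kP z1).
have mP : cmeasurable (Psi z) by exact: cmeasurable_section (kernel_measurable kP).
have P0 w : (0 <= Psi z w)%E by exact: (kernel_ge0 kP).
rewrite -(hintZl mP P0 M20); apply: le_hint.
- by apply: emeasurable_funM => //; exact: cmeasurable_section mF2.
- exact: emeasurable_funM.
- by move=> w; rewrite mule_ge0 ?cmod2_ge0.
- by move=> w; rewrite mule_ge0.
move=> w w1; rewrite muleC lee_wpmul2r// lee_fin lerXn2r ?nnegrE ?cmod_ge0 ?FM//.
exact: le_trans (cmod_ge0 _) (FM z w z1 w1).
Qed.

End holomorphic.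

End liouville.

(** * Constancy of bounded and of Hardy functions *)

Section hardy.
Local Open Scope complex_scope.
Variables (R : realType) (G : fuchsian R).
Hypothesis cov : covering_action G.
Hypothesis cpt : compact [set: surface G].

(** Since F v z = F z z, a bound on the diagonal is a bound everywhere; the transposed function is
    thus bounded and also independent of its first variable. *)
Lemma diag_constant (F : R[i] -> R[i] -> R[i]) (M : R) :
  (forall z w, ~~ (in_disk z && in_disk w) -> F z w = 0) ->
  jointly_continuous F ->
  (forall w, cmod w < 1 -> holo (fun z => F z w)) ->
  (forall z, cmod z < 1 -> holo (F z)) ->
  (forall g, G g -> forall z w : disk R,
    F (set_val (g z)) (set_val (g w)) = F (set_val z) (set_val w)) ->
  (forall z v, cmod z < 1 -> cmod v < 1 -> F v z = F z z) ->
  (forall z, cmod z < 1 -> cmod (F z z) <= M) ->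
  forall z w, cmod z < 1 -> cmod w < 1 -> F z w = F 0 0.
Proof.
move=> F_out Fc h1 h2 FG diag FM z w z1 w1.
have o1 : cmod (0 : R[i]) < 1 by rewrite cmod0.
have swap x y : cmod x < 1 -> cmod y < 1 -> F x y = F x x.
  move=> x1 y1.
  have G_out u v : ~~ (in_disk u && in_disk v) -> F v u = 0 by rewrite andbC; exact: F_out.
  have G_cont : jointly_continuous (fun z w => F w z).
    move=> u v u1 v1 e e0; have [d d0 hd] := Fc v u v1 u1 e e0.
    by exists d => // u' v' uu' vv'; exact: hd.
  have GG g : G g -> forall u v : disk R,
      F (set_val (g v)) (set_val (g u)) = F (set_val v) (set_val u).
    by move=> Gg u v; exact: FG.
  apply: (bounded_diag cov cpt G_out G_cont h2 h1 GG) => // u v u1 v1.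
  by rewrite diag//; exact: FM.
(* F z w = F z z = F z 0 by independence of the second variable, and F z 0 = F 0 0 by independence
   of the first. *)
by rewrite swap// -(swap z 0)// diag.
Qed.

Section holomorphic.
Variable f : R[i] * R[i] -> R[i].
Hypothesis fO : holo_Omega G f.
Local Notation F := (bidisk_fun f).

Let F_out z w : ~~ (in_disk z && in_disk w) -> F z w = 0.
Proof. by rewrite /bidisk_fun => /negbTE ->. Qed.

Let F_cont : jointly_continuous F.
Proof.
move=> z w z1 w1 e e0.
have [d d0 hd] := differentiable_ccontinuous (fO.1 z w z1 w1) e0.
have [d' d'0 hd'] := nbhs_bidiskP (bidisk_nbhs z1 w1).
exists (Num.min d d') => [|z' w']; first by rewrite lt_min d0.
rewrite !lt_min => /andP[zd zd'] /andP[wd wd'].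
have [/= z'1 w'1] := hd' _ _ zd' wd'.
by rewrite !bidisk_funE//; exact: hd.
Qed.

Let F_holo1 w : cmod w < 1 -> holo (fun z => F z w).
Proof.
move=> w1 z z1; have [A hA] := differentiable_cderiv1 (fO.1 z w z1 w1); exists A.
have [d d0 hd] := nbhs_bidiskP (bidisk_nbhs z1 w1).
apply: (cderiv_near d0 _ hA) => z' zz'.
have [|/= z'1 _] := hd z' w zz'; first by rewrite subrr cmod0.
by rewrite bidisk_funE.
Qed.

Let F_holo2 z : cmod z < 1 -> holo (F z).
Proof.
move=> z1 w w1; have [A hA] := differentiable_cderiv2 (fO.1 z w z1 w1); exists A.
have [d d0 hd] := nbhs_bidiskP (bidisk_nbhs z1 w1).
apply: (cderiv_near d0 _ hA) => w' ww'.
have [|/= _ w'1] := hd z w' _ ww'; first by rewrite subrr cmod0.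
by rewrite bidisk_funE.
Qed.

Let FG g : G g -> forall z w : disk R,
  F (set_val (g z)) (set_val (g w)) = F (set_val z) (set_val w).
Proof. by move=> Gg z w; rewrite !bidisk_funE ?cmod_set_val//; exact: fO.2. Qed.

Lemma bidisk_fun_constant k :
  (forall z w, cmod z < 1 -> cmod w < 1 -> F z w = k) -> constant_on_bidisk f.
Proof. by move=> Fk; exists k => z w z1 w1; rewrite -(Fk z w)// bidisk_funE. Qed.

Lemma bounded_constant : bounded_on_bidisk f -> constant_on_bidisk f.
Proof.
move=> [M fM]; have FM z w : cmod z < 1 -> cmod w < 1 -> cmod (F z w) <= M.
  by move=> z1 w1; rewrite bidisk_funE//; exact: fM.
apply: (@bidisk_fun_constant (F 0 0)).
apply: (@diag_constant F M) => //.
  exact: (bounded_diag cov cpt F_out F_cont F_holo1 F_holo2 FG FM).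
by move=> z z1; exact: FM.
Qed.

(** The sublevel sets of |F(z, z)| are invariant and exhaust the disk locally, so [surface_uniform]
    applies. *)
Lemma diag_bounded : exists M : R, forall z, cmod z < 1 -> cmod (F z z) <= M.
Proof.
pose A (n : nat) := [set z : disk R | cmod (F (set_val z) (set_val z)) <= n%:R].
have [n An] : exists n, forall z, A n z.
  apply: (@surface_uniform _ G A cpt) => [n g z Gg|n m nm z|z].
  - by rewrite /A /= FG.
  - by move=> /le_trans; apply; rewrite ler_nat.
  - have z1 := cmod_set_val z; have [d d0 hd] := F_cont z1 z1 ltr01.
    pose y := cmod (F (set_val z) (set_val z)) + 1.
    have y0 : 0 <= y by rewrite addr_ge0 ?cmod_ge0.
    exists (Num.bound y), d => // z' zz'; apply: ltW; apply: lt_trans (archi_boundP y0).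
    have := hd _ _ zz' zz'; have := cmodD (F (set_val z) (set_val z))
      (F (set_val z') (set_val z') - F (set_val z) (set_val z)).
    by rewrite subrKC /y => H1 H2; apply: le_lt_trans H1 _; rewrite ltrD2l.
by exists n%:R => z /disk_lift[y <-]; exact: An.
Qed.

Lemma hardy_constant c : taylor_expansion f c -> (hardy_norm2 G c < +oo)%E ->
  constant_on_bidisk f.
Proof.
move=> fc; rewrite /hardy_norm2.
have mD := dirichlet_indic_measurable cov; have D0 := @dirichlet_indic_ge0 R G.
have mRe := continuous_Re_measurable F_out F_cont.
have mIm := continuous_Im_measurable F_out F_cont.
have mcoef n : cmeasurable (fun z => cmod2 (coef c n z)).
  by apply: plane_map_cmod2; exact: (plane_map_coef mRe mIm fc).
have coefE n z : cmod z < 1 -> coef c n z = c n z by rewrite /coef /in_disk => ->.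
pose S := (\sum_(0 <= n <oo) hint (fun z => dirichlet_indic G z * cmod2 (coef c n z)))%E.
have -> : (\sum_(0 <= n <oo) diff_L2norm2 G n (assoc_diff c n) = S)%E.
  apply: eq_eseriesr => n _; rewrite diff_L2norm2_assoc.
  by apply: eq_hint => z z1; rewrite coefE.
have h0 n z : (0 <= dirichlet_indic G z * cmod2 (coef c n z))%E by rewrite mule_ge0 ?cmod2_ge0.
have S0 : (0 <= S)%E by apply: nneseries_ge0 => n _ _; apply: hint_ge0.
move=> piS; have Soo : (S < +oo)%E.
  by move: piS; case: (S) S0 => [r| |]// _; rewrite ?ltry// gt0_muley// lte_fin pi_gt0.
have [M FM] := diag_bounded.
apply: (@bidisk_fun_constant (F 0 0)).
apply: (@diag_constant F M) => //.
apply: (dirichlet_energy_diag cov F_out F_cont F_holo1 F_holo2 FG Soo) => Psi kP.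
have mh n : cmeasurable (fun z => dirichlet_indic G z * cmod2 (coef c n z))%E.
  by apply: emeasurable_funM; [exact: mD|exact: mcoef].
(* The comparison is made pointwise in z, before integrating, where [taylor_energy] applies. *)
rewrite /S -(hint_nneseries mh h0); apply: le_hint.
- by apply: emeasurable_funM => //; exact: (mean_cmod2_measurable F_out F_cont).
- by apply: ge0_emeasurable_sum => [n p _ _|n _]; [exact: h0|exact: mh].
- by move=> z; rewrite mule_ge0 ?mean_cmod2_ge0.
- by move=> z; apply: nneseries_ge0 => n _ _; exact: h0.
move=> z z1; rewrite nneseriesZl_ereal//; last by move=> n; exact: cmod2_ge0.
apply: lee_wpmul2l => //; apply: le_trans (taylor_energy mRe mIm fc kP z1) _.
rewrite le_eqVlt; apply/orP; left; apply/eqP.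
by apply: eq_eseriesr => n _; rewrite coefE.
Qed.

End holomorphic.

Lemma constant_hardy (f : R[i] * R[i] -> R[i]) : constant_on_bidisk f -> hardy_space G f.
Proof.
move=> [k fk]; split.
  split=> [z w z1 w1|g Gg z w]; last by rewrite !fk; [|exact: cmod_set_val..].
  apply: (@near_cst_differentiable _ _ _ f (z, w) k).
  by apply: filterS (bidisk_nbhs z1 w1) => -[x y] /= [x1 y1]; exact: fk.
(* Only the term of degree 0 survives, so partial sums are constant from index 1 on and the norm is
   |k|^2 times a finite area, up to the factor pi. *)
exists (fun n _ => if n is 0%N then k else 0).
  move=> z w z1 w1; rewrite fk//; apply: cvg_near_cst; exists 1%N => // -[//|n] _.
  rewrite /series /= big_nat_recl// expr0 mulr1 big1_seq ?addr0// => i _.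
  by rewrite mul0r.
have mD := dirichlet_indic_measurable cov; have D0 := @dirichlet_indic_ge0 R G.
rewrite /hardy_norm2 (@nneseriesD1 _ _ 0%N)//; last first.
  by move=> n _; rewrite diff_L2norm2_assoc; apply: hint_ge0 => z; rewrite mule_ge0 ?cmod2_ge0.
rewrite [X in (_ + X)%E]eseries0 ?adde0; last first.
  move=> n _; case: n => [//|n] _; rewrite diff_L2norm2_assoc.
  by rewrite /hint integral0_eq// => p _; rewrite /cmod2 cmod0 expr0n !mule0.
rewrite diff_L2norm2_assoc.
have -> : hint (fun z => dirichlet_indic G z * cmod2 k)%E = (cmod2 k * hint (dirichlet_indic G))%E.
  rewrite -hintZl ?cmod2_ge0//; apply: eq_hint => z _; exact: muleC.
rewrite lte_mul_pinfty ?lee_fin ?pi_ge0// lte_mul_pinfty ?cmod2_ge0//.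
exact: dirichlet_area.
Qed.

End hardy.

Theorem corollary2 (R : realType) (G : fuchsian R)
    (cov : covering_action G) (cpt : compact [set: surface G]) :
  hardy_space G = [set f | constant_on_bidisk f] /\
  (forall f : R[i] * R[i] -> R[i],
    holo_Omega G f -> bounded_on_bidisk f -> constant_on_bidisk f).
Proof.
split=> [|f fO fb]; last exact: (bounded_constant cov cpt fO fb).
apply/seteqP; split=> f /=; last exact: constant_hardy.
by move=> [fO [c fc fin]]; exact: (hardy_constant cov cpt fO fc fin).
Qed.
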